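(* Let $n\ge1$, $k\ge0$, $m=2n+k$. The map $f\colon\mathbb{S}(W_{n,k})\to|\operatorname{Hom}(K_2,SG_{n,k})|$ described below is a $D_{2m}$-homotopy equivalence (i.e. there is a $D_{2m}$-equivariant map in the other direction such that both composites are $D_{2m}$-equivariantly homotopic to the identities).
   Context: Graphs: vertex set with symmetric adjacency relation. For $m=2n+k$, $SG_{n,k}$ has vertices the $n$-subsets of $\mathbb{Z}_m$ containing no pair $\{i,i+1\}$ (mod $m$), adjacent iff disjoint; $K_2$ has vertices $\{0,1\}$. $\operatorname{Hom}(G,H)$ is the poset of functions $f$ from $V(G)$ to nonempty subsets of $V(H)$ with $f(u)\times f(v)\subseteq E(H)$ for all $(u,v)\in E(G)$, ordered by pointwise inclusion; $|\cdot|$ is the realization of the order complex. $D_{2m}=\langle\sigma,\rho\mid\rho^2=\sigma^m=(\sigma\rho)^2=1\rangle$ acts on $SG_{n,k}$ by $S\cdot\sigma=S+1$, $S\cdot\rho=-S$, hence on $\operatorname{Hom}(K_2,SG_{n,k})$. With $R_\phi$ the rotation of $\mathbb{R}^2\cong\mathbb{C}$ by angle $\phi$, $W_{n,k}$ is $\mathbb{R}^{k+1}$ with right $D_{2m}$-action: for $k=2r$, identifying $\mathbb{R}^{k+1}=\mathbb{R}\times\mathbb{C}^r$, $x\cdot\sigma=-\operatorname{diag}(1,R_{2\pi/m},R_{4\pi/m},\dots,R_{2r\pi/m})x$ and $\rho$ acts by $(x_0,z_1,\dots,z_r)\mapsto(x_0,\bar z_1,\dots,\bar z_r)$; for $k=2r+1$,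 identifying $\mathbb{R}^{k+1}=\mathbb{C}^{r+1}$, $x\cdot\sigma=-\operatorname{diag}(R_{\pi/m},R_{3\pi/m},\dots,R_{(2r+1)\pi/m})x$ and $\rho$ acts by complex conjugation of all coordinates. The map $f$: for $k=2r$ put $\xi=e^{2\pi i/m}$ and $v_j=(1,\xi^j,\xi^{2j},\dots,\xi^{rj})\in\mathbb{R}\times\mathbb{C}^r$; for $k=2r+1$ put $\xi=e^{\pi i/m}$ and $v_j=(\xi^j,\xi^{3j},\dots,\xi^{(2r+1)j})\in\mathbb{C}^{r+1}$ ($0\le j<m$), with $\langle\cdot,\cdot\rangle$ the standard real inner product. The sign vectors $s(x)=(\operatorname{sign}\langle x,v_j\rangle)_{0\le j<m}$, $x\in\mathbb{S}(W_{n,k})$, form a poset $\mathcal L$ (order induced by $0<+1$, $0<-1$ coordinatewise), which is the face poset of a regular cell decomposition of the sphere whose open cells are the sets $\{x: s(x)=s\}$. For $s\in\mathcal L$ and $l\in\{0,1\}$ let $S_l(s)=\{j:(-1)^js_j=(-1)^l\}$; the order preserving map $g\colon\mathcal L\to\operatorname{Hom}(K_2,SG_{n,k})$, $g(s)(l)=\{T\in V(SG_{n,k}):T\subseteq S_l(s)\}$, induces via $\mathbb{S}(W_{n,k})\cong|\mathcal L|$ (barycentric subdivision) the continuous map $f=|g|$. *)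

(* Defs.v *)
From mathcomp Require Import all_boot all_order all_algebra.
From mathcomp Require Import all_classical all_reals all_analysis.
From mathcomp Require Import complex.

Set Implicit Arguments.
Unset Strict Implicit.
Unset Printing Implicit Defensive.

Import Order.TTheory GRing.Theory Num.Theory.
Import numFieldNormedType.Exports.

Local Open Scope ring_scope.

Record graph := Graph {
  vertex :> finType;
  adj : rel vertex;
  adj_sym : symmetric adj }.

Lemma K2_sym : symmetric (fun u v : 'I_2 => u != v).
Proof. by move=> u v; rewrite eq_sym. Qed.

Definition K2 : graph := Graph K2_sym.

(* ['Z_m] is Z/m only for m >= 2, and its elements are then the ordinals
   0, ..., m - 1; every use below has m = 2n + k with n >= 1. *)
Definition no_adjacent_pair (m : nat) (S : {set 'Z_m}) : bool :=
  [forall i, ~~ ((i \in S) && (i + 1 \in S))].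

Section StableKneser.
Variables n k : nat.
Local Notation m := (2 * n + k)%N.

Definition stable_subset (S : {set 'Z_m}) : bool :=
  (#|S| == n) && no_adjacent_pair S.

Definition SG_vertex : finType := {S : {set 'Z_m} | stable_subset S}.

Lemma SG_sym : symmetric (fun S T : SG_vertex => [disjoint val S & val T]).
Proof. by move=> S T; rewrite disjoint_sym. Qed.

Definition SG : graph := Graph SG_sym.

Definition shift_set (S : {set 'Z_m}) : {set 'Z_m} := [set i + 1 | i in S].
Definition opp_set (S : {set 'Z_m}) : {set 'Z_m} := [set - i | i in S].

Lemma SG_sigma_subproof (S : SG_vertex) :
  stable_subset (shift_set (val S)).
Proof.
have inj1 : injective (fun i : 'Z_m => i + 1) by exact: addIr.
case: S => S /= /andP[/eqP cS /forallP nS].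
rewrite /stable_subset card_imset // cS eqxx /=; apply/forallP => j.
rewrite -[j](subrK 1) /shift_set !(mem_imset _ _ inj1); exact: nS.
Qed.

Lemma SG_rho_subproof (S : SG_vertex) :
  stable_subset (opp_set (val S)).
Proof.
have injN : injective (fun i : 'Z_m => - i) by exact: oppr_inj.
case: S => S /= /andP[/eqP cS /forallP nS].
rewrite /stable_subset card_imset // cS eqxx /=; apply/forallP => i.
have := nS (- (i + 1)); rewrite opprD subrK andbC.
have memN (j : 'Z_m) : (j \in opp_set S) = (- j \in S).
  by rewrite -[j in LHS]opprK /opp_set (mem_imset _ _ injN).
by rewrite !memN opprD.
Qed.

Definition SG_sigma (S : SG) : SG :=
  exist (fun T => is_true (stable_subset T)) _ (SG_sigma_subproof S).
Definition SG_rho (S : SG) : SG :=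
  exist (fun T => is_true (stable_subset T)) _ (SG_rho_subproof S).

End StableKneser.

Definition Hom (G H : graph) : {set {ffun G -> {set H}}} :=
  finset (fun f : {ffun G -> {set H}} =>
    [forall u, f u != finset.set0] &&
    [forall u, forall v, adj u v ==>
       [forall a in f u, forall b in f v, adj a b]]).

Definition Hom_le (G H : graph) (f g : {ffun G -> {set H}}) : bool :=
  [forall u, f u \subset g u].

Definition Hom_map (G H H' : graph) (a : H -> H') (f : {ffun G -> {set H}}) :
    {ffun G -> {set H'}} :=
  [ffun u => a @: f u].

Section HomTheory.
Variables G H : graph.

Lemma Hom_map_Hom (a : H -> H) (h : {ffun G -> {set H}}) :
  (forall u v, adj u v -> adj (a u) (a v)) -> h \in Hom G H ->
  Hom_map a h \in Hom G H.
Proof.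
move=> ha; rewrite !inE => /andP[/forallP h0 /forallP hadj]; apply/andP; split.
  apply/forallP => u; rewrite ffunE; have /set0Pn[x xh] := h0 u.
  by apply/set0Pn; exists (a x); apply: imset_f.
apply/forallP => u; apply/forallP => w; apply/implyP => uw; rewrite !ffunE.
have /forallP/(_ w)/implyP/(_ uw)/forall_inP hh := hadj u.
apply/forall_inP => _ /imsetP[x xu ->]; apply/forall_inP => _ /imsetP[y yw ->].
by apply: ha; have /forall_inP := hh x xu; apply.
Qed.

Lemma Hom_map_le (a : H -> H) (h h' : {ffun G -> {set H}}) :
  Hom_le h h' -> Hom_le (Hom_map a h) (Hom_map a h').
Proof.
by move=> /forallP hh; apply/forallP => u; rewrite !ffunE imsetS.
Qed.

Lemma Hom_map_comp (a b : H -> H) :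
  Hom_map (G := G) a \o Hom_map b = Hom_map (a \o b).
Proof.
by apply/funext => h; apply/ffunP => u; rewrite /= !ffunE -imset_comp.
Qed.

Lemma Hom_map_id : Hom_map (id : H -> H) = (id : {ffun G -> {set H}} -> _).
Proof. by apply/funext => h; apply/ffunP => u; rewrite ffunE imset_id. Qed.

End HomTheory.

Section SGTheory.
Variables n k : nat.
Local Notation m := (2 * n + k)%N.

Lemma SG_sigma_adj (S T : SG n k) : adj S T -> adj (SG_sigma S) (SG_sigma T).
Proof.
rewrite /= -!setI_eq0 /shift_set -imsetI; last by move=> x y _ _; apply: addIr.
by rewrite imset_eq0.
Qed.

Lemma SG_rho_adj (S T : SG n k) : adj S T -> adj (SG_rho S) (SG_rho T).
Proof.
rewrite /= -!setI_eq0 /opp_set -imsetI; last by move=> x y _ _; apply: oppr_inj.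
by rewrite imset_eq0.
Qed.

Lemma SG_rhoK : @SG_rho n k \o @SG_rho n k = id.
Proof.
apply/funext => S; apply: val_inj => /=; rewrite /opp_set -imset_comp.
by rewrite -[RHS]imset_id; apply: eq_imset => i /=; rewrite opprK.
Qed.

Lemma SG_relation :
  ((@SG_rho n k \o @SG_sigma n k) \o @SG_rho n k) \o @SG_sigma n k = id.
Proof.
apply/funext => S; apply: val_inj => /=; rewrite /opp_set /shift_set.
rewrite -!imset_comp -[RHS]imset_id; apply: eq_imset => i /=.
by rewrite opprD opprK addrK.
Qed.

Lemma SG_sigma_iter : (0 < n)%N -> iter m (@SG_sigma n k) = id.
Proof.
move=> n0; apply/funext => S; apply: val_inj => /=.
have -> j : val (iter j (@SG_sigma n k) S) = [set i + j%:R | i in val S].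
  elim: j => [|j IH] /=.
    by rewrite -[LHS]imset_id; apply: eq_imset => i; rewrite addr0.
  rewrite IH /shift_set -imset_comp; apply: eq_imset => i /=.
  by rewrite -addrA -natr1.
rewrite -[RHS]imset_id; apply: eq_imset => i.
by rewrite pchar_Zp ?addr0 //; case: (n) n0 => // n' _; rewrite mulnS.
Qed.

End SGTheory.

Local Open Scope classical_set_scope.

(* A space is a subset [points] of an ambient topological space, with the
   subspace topology.  A right action of
     D_2m = < sigma, rho | rho^2 = sigma^m = (sigma rho)^2 = 1 >
   is given by the actions of the two generators: [rsigma S x] is x . sigma
   and [rrho S x] is x . rho, so that x . (sigma rho) is
   [rrho S (rsigma S x)]. *)
Record dihedral_space (m : nat) := DihedralSpace {
  ambient : topologicalType;
  points : set ambient;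
  rsigma : ambient -> ambient;
  rrho : ambient -> ambient;
  rsigma_continuous : {within points, continuous rsigma};
  rrho_continuous : {within points, continuous rrho};
  rsigma_points : forall x, points x -> points (rsigma x);
  rrho_points : forall x, points x -> points (rrho x);
  rrhoK : forall x, points x -> rrho (rrho x) = x;
  rsigma_iter : forall x, points x -> iter m rsigma x = x;
  rsigma_rrho_sq : forall x, points x -> rrho (rsigma (rrho (rsigma x))) = x }.

Arguments ambient {m} d.
Arguments points {m} d _.
Arguments rsigma {m} d _.
Arguments rrho {m} d _.

Section DihedralMaps.
Variables (R : realType) (m : nat).

(* Since sigma and rho generate D_2m, commuting with both of them is the same
   as commuting with every element of the group. *)
Definition equivariant (X Y : dihedral_space m)
    (f : ambient X -> ambient Y) : Prop :=
  forall x, points X x ->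
    f (rsigma X x) = rsigma Y (f x) /\ f (rrho X x) = rrho Y (f x).

Arguments equivariant X Y f : clear implicits.

Definition equivariant_map (X Y : dihedral_space m)
    (f : ambient X -> ambient Y) : Prop :=
  [/\ forall x, points X x -> points Y (f x),
      {within points X, continuous f} & equivariant X Y f].

Arguments equivariant_map X Y f : clear implicits.

Definition equivariantly_homotopic (X Y : dihedral_space m)
    (f0 f1 : ambient X -> ambient Y) : Prop :=
  exists H : R * ambient X -> ambient Y,
    [/\ {within `[0, 1] `*` points X, continuous H},
        forall x, points X x -> H (0, x) = f0 x,
        forall x, points X x -> H (1, x) = f1 x,
        forall t x, t \in `[0, 1] -> points X x -> points Y (H (t, x)) &
        forall t, t \in `[0, 1] -> equivariant X Y (fun x => H (t, x))].

Arguments equivariantly_homotopic X Y f0 f1 : clear implicits.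

Definition equivariant_homotopy_equivalence X Y
    (f : ambient X -> ambient Y) : Prop :=
  equivariant_map X Y f /\
  exists g : ambient Y -> ambient X,
    [/\ equivariant_map Y X g,
        equivariantly_homotopic X X (g \o f) id &
        equivariantly_homotopic Y Y (f \o g) id].

End DihedralMaps.

Arguments equivariant {m} X Y f.
Arguments equivariant_map {m} X Y f.
Arguments equivariantly_homotopic R {m} X Y f0 f1.
Arguments equivariant_homotopy_equivalence R {m} X Y f.

Section Realization.
Variable R : realType.

(* The poset consists of the elements of [P], ordered by [le].  A point of the
   realization is given by its barycentric coordinates, so its support is a
   nonempty chain of [P]; as T is finite, the topology is that of a subspace
   of the Euclidean space R^T. *)
Definition realization (T : finType) (le : rel T) (P : {set T}) :
    set {ptws T -> R} :=
  [set p | [/\ forall t, 0 <= p t,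
               \sum_t p t = 1,
               forall t, p t != 0 -> t \in P &
               forall t u, p t != 0 -> p u != 0 -> le t u || le u t]].

Definition realization_map (T U : finType) (phi : T -> U)
    (p : {ptws T -> R}) : {ptws U -> R} :=
  fun u => \sum_(t | phi t == u) p t.

Lemma realization_map_id (T : finType) (p : {ptws T -> R}) :
  realization_map id p = p.
Proof.
by apply/funext => u; rewrite /realization_map (big_pred1 u).
Qed.

Lemma realization_map_comp (T U V : finType) (phi : T -> U) (psi : U -> V)
    (p : {ptws T -> R}) :
  realization_map psi (realization_map phi p) = realization_map (psi \o phi) p.
Proof.
apply/funext => w; rewrite /realization_map.
rewrite (partition_big phi (fun u => psi u == w)) //=.
apply: eq_bigr => u /eqP <-; apply: eq_bigl => t.
by case: (phi t =P u) => [->|]; rewrite ?eqxx ?andbF.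
Qed.

Lemma realization_map_stable (T U : finType) (le : rel T) (le' : rel U)
    (P : {set T}) (Q : {set U}) (phi : T -> U) (p : {ptws T -> R}) :
  {in P, forall t, phi t \in Q} ->
  {in P &, forall t u, le t u -> le' (phi t) (phi u)} ->
  realization le P p -> realization le' Q (realization_map phi p).
Proof.
move=> PQ mono [p0 p1 pP pC].
have suppE u : realization_map phi p u != 0 -> exists2 t, phi t = u & p t != 0.
  move=> /eqP nz; apply: contrapT => h; apply: nz; apply: big1 => t /eqP e.
  by apply/eqP; apply: contrapT => /negP ?; apply: h; exists t.
split.
- by move=> u; apply: sumr_ge0.
- by rewrite -p1 [RHS](partition_big phi predT).
- by move=> u /suppE[t <- /pP]; exact: PQ.
- move=> u u' /suppE[t <- nt] /suppE[t' <- nt'].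
  by case/orP: (pC _ _ nt nt') => h; apply/orP; [left|right]; apply: mono;
    rewrite ?pP.
Qed.

Lemma cvg_ptws (T : Type) (U : topologicalType) (F : set_system (T -> U))
    (h : {ptws T -> U}) : Filter F ->
  (forall t, p t @[p --> F] --> h t) -> F --> h.
Proof.
move=> FF cF; apply/cvg_sup => t A [/= _ [[B oB <-]] Bh] /filterS; apply.
by apply: cF; exact: open_nbhs_nbhs.
Qed.

Lemma realization_map_continuous (T U : finType) (phi : T -> U) :
  continuous (realization_map phi : {ptws T -> R} -> {ptws U -> R}).
Proof.
move=> p.
apply: (@cvg_ptws U R (realization_map phi @ nbhs p)
    (realization_map phi p)) => u.
have addc := (@add_continuous R).
apply: (@cvg_big R T +%R 0 (fun t => phi t == u) addc) => t _.
exact: (@proj_continuous T (fun=> R)).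
Qed.

End Realization.

Section Representation.
Variables (R : realType) (n k : nat).
Local Notation m := (2 * n + k)%N.
Local Notation r := (k./2).
Local Notation C := (R[i]^o).

(* Both R x C^r (k = 2r) and C^(r+1) (k = 2r+1) are realized inside C^(r+1),
   the former as the vectors with real coordinate of index 0. *)
Definition W : set 'rV[C]_r.+1 :=
  [set x | ~~ odd k -> complex.Im (x 0 0) = 0].

Definition inner (x y : 'rV[C]_r.+1) : R :=
  \sum_t complex.Re (x 0 t * (y 0 t)^*%C).

Definition sphereW : set 'rV[C]_r.+1 := W `&` [set x | inner x x = 1].

Definition expi (theta : R) : R[i] := (cos theta +i* sin theta)%C.

(* The coordinate of index t has weight 2t for k even and 2t + 1 for k odd,
   in units of pi / m. *)
Definition angle (t : 'I_r.+1) : R := (t.*2 + odd k)%:R * pi / m%:R.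

Definition W_sigma (x : 'rV[C]_r.+1) : 'rV[C]_r.+1 :=
  \row_t - (expi (angle t) * x 0 t).

Definition W_rho (x : 'rV[C]_r.+1) : 'rV[C]_r.+1 := \row_t (x 0 t)^*%C.

Definition vvec (j : 'Z_m) : 'rV[C]_r.+1 :=
  \row_t expi ((j : nat)%:R * angle t).

End Representation.

Arguments W R k _ : clear implicits.
Arguments sphereW R k _ : clear implicits.
Arguments W_sigma {R} n {k} x.
Arguments vvec R {n k} j.

Section RepresentationTheory.
Variables (R : realType) (n k : nat).
Local Notation m := (2 * n + k)%N.
Local Notation C := (R[i]^o).
Local Notation V := 'rV[C]_(k./2).+1.

Lemma expiD (a b : R) : expi (a + b) = expi a * expi b.
Proof.
by rewrite /expi cosD sinD; apply/eqP; rewrite eq_complex /= eqxx addrC eqxx.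
Qed.

Lemma expi0 : expi (0 : R) = 1.
Proof. by rewrite /expi cos0 sin0. Qed.

Lemma expiJ (a : R) : (expi a)^*%C = expi (- a).
Proof. by rewrite /expi cosN sinN. Qed.

Lemma expi_natpi j : expi (j%:R * pi : R) = (-1) ^+ j.
Proof.
elim: j => [|j IH]; first by rewrite mul0r expi0.
rewrite -natr1 mulrDl expiD IH mul1r exprSr /expi cospi sinpi; congr (_ * _).
by apply/eqP; rewrite eq_complex /= oppr0 !eqxx.
Qed.

Lemma expi_rotJ (a : R) (z w : R[i]) :
  (- (expi a * z)) * (- (expi a * w))^*%C = z * w^*%C.
Proof.
rewrite (rmorphN conjc) (rmorphM conjc) mulrNN mulrACA.
by rewrite [X in _ * X * _]expiJ -expiD subrr expi0 mul1r.
Qed.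

Lemma inner_sigma (x y : V) : inner (W_sigma n x) (W_sigma n y) = inner x y.
Proof.
rewrite /inner; apply: eq_bigr => t _; rewrite !mxE; congr complex.Re.
exact: expi_rotJ.
Qed.

Lemma inner_rho (x y : V) : inner (W_rho x) (W_rho y) = inner x y.
Proof.
rewrite /inner; apply: eq_bigr => t _; rewrite !mxE -rmorphM /=.
by case: (_ * _).
Qed.

Lemma W_sigma_stable (x : V) : sphereW R k x -> sphereW R k (W_sigma n x).
Proof.
move=> [Wx ux]; split; last by rewrite /= inner_sigma.
move=> /= ek; rewrite !mxE /angle (negbTE ek) mul0r mul0r expi0 mul1r.
by have := Wx ek; case: (x 0 0) => a b /= ->; rewrite oppr0.
Qed.

Lemma W_rho_stable (x : V) : sphereW R k x -> sphereW R k (W_rho x).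
Proof.
move=> [Wx ux]; split; last by rewrite /= inner_rho.
move=> /= ek; rewrite !mxE.
by have := Wx ek; case: (x 0 0) => a b /= ->; rewrite oppr0.
Qed.

Lemma W_rhoK (x : V) : W_rho (W_rho x) = x.
Proof. by apply/rowP => t; rewrite !mxE conjcK. Qed.

Lemma W_sigma_iter (x : V) : (0 < n)%N -> iter m (W_sigma n) x = x.
Proof.
move=> n0; have -> j : iter j (W_sigma n) x =
    \row_t ((-1) ^+ j * expi (j%:R * angle R n t) * x 0 t).
  elim: j => [|j IH].
    by apply/rowP => t; rewrite !mxE mul0r expi0 expr0 !mul1r.
  apply/rowP => t; rewrite iterS IH !mxE -natr1 mulrDl mul1r expiD exprS.
  have step (a s b z : R[i]) : - (a * (s * b * z)) = -1 * s * (b * a) * z.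
    by rewrite mulN1r !mulNr [b * a]mulrC !mulrA [s * a]mulrC.
  exact: step.
apply/rowP => t; rewrite !mxE /angle.
rewrite [m%:R * _]mulrC divfK; last first.
  by rewrite pnatr_eq0 addn_eq0 muln_eq0 /= negb_and -lt0n n0.
rewrite expi_natpi -exprD -signr_odd !oddD odd_double /= addbF addbb.
by case: (odd k); rewrite /= ?expr0 mul1r.
Qed.

Lemma W_relation (x : V) : W_rho (W_sigma n (W_rho (W_sigma n x))) = x.
Proof.
have rel (a : R) (z : R[i]) : (- (expi a * (- (expi a * z))^*%C))^*%C = z.
  have cM (u w : R[i]) : (u * w)^*%C = u^*%C * w^*%C by exact: rmorphM.
  have cN (u : R[i]) : (- u)^*%C = - u^*%C by exact: rmorphN.
  by rewrite !(cN, cM) !conjcK mulrN opprK mulrA expiJ -expiD addNr expi0 mul1r.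
by apply/rowP => t; rewrite !mxE; exact: rel.
Qed.

Lemma row_map_continuous (h : 'I_(k./2).+1 -> C -> C) :
  (forall t, continuous (h t)) ->
  continuous (fun x : V => \row_t h t (x 0 t) : V).
Proof.
move=> hc x A [/= P Px sPA].
exists (fun i t => h t @^-1` P i t) => [i t|y /= Py].
  by apply: hc; have := Px i t; rewrite !mxE ord1.
by apply: sPA => i t; rewrite mxE -(ord1 i); exact: Py.
Qed.

Lemma W_sigma_continuous : continuous (W_sigma n : V -> V).
Proof.
have -> : (W_sigma n : V -> V) =
    fun x : V => \row_t ((- expi (angle R n t)) * x 0 t : C).
  by apply/funext => x; apply/rowP => t; rewrite !mxE mulNr.
apply: (@row_map_continuous (fun t (z : C) => (- expi (angle R n t)) * z)) => t.
exact: (@mulrl_continuous (R[i] : numFieldType) _).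
Qed.

Lemma W_rho_continuous : continuous (@W_rho R k : V -> V).
Proof.
apply: (@row_map_continuous (fun t (z : C) => z^*%C)) => t z A.
case=> e /= e0 eA; exists e => //= w zw; apply: eA => /=.
by rewrite -[X in `|X| < _](rmorphB conjc) normcJ.
Qed.

End RepresentationTheory.

(* [None] stands for the sign 0, and [Some b] for (-1)^b. *)
Definition sign_vector (m : nat) := {ffun 'Z_m -> option bool}.

Definition sign_value (a : option bool) : int :=
  if a is Some b then (-1) ^+ b else 0.

(* The order 0 < +1, 0 < -1, taken coordinatewise. *)
Definition sign_le (m : nat) (s t : sign_vector m) : bool :=
  [forall j, (s j == None) || (s j == t j)].

Section TheMap.
Variables (R : realType) (n k : nat).
Local Notation m := (2 * n + k)%N.
Local Notation C := (R[i]^o).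
Local Notation V := 'rV[C]_(k./2).+1.

Definition sign (y : R) : option bool := if y == 0 then None else Some (y < 0).

Definition sgnvec (x : V) : sign_vector m :=
  [ffun j => sign (inner x (vvec R j))].

Definition L : {set sign_vector m} :=
  finset (fun s => `[< exists2 x, sphereW R k x & sgnvec x = s >]).

Definition S_ (l : 'I_2) (s : sign_vector m) : {set 'Z_m} :=
  finset (fun j : 'Z_m => (-1) ^+ (j : nat) * sign_value (s j) == (-1) ^+ l).

Definition g_map (s : sign_vector m) : {ffun K2 -> {set SG n k}} :=
  [ffun l => finset (fun T : SG n k => val T \subset S_ l s)].

(* A choice of a point b(s) in the open cell of each s in [L], such that
   x |-> b(s(x)) commutes with the action of D_2m, i.e. b is equivariant for
   the induced action on [L].  Such choices exist: the v_j span W, so each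
   cell is the trace on the sphere of a convex cone not containing 0, and
   points chosen in these cones can be averaged over the group and
   normalized. *)
Definition barycenters (b : sign_vector m -> V) : Prop :=
  (forall s, s \in L -> sphereW R k (b s) /\ sgnvec (b s) = s) /\
  (forall x, sphereW R k x ->
     b (sgnvec (W_sigma n x)) = W_sigma n (b (sgnvec x)) /\
     b (sgnvec (W_rho x)) = W_rho (b (sgnvec x))).

Definition normalize (y : V) : V := ((Num.sqrt (inner y y))^-1%:C)%C *: y.

(* The homeomorphism |L| -> S(W) given by barycentric subdivision: it sends the
   vertex s to b(s), and is extended linearly over each simplex, followed by
   radial projection to the sphere. *)
Definition subdivision (b : sign_vector m -> V)
    (p : {ptws sign_vector m -> R}) : V :=
  normalize (\sum_s (p s)%:C%C *: b s).

(* |g| composed with the inverse of the subdivision homeomorphism; the default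
   value 0 of the inverse only matters outside of the image. *)
Definition f_map (b : sign_vector m -> V) (x : V) :
    {ptws {ffun K2 -> {set SG n k}} -> R} :=
  realization_map g_map
    ('pinv_(fun=> 0 : sign_vector m -> R) (realization (@sign_le m) L)
       (subdivision b) x).

End TheMap.

Section Spaces.
Variables (R : realType) (n k : nat).
Hypothesis n_gt0 : (0 < n)%N.
Local Notation m := (2 * n + k)%N.

Definition sphere_space : dihedral_space m :=
  DihedralSpace
    (continuous_subspaceT (@W_sigma_continuous R n k))
    (continuous_subspaceT (@W_rho_continuous R k))
    (@W_sigma_stable R n k)
    (@W_rho_stable R k)
    (fun x _ => W_rhoK x)
    (fun x _ => W_sigma_iter x n_gt0)
    (fun x _ => W_relation n x).

(* D_2m acts on Hom(K_2, SG) through its action on SG. *)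
Local Notation HomT := {ffun K2 -> {set SG n k}}.

Definition Hom_realization : set {ptws HomT -> R} :=
  realization (@Hom_le K2 (SG n k)) (Hom K2 (SG n k)).

Definition Hom_sigma : {ptws HomT -> R} -> {ptws HomT -> R} :=
  realization_map (Hom_map (@SG_sigma n k)).

Definition Hom_rho : {ptws HomT -> R} -> {ptws HomT -> R} :=
  realization_map (Hom_map (@SG_rho n k)).

Lemma Hom_sigma_stable p : Hom_realization p -> Hom_realization (Hom_sigma p).
Proof.
apply: realization_map_stable => [h|h h' _ _]; last exact: Hom_map_le.
by apply: Hom_map_Hom; exact: SG_sigma_adj.
Qed.

Lemma Hom_rho_stable p : Hom_realization p -> Hom_realization (Hom_rho p).
Proof.
apply: realization_map_stable => [h|h h' _ _]; last exact: Hom_map_le.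
by apply: Hom_map_Hom; exact: SG_rho_adj.
Qed.

Lemma Hom_rhoK p : Hom_rho (Hom_rho p) = p.
Proof.
by rewrite /Hom_rho realization_map_comp Hom_map_comp SG_rhoK Hom_map_id
  realization_map_id.
Qed.

Lemma Hom_sigma_iter p : iter m Hom_sigma p = p.
Proof.
have -> j : iter j Hom_sigma p =
    realization_map (Hom_map (iter j (@SG_sigma n k))) p.
  elim: j => [|j IH] /=; first by rewrite Hom_map_id realization_map_id.
  by rewrite IH /Hom_sigma realization_map_comp Hom_map_comp.
by rewrite SG_sigma_iter // Hom_map_id realization_map_id.
Qed.

Lemma Hom_relation p : Hom_rho (Hom_sigma (Hom_rho (Hom_sigma p))) = p.
Proof.
by rewrite /Hom_rho /Hom_sigma !realization_map_comp !Hom_map_comp SG_relation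
  Hom_map_id realization_map_id.
Qed.

Definition hom_space : dihedral_space m :=
  DihedralSpace
    (continuous_subspaceT (@realization_map_continuous R _ _ _))
    (continuous_subspaceT (@realization_map_continuous R _ _ _))
    Hom_sigma_stable
    Hom_rho_stable
    (fun p _ => Hom_rhoK p)
    (fun p _ => Hom_sigma_iter p)
    (fun p _ => Hom_relation p).

End Spaces.

(* Main.v *)
(* Write u_j = (-1)^j v_j.  For a vertex T = (A, B) of Hom(K_2, SG) let X be the
   union of A.  Since A contains a stable n-set, some trigonometric polynomial
   with k zeros shows that the open convex cone O_X = {<., u_j> < 0 for j not
   in X} is nonempty; the sum c(T) of the barycenters of the cells inside O_X
   is an equivariant choice of a point of it.  As O_X grows with T, normalizing
   the linear extension of c gives an equivariant map h to the sphere.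

   The points x and h (f x) have a common negative coordinate, so the segment
   between them avoids 0.  For p in |Hom(K_2, SG)|, every vertex (A, B) of the
   carrier of f (h p) and every vertex (A', B') of the carrier of p are such
   that (A, B') is again in Hom(K_2, SG), whence the zigzag
     (A, B) <= (A, B u B') >= (A, B') <= (A u A', B') >= (A', B').
   Coupling the measures f (h p), p and a point of the realized fence
   0 < 1 > 2 < 3 > 4 monotonically along their chains turns this zigzag into an
   equivariant homotopy from f o h to the identity. *)

Require Import Defs.
From mathcomp Require Import all_boot all_order all_algebra.
From mathcomp Require Import all_classical all_reals all_analysis.
From mathcomp Require Import complex.
From mathcomp Require Import ring lra zify.

Set Implicit Arguments.
Unset Strict Implicit.
Unset Printing Implicit Defensive.

Import Order.TTheory GRing.Theory Num.Theory.
Import numFieldNormedType.Exports.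

Local Open Scope ring_scope.
Local Open Scope classical_set_scope.


(** * Realizations and couplings of chain measures *)

(** Pairing with the curve through the v_j identifies W with the real trigonometric polynomials with
    frequencies -k, -k + 2, ..., k, and the cells record their signs at the angles j pi / m. Two
    facts about them carry the geometry: k zeros can be prescribed, and alternating sums over the m
    angles kill products of degree m - 2. The first makes O_X nonempty; the second gives Gale's
    lemma for stable sets, that is, nonemptiness of the two sets of g(s).

    The obstacle is that h is not induced by a poset map: the carriers of f (h p) and p are
    unrelated chains, so the two points cannot be compared vertex by vertex. The zigzag is a map on
    pairs of vertices, hence lives on the realization of a product poset, and what is needed is a
    section of |P x Q| -> |P| x |Q|. The coupling is one in closed form, built from sums, min and
    max of weights, so it is continuous where supports jump and natural under automorphisms.

    The zigzag avoids (A', B) because only negative coordinates of h p are controlled: nothing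
    forces A' and B to be disjoint. *)

Section FilterLimits.
Variables (R : realType) (T : Type) (F : set_system T).
Hypothesis FF : Filter F.

Lemma cvg_minr (f g : T -> R) (a b : R) : f @ F --> a -> g @ F --> b ->
  Num.min (f x) (g x) @[x --> F] --> Num.min a b.
Proof.
move=> fa gb; under eq_cvg do rewrite minr_absE.
rewrite minr_absE; apply: cvgM; last exact: cvg_cst.
apply: cvgB; first exact: cvgD.
by apply: cvg_norm; apply: cvgB.
Qed.

Lemma cvg_maxr (f g : T -> R) (a b : R) : f @ F --> a -> g @ F --> b ->
  Num.max (f x) (g x) @[x --> F] --> Num.max a b.
Proof.
move=> fa gb; under eq_cvg do rewrite maxr_absE.
rewrite maxr_absE; apply: cvgM; last exact: cvg_cst.
apply: cvgD; first exact: cvgD.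
by apply: cvg_norm; apply: cvgB.
Qed.

Lemma cvg_sumr (I : Type) (r : seq I) (P : pred I) (f : I -> T -> R)
    (a : I -> R) :
  (forall i, P i -> f i x @[x --> F] --> a i) ->
  \sum_(i <- r | P i) f i x @[x --> F] --> \sum_(i <- r | P i) a i.
Proof. by move=> fa; apply: cvg_big => //; exact: add_continuous. Qed.

End FilterLimits.

Lemma ptws_cvg_coord (R : realType) (I : eqType) (T : Type)
    (F : set_system T) (f : T -> {ptws I -> R}) (p : {ptws I -> R}) (i : I) :
  Filter F -> f @ F --> p -> f x i @[x --> F] --> p i.
Proof.
move=> FF fp; apply: (@cvg_comp _ _ _ f (fun q : {ptws I -> R} => q i)
  F (nbhs p)) => //.
exact: (@proj_continuous _ (fun=> R) i p).
Qed.

Section PushForward.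
Variable R : realType.
Implicit Types T U V : finType.

(** Change of variables for a push-forward measure. The values of [G] lie in an arbitrary
    [nmodType], so that weighted sums of vectors are covered. *)
Lemma sum_realization_map T U (E : nmodType) (phi : T -> U)
    (p : {ptws T -> R}) (G : U -> R -> E) :
  (forall u, {morph G u : x y / x + y}) -> (forall u, G u 0 = 0) ->
  \sum_u G u (realization_map phi p u) = \sum_t G (phi t) (p t).
Proof.
move=> Gadd G0; rewrite [RHS](partition_big phi predT) //=.
apply: eq_bigr => u _; rewrite /realization_map (big_morph _ (Gadd u) (G0 u)).
by apply: eq_bigr => t /eqP ->.
Qed.

Lemma realization_map_supp T U (phi : T -> U) (p : {ptws T -> R}) u :
  realization_map phi p u != 0 -> exists2 t, phi t = u & p t != 0.
Proof.
move=> /eqP nz; apply: contrapT => h; apply: nz; apply: big1 => t /eqP e.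
by apply/eqP; apply: contrapT => /negP ?; apply: h; exists t.
Qed.

Lemma eq_realization_map T U (phi psi : T -> U) (p : {ptws T -> R}) :
  (forall t, p t != 0 -> phi t = psi t) ->
  realization_map phi p = realization_map psi p.
Proof.
move=> e; apply/funext => u; rewrite /realization_map.
rewrite [LHS]big_mkcond [RHS]big_mkcond; apply: eq_bigr => t _.
by have [->|/e ->] := eqVneq (p t) 0; first by rewrite !if_same.
Qed.

Lemma realization_map_inj T U (phi : T -> U) (p : {ptws T -> R}) t :
  injective phi -> realization_map phi p (phi t) = p t.
Proof.
by move=> inj; rewrite /realization_map (big_pred1 t) // => u; rewrite inj_eq.
Qed.

End PushForward.

(** * Distribution functions on chains and joint laws *)

Section Coupling.
Variable R : realType.

(** For [p] supported on a chain this is its distribution function: the atom [t] occupies the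
    interval from [cumul t - p t] to [cumul t], which is degenerate when [t] is outside the
    support. *)
Definition cumul (T : finType) (le : rel T) (p : T -> R) (t : T) : R :=
  \sum_(u | le u t) p u.

Lemma chain_max (T : finType) (le : rel T) (S : {set T}) :
  reflexive le -> transitive le ->
  {in S &, forall t u, le t u || le u t} -> S != finset.set0 ->
  exists2 M, M \in S & forall u, u \in S -> le u M.
Proof.
move=> lexx trans chS /set0Pn [t0 t0S].
pose rk t := #|finset (fun u => (u \in S) && le u t)|.
case: (arg_maxnP (P := mem S) rk t0S) => M MS Mmax {t0 t0S}.
exists M => // u uS; apply/negPn/negP => nle.
have leMu : le M u by move: (chS _ _ uS MS); rewrite (negbTE nle).
suff : (rk M < rk u)%N by rewrite ltnNge; have /= -> := Mmax u uS.
apply: proper_card; apply/properP; split.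
  apply/fintype.subsetP => v; rewrite !inE => /andP[-> /= vM]; exact: trans vM leMu.
by exists u; rewrite !inE uS ?lexx // (negbTE nle).
Qed.

(** Induction on [S] by removing its top [M]: the interval of [M] ends at the total mass, and those
    of the other elements do not see [M]. *)
Lemma chain_telescope (T : finType) (le : rel T) (p : T -> R) (f : R -> R)
    (S : {set T}) :
  reflexive le -> antisymmetric le -> transitive le ->
  {in S &, forall t u, le t u || le u t} ->
  \sum_(t in S) (f (\sum_(u in S | le u t) p u) -
                 f (\sum_(u in S | le u t) p u - p t)) =
  f (\sum_(t in S) p t) - f 0.
Proof.
move=> lexx anti trans; move: {2}#|S|.+1 (ltnSn #|S|) => N.
elim: N S => // N IH S; rewrite ltnS => cardS chS.
have [->|S0] := eqVneq S finset.set0.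
  by rewrite !big_set0 subrr.
have [M MS topM] := chain_max lexx trans chS S0.
have leM t : t \in S -> t != M -> ~~ le M t.
  move=> tS; apply: contra => Mt; apply/eqP/anti.
  by rewrite (topM _ tS) Mt.
rewrite (big_setD1 M) //= [in RHS](big_setD1 M) //=.
have eM : \sum_(u in S | le u M) p u = p M + \sum_(u in S :\ M) p u.
  rewrite -(big_setD1 M) //; apply: eq_bigl => u.
  by case uS: (u \in S); rewrite //= topM.
rewrite eM [p M + _ - p M]addrC addKr.
rewrite [X in _ + X](eq_bigr (fun t => f (\sum_(u in S :\ M | le u t) p u) -
                 f (\sum_(u in S :\ M | le u t) p u - p t))); last first.
  move=> t; rewrite !inE => /andP[tM tS].
  suff -> : \sum_(u in S | le u t) p u = \sum_(u in S :\ M | le u t) p u by [].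
  apply: eq_bigl => u; rewrite !inE.
  by have [->|//] := eqVneq u M; rewrite (negbTE (leM _ tS tM)) andbF.
rewrite IH.
- by rewrite addrA subrK.
- by move: cardS; rewrite (cardsD1 M) (MS : M \in S).
- by move=> t u; rewrite !inE => /andP[_ tS] /andP[_ uS]; exact: chS.
Qed.

Section One.
Variables (T : finType) (le : rel T) (P : {set T}) (p : {ptws T -> R}).
Hypotheses (lexx : reflexive le) (anti : antisymmetric le)
  (trans : transitive le) (Rp : realization le P p).

Lemma cumul_ge t : p t <= cumul le p t.
Proof.
case: Rp => p0 _ _ _; rewrite /cumul (bigD1 t) //= lerDl.
exact: sumr_ge0.
Qed.

Lemma cumul_le1 t : cumul le p t <= 1.
Proof.
case: Rp => p0 <- _ _; rewrite [leRHS](bigID (fun u => le u t)) /= lerDl.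
exact: sumr_ge0.
Qed.

Lemma cumul_mono t t' : le t t' -> t != t' ->
  cumul le p t <= cumul le p t' - p t'.
Proof.
case: Rp => p0 _ _ _ tt' ne; rewrite /cumul [in leRHS](bigD1 t') //=.
rewrite [p t' + _]addrC addrK [leRHS](bigID (fun u => le u t)) /=.
rewrite (eq_bigl (fun u => (le u t' && (u != t')) && le u t)).
  by rewrite lerDl; exact: sumr_ge0.
move=> u; case ut: (le u t); rewrite ?andbF //= (trans ut tt') /=.
rewrite andbT; apply/esym/negP => /eqP e; move: ne; rewrite e in ut.
by rewrite (anti (x := t) (y := t')) ?eqxx // tt' ut.
Qed.

(** The intervals of the atoms tile [0, 1], and elements outside the support contribute 0. With a
    truncation for [f], the sum measures how much of a given interval they cover. *)
Lemma realization_telescope (f : R -> R) :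
  \sum_t (f (cumul le p t) - f (cumul le p t - p t)) = f 1 - f 0.
Proof.
case: Rp => p0 p1 _ pC; pose S := finset (fun t => p t != 0).
have eS (Q : pred T) : \sum_(t | Q t) p t = \sum_(t in S | Q t) p t.
  rewrite (bigID (fun t => t \in S)) /= [X in _ + X]big1 ?addr0.
    by apply: eq_bigl => t; rewrite andbC.
  by move=> t /andP[_]; rewrite inE negbK => /eqP.
rewrite (bigID (fun t => t \in S)) /= [X in _ + X]big1 ?addr0; last first.
  by move=> t; rewrite inE negbK => /eqP ->; rewrite subr0 subrr.
have := @chain_telescope T le p f S lexx anti trans.
have -> : \sum_(t in S) p t = 1.
  by rewrite -p1 (eS predT); apply: eq_bigl => t; rewrite andbT.
move=> <-; first by apply: eq_bigr => t _; rewrite /cumul eS.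
by move=> t u; rewrite !inE; exact: pC.
Qed.

End One.

(* Both measures are laws of monotone step functions on [0, 1], and this is the
   law of the pair: the mass of (t, u) is the length of the intersection of
   the intervals on which these functions take the values t and u. *)
Definition coupling (T U : finType) (le : rel T) (le' : rel U)
    (p : {ptws T -> R}) (q : {ptws U -> R}) : {ptws T * U -> R} :=
  fun z => Num.max 0
    (Num.min (cumul le p z.1) (cumul le' q z.2) -
     Num.max (cumul le p z.1 - p z.1) (cumul le' q z.2 - q z.2)).

Definition prod_le (T U : finType) (le : rel T) (le' : rel U) : rel (T * U) :=
  fun z w => le z.1 w.1 && le' z.2 w.2.

(** The overlap of [a, b] and [c, d] becomes the increment, from c to d, of the truncation to
    [a, b]; this is the form that [realization_telescope] sums. *)
Lemma overlapE (a b c d : R) : a <= b -> c <= d ->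
  Num.max 0 (Num.min b d - Num.max a c) =
  Num.max a (Num.min b d) - Num.max a (Num.min b c).
Proof.
move=> ab cd; have [bc|cb] := leP b c.
  rewrite (elimT min_idPl (le_trans bc cd)) subrr.
  by apply/max_idPl; rewrite subr_le0 le_max bc orbT.
have [da|ad] := leP d a.
  rewrite (elimT min_idPr (le_trans da ab)) (elimT max_idPl da).
  rewrite (elimT max_idPl (le_trans cd da)) subrr.
  by apply/max_idPl; rewrite subr_le0.
have amin : a <= Num.min b d by rewrite le_min ab ltW.
rewrite [in RHS](elimT max_idPr amin); apply/max_idPr.
by rewrite subr_ge0 ge_max amin le_min cd ltW.
Qed.

Section Two.
Variables (T U : finType) (le : rel T) (le' : rel U).
Variables (P : {set T}) (Q : {set U}).
Variables (p : {ptws T -> R}) (q : {ptws U -> R}).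
Hypotheses (lexx : reflexive le) (anti : antisymmetric le)
  (trans : transitive le).
Hypotheses (lexx' : reflexive le') (anti' : antisymmetric le')
  (trans' : transitive le').
Hypotheses (Rp : realization le P p) (Rq : realization le' Q q).

Lemma coupling_ge0 z : 0 <= coupling le le' p q z.
Proof. by rewrite /coupling le_max Order.POrderTheory.lexx. Qed.

Lemma coupling_neq0 z : coupling le le' p q z != 0 ->
  Num.max (cumul le p z.1 - p z.1) (cumul le' q z.2 - q z.2) <
  Num.min (cumul le p z.1) (cumul le' q z.2).
Proof.
rewrite /coupling => nz; rewrite -subr_gt0.
by move: nz; rewrite /Num.max; case: ifP; rewrite ?eqxx.
Qed.

Lemma coupling_fst t : \sum_u coupling le le' p q (t, u) = p t.
Proof.
have ge0 := cumul_ge lexx Rp t; have le1 := cumul_le1 Rp t.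
have pt0 : 0 <= p t by case: Rp.
(* The function is the truncation to the interval of [t]; its total increment over [0, 1] is the
   length [p t]. *)
have := realization_telescope lexx' anti' trans' Rq
  (fun z => Num.max (cumul le p t - p t) (Num.min (cumul le p t) z)).
have -> : Num.max (cumul le p t - p t) (Num.min (cumul le p t) 1) -
   Num.max (cumul le p t - p t) (Num.min (cumul le p t) 0) = p t.
  rewrite (elimT min_idPl le1) (elimT min_idPr (le_trans pt0 ge0)).
  by rewrite (elimT max_idPr _) ?(elimT max_idPl _); lra.
move=> <-; apply: eq_bigr => u _; rewrite /coupling /= overlapE //.
  lra.
by have qu : 0 <= q u by [case: Rq]; lra.
Qed.

Lemma coupling_supp z : coupling le le' p q z != 0 ->
  p z.1 != 0 /\ q z.2 != 0.
Proof.
move=> /coupling_neq0; rewrite gt_max !lt_min => /andP[/andP[h1 _] /andP[_ h2]].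
by split; apply/negP => /eqP e; [move: h1|move: h2]; rewrite e subr0 ltxx.
Qed.

End Two.

Lemma coupling_swap (T U : finType) (le : rel T) (le' : rel U) p q t u :
  coupling le le' p q (t, u) = coupling le' le q p (u, t).
Proof. by rewrite /coupling /= minC [Num.max (_ - _) _]maxC. Qed.

Section Three.
Variables (T U : finType) (le : rel T) (le' : rel U).
Variables (P : {set T}) (Q : {set U}).
Variables (p : {ptws T -> R}) (q : {ptws U -> R}).
Hypotheses (lexx : reflexive le) (anti : antisymmetric le)
  (trans : transitive le).
Hypotheses (lexx' : reflexive le') (anti' : antisymmetric le')
  (trans' : transitive le').
Hypotheses (Rp : realization le P p) (Rq : realization le' Q q).

Lemma coupling_snd u : \sum_t coupling le le' p q (t, u) = q u.
Proof.
under eq_bigr do rewrite coupling_swap.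
exact: (coupling_fst lexx' lexx anti trans Rq Rp).
Qed.

(** The support is a chain: if t < t' and u' < u, then the interval of t precedes that of t' and the
    interval of u' precedes that of u, so t cannot overlap u while t' overlaps u'. *)
Lemma coupling_realization (S : {set T * U}) :
  (forall t u, p t != 0 -> q u != 0 -> (t, u) \in S) ->
  realization (prod_le le le') S (coupling le le' p q).
Proof.
move=> PQS; split.
- by move=> z; exact: coupling_ge0.
- rewrite -(pair_bigA _ (fun t u => coupling le le' p q (t, u))) /=.
  under eq_bigr do rewrite (coupling_fst lexx lexx' anti' trans' Rp Rq).
  by case: Rp.
- by case=> t u /coupling_supp [] /= /PQS /[apply].
move=> [t u] [t' u'] nz nz'; have [pt qu] := coupling_supp nz.
have [pt' qu'] := coupling_supp nz'; rewrite /prod_le /=.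
move: nz nz' => /coupling_neq0 + /coupling_neq0.
rewrite !gt_max !lt_min /= => /andP[/andP[_ h1] /andP[h2 _]].
move=> /andP[/andP[_ h1'] /andP[h2' _]].
have [->|nt] := eqVneq t t'.
  by rewrite !lexx /=; case: Rq => _ _ _; apply.
have [->|nu] := eqVneq u u'.
  by rewrite !lexx' !andbT; case: Rp => _ _ _; apply.
have /orP ct : le t t' || le t' t by case: Rp => _ _ _; apply.
have /orP cu : le' u u' || le' u' u by case: Rq => _ _ _; apply.
case: ct => ct; case: cu => cu; rewrite ct cu ?orbT //= ?andbT ?orbF.
- have := cumul_mono lexx anti trans Rp ct nt.
  have := cumul_mono lexx' anti' trans' Rq cu _; rewrite eq_sym => /(_ nu).
  lra.
- have := cumul_mono lexx anti trans Rp ct _; rewrite eq_sym => /(_ nt).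
  have := cumul_mono lexx' anti' trans' Rq cu nu.
  lra.
Qed.

Lemma realization_map_coupling_fst :
  realization_map fst (coupling le le' p q) = p.
Proof.
apply/funext => t; rewrite /realization_map.
rewrite -(coupling_fst lexx lexx' anti' trans' Rp Rq t).
rewrite [LHS]big_mkcond -(pair_bigA _
  (fun t' u => if t' == t then coupling le le' p q (t', u) else 0)) /=.
rewrite exchange_big; apply: eq_bigr => u _.
by rewrite -big_mkcond big_pred1_eq.
Qed.

Lemma realization_map_coupling_snd :
  realization_map snd (coupling le le' p q) = q.
Proof.
apply/funext => u; rewrite /realization_map -(coupling_snd u).
rewrite [LHS]big_mkcond -(pair_bigA _
  (fun t u' => if u' == u then coupling le le' p q (t, u') else 0)) /=.
by apply: eq_bigr => t _; rewrite -big_mkcond big_pred1_eq.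
Qed.

(** Naturality under order automorphisms, the source of the equivariance of [hom_homotopy]; an
    injective self-map of a finite type is bijective. *)
Lemma coupling_map (alpha : T -> T) (beta : U -> U) :
  injective alpha -> injective beta ->
  {mono alpha : t u / le t u} -> {mono beta : t u / le' t u} ->
  coupling le le' (realization_map alpha p) (realization_map beta q) =
  realization_map (fun z => (alpha z.1, beta z.2)) (coupling le le' p q).
Proof.
move=> ia ib ma mb.
have cumE (V : finType) (lt : rel V) (a : V -> V) (r : {ptws V -> R}) v :
    injective a -> {mono a : x y / lt x y} ->
    cumul lt (realization_map a r) (a v) = cumul lt r v.
  move=> ja moa; rewrite /cumul (reindex_inj ja) /=.
  by apply: eq_big => w; rewrite ?moa // realization_map_inj.
apply/funext => -[t' u'].
have [a' _ aK] := injF_bij ia; have [b' _ bK] := injF_bij ib.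
rewrite -(aK t') -(bK u'); move: (a' t') (b' u') => t u.
rewrite -[(alpha t, beta u)]/((fun z => (alpha z.1, beta z.2)) (t, u)).
rewrite realization_map_inj; last by move=> [? ?] [? ?] /= [/ia -> /ib ->].
by rewrite /coupling /= !cumE // !realization_map_inj.
Qed.

End Three.

Lemma cvg_coupling (T U : finType) (le : rel T) (le' : rel U) (X : Type)
    (F : set_system X) (f : X -> {ptws T -> R}) (g : X -> {ptws U -> R})
    (p : {ptws T -> R}) (q : {ptws U -> R}) : Filter F ->
  f @ F --> p -> g @ F --> q ->
  (fun x => coupling le le' (f x) (g x)) @ F --> coupling le le' p q.
Proof.
move=> FF fp gq; apply: cvg_ptws => -[t u]; rewrite /coupling /=.
have cf v : f x v @[x --> F] --> p v by exact: ptws_cvg_coord.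
have cg v : g x v @[x --> F] --> q v by exact: ptws_cvg_coord.
have cumf v : cumul le (f x) v @[x --> F] --> cumul le p v by exact: cvg_sumr.
have cumg v : cumul le' (g x) v @[x --> F] --> cumul le' q v.
  exact: cvg_sumr.
apply: cvg_maxr; first exact: cvg_cst.
by apply: cvgB; [exact: cvg_minr | apply: cvg_maxr; exact: cvgB].
Qed.

End Coupling.

(** * The fence and its path *)

Section Fence.
Variable R : realType.

(* The poset 0 < 1 > 2 < 3 > 4, whose realization is an interval. *)
Definition fence_le (i j : 'I_5) : bool :=
  (i == j) || [&& ~~ odd i, odd j & (i.+1 == j :> nat) || (j.+1 == i :> nat)].

Lemma fence_refl : reflexive fence_le.
Proof. by move=> i; rewrite /fence_le eqxx. Qed.

Lemma fence_anti : antisymmetric fence_le.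
Proof.
move=> i j; rewrite /fence_le eq_sym; case: eqP => //= _.
by case/andP => /and3P[/negbTE -> _ _] /and3P[].
Qed.

Lemma fence_trans : transitive fence_le.
Proof.
move=> j i l; rewrite /fence_le => /orP[/eqP -> //|/and3P[-> oj h]] /=.
by rewrite oj /= orbF => /eqP <-; rewrite oj h orbT.
Qed.

(** The hat functions centred at 0, ..., 4, evaluated at 4t: the piecewise linear walk from vertex 0
    to vertex 4. *)
Definition fence_path (t : R) : {ptws 'I_5 -> R} :=
  fun i => Num.max 0 (1 - `|4 * t - i%:R|).

Lemma fence_path_realization (t : R) : 0 <= t <= 1 ->
  realization fence_le finset.setT (fence_path t).
Proof.
move=> /andP[t0 t1]; split.
- by move=> i; rewrite /fence_path le_max lexx.
- rewrite /fence_path !big_ord_recr big_ord0 /= add0r.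
  (* The hat function is half the second difference of the absolute value, so the sum over the five
     centres telescopes. *)
  have tent (x : R) :
      Num.max 0 (1 - `|x|) = (`|x - 1| + `|x + 1| - 2 * `|x|) / 2.
    rewrite /Num.max; case: (ger0P x) => ?; case: (ger0P (x - 1)) => ?;
    by case: (ger0P (x + 1)) => ?; case: ltP => ?; lra.
  rewrite !tent.
  have -> : 4 * t - 1 + 1 = 4 * t by ring.
  have -> : 4 * t - 2 + 1 = 4 * t - 1 by ring.
  have -> : 4 * t - 3 + 1 = 4 * t - 2 by ring.
  have -> : 4 * t - 4 + 1 = 4 * t - 3 by ring.
  have -> : 4 * t - 1 - 1 = 4 * t - 2 by ring.
  have -> : 4 * t - 2 - 1 = 4 * t - 3 by ring.
  have -> : 4 * t - 3 - 1 = 4 * t - 4 by ring.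
  rewrite subr0 [`|4 * t|]ger0_norm ?[`|4 * t + 1|]ger0_norm; [|lra|lra].
  by rewrite [`|4 * t - 4|]ler0_norm ?[`|4 * t - 4 - 1|]ler0_norm; lra.
- by move=> i _; rewrite inE.
- move=> i j.
  have near (l : 'I_5) : fence_path t l != 0 -> `|4 * t - l%:R| < 1.
    by rewrite /fence_path /Num.max; case: ltP; rewrite ?eqxx // subr_gt0.
  move=> /near; rewrite ltr_norml => /andP[a1 a2].
  move=> /near; rewrite ltr_norml => /andP[b1 b2].
  have ij : (i%:R : R) < (j + 2)%:R by rewrite natrD; lra.
  have ji : (j%:R : R) < (i + 2)%:R by rewrite natrD; lra.
  move: ij ji; rewrite !ltr_nat /fence_le => ij ji {near a1 a2 b1 b2}.
  have [/val_inj -> |nij] := eqVneq (i : nat) j; first by rewrite eq_refl.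
  by apply/orP; case oi: (odd i); case oj: (odd j) => /=; lia.
Qed.

Lemma fence_path0 i : fence_path 0 i = (i == ord0)%:R.
Proof.
rewrite /fence_path mulr0 sub0r normrN normr_nat.
case: i => [[|i] hi]; first by rewrite subr0 (elimT max_idPr _).
rewrite (elimT max_idPl _) // subr_le0 ler1n //.
Qed.

Lemma fence_path1 i : fence_path 1 i = (i == ord_max)%:R.
Proof.
rewrite /fence_path mulr1 -[4]/(4%:R) distrC.
have hi : (i <= 4)%N by rewrite -ltnS.
rewrite -normrN opprB -natrB // normr_nat -val_eqE /=.
move: hi; rewrite leq_eqVlt => /orP[/eqP ->|lt].
  by rewrite subnn subr0 (elimT max_idPr _).
by rewrite (ltn_eqF lt) (elimT max_idPl _) // subr_le0 ler1n subn_gt0.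
Qed.

Lemma fence_path_continuous : continuous fence_path.
Proof.
move=> t; apply: (@cvg_ptws _ _ (fence_path @ nbhs t)) => i.
suff : fence_path s i @[s --> t] --> fence_path t i by [].
apply: cvg_maxr; first exact: cvg_cst.
apply: cvgB; first exact: cvg_cst.
apply: cvg_norm; apply: cvgB; last exact: cvg_cst.
by apply: cvgM; [exact: cvg_cst|exact: cvg_id].
Qed.
End Fence.


(** * Trigonometric polynomials *)

Section Expi.
Variable R : realType.
Implicit Types a b : R.

Lemma expiX a j : expi a ^+ j = expi (j%:R * a).
Proof.
elim: j => [|j IH]; first by rewrite mul0r expi0.
by rewrite exprS IH -expiD -natr1 mulrDl mul1r addrC.
Qed.

Lemma expi_double_neq1 a : 0 < a < pi -> expi (2 * a) != 1.
Proof.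
move=> api; have sa := sin_gt0_pi api; apply/negP => /eqP [c _].
move: c; rewrite mulr_natl cos_mulr2n cos2sin2 => c.
have : sin a ^+ 2 != 0 by rewrite expf_neq0 // gt_eqF.
by move/eqP; apply; lra.
Qed.

Lemma expi_root_inj (m i j : nat) : (i < m)%N -> (j < m)%N ->
  expi (2 * (i%:R * pi / m%:R) : R) = expi (2 * (j%:R * pi / m%:R)) -> i = j.
Proof.
wlog ij : i j / (i <= j)%N => [H|].
  have [|/ltnW ji] := leqP i j; first exact: H.
  by move=> im jm /esym e; apply/esym/H.
move=> im jm e; apply/eqP; rewrite eqn_leq ij leqNgt; apply/negP => lt.
have m0 : (0 : R) < m%:R by rewrite ltr0n (leq_trans _ im).
suff api : 0 < ((j - i)%:R : R) * pi / m%:R < pi.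
  have /negP := expi_double_neq1 api; apply; apply/eqP.
  rewrite natrB // !mulrBl mulrBr expiD -e -expiJ.
  by rewrite expiJ -expiD subrr expi0.
apply/andP; split.
  apply: divr_gt0 => //; apply: mulr_gt0; last exact: pi_gt0.
  by rewrite ltr0n subn_gt0.
rewrite ltr_pdivrMr // mulrC ltr_pM2l ?pi_gt0 // ltr_nat.
by rewrite (leq_ltn_trans _ jm) // leq_subr.
Qed.

End Expi.

Section TrigonometricPolynomials.
Variable R : realType.
Implicit Types (d e : nat) (F G : R -> R[i]).

(* Trigonometric polynomials with frequencies -d, -d + 2, ..., d. *)
Definition trig_poly d F := exists2 P : {poly R[i]}, (size P <= d.+1)%N &
  forall phi, F phi = expi (- (d%:R * phi)) * P.[expi (2 * phi)].

Lemma trig_polyM d e F G : trig_poly d F -> trig_poly e G ->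
  trig_poly (d + e) (fun phi => F phi * G phi).
Proof.
move=> [P sP FE] [Q sQ GE]; exists (P * Q).
  apply: leq_trans (size_polyMleq _ _) _.
  by rewrite -ltnS -!addSn; lia.
move=> phi; rewrite FE GE hornerM.
have -> : (d + e)%:R * phi = d%:R * phi + e%:R * phi by rewrite natrD mulrDl.
by rewrite opprD expiD mulrACA.
Qed.

(** All frequencies of a [trig_poly] have the parity of its degree, so the degree is raised in steps
    of two; the factor ['X] recentres the frequencies. *)
Lemma trig_poly_raise d F : trig_poly d F -> trig_poly d.+2 F.
Proof.
move=> [P sP FE]; exists (P * 'X).
  by apply: leq_trans (size_polyMleq _ _) _; rewrite size_polyX; lia.
move=> phi; rewrite FE hornerM hornerX.
have -> : d.+2%:R * phi = d%:R * phi + 2 * phi by rewrite -addn2 natrD mulrDl.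
rewrite opprD expiD.
by rewrite mulrACA -(expiD (- (2 * phi))) addNr expi0 mulr1.
Qed.

Lemma trig_poly_raisen d j F : trig_poly d F -> trig_poly (j.*2 + d) F.
Proof. by elim: j => // j IH /IH /trig_poly_raise. Qed.

Lemma trig_poly_sin (a : R) : trig_poly 1 (fun phi => (sin (phi - a))%:C%C).
Proof.
(* The constant 1 / (2i) of Euler's formula for the sine. *)
pose kap : R[i] := (0 +i* - 2^-1)%C.
exists ((kap * expi (- a)) *: 'X - (kap * expi a)%:P).
  apply: leq_trans (size_polyD _ _) _; rewrite geq_max size_polyN.
  rewrite (leq_trans (size_scale_leq _ _)) ?size_polyX //=.
  by rewrite (leq_trans (size_polyC_leq1 _)).
move=> phi; rewrite hornerD hornerN hornerC hornerZ hornerX mul1r.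
have -> : expi (- phi) * (kap * expi (- a) * expi (2 * phi) - kap * expi a) =
    kap * (expi (phi - a) - expi (- (phi - a))).
  have -> : phi - a = - phi + (- a + 2 * phi) by ring.
  have -> : - (- phi + (- a + 2 * phi)) = - phi + a by ring.
  by rewrite !expiD; ring.
rewrite -expiJ; apply/eqP; rewrite eq_complex /=; apply/andP; split; apply/eqP.
  by field.
by ring.
Qed.

Lemma trig_poly_prod_sin (s : seq R) :
  trig_poly (size s) (fun phi => (\prod_(a <- s) sin (phi - a))%:C%C).
Proof.
elim: s => [|a s IH] /=.
  exists 1; first by rewrite size_poly1.
  by move=> phi; rewrite big_nil mul0r oppr0 expi0 mul1r hornerC.
have := trig_polyM (trig_poly_sin a) IH; rewrite add1n.
case=> P sP H; exists P => // phi.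
by rewrite -H big_cons -rmorphM.
Qed.

(** At the j-th angle, (-1)^j = exp(i pi j) turns the frequency 2l - d into the power j (l + 1) of a
    primitive root of unity of order d + 2. Since 0 < l + 1 < d + 2, each geometric sum vanishes. *)
Lemma trig_poly_alternating_sum d F : trig_poly d F ->
  \sum_(j < d.+2) (-1) ^+ j * F (j%:R * pi / d.+2%:R) = 0.
Proof.
move=> [P sP FE]; pose om : R[i] := expi (2 * (1%:R * pi / d.+2%:R)).
have omX l : om ^+ l = expi (2 * (l%:R * pi / d.+2%:R)).
  by rewrite expiX; congr expi; rewrite mul1r; ring.
have m0 : (d.+2%:R : R) != 0 by rewrite pnatr_eq0.
have om1 : om ^+ d.+2 = 1.
  rewrite omX mulrAC divff // mul1r expi_natpi.
  by rewrite expr2 mulrNN mul1r.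
rewrite (eq_bigr (fun j : 'I__ => \sum_(i < d.+1) P`_i * (om ^+ i.+1) ^+ j)).
  rewrite exchange_big big1 // => i _; rewrite -mulr_sumr.
  have: om ^+ i.+1 != 1.
    apply/negP => /eqP; rewrite -(expr0 om) !omX.
    by move/(@expi_root_inj _ d.+2 i.+1 0)=> /(_ (ltn_ord i) isT).
  rewrite -subr_eq0 => nz; have := subrX1 (om ^+ i.+1) d.+2.
  rewrite exprAC om1 expr1n subrr => /esym/eqP.
  by rewrite mulf_eq0 (negbTE nz) /= => /eqP ->; rewrite mulr0.
move=> j _; rewrite FE -expi_natpi [LHS]mulrA -expiD (horner_coef_wide _ sP).
rewrite mulr_sumr; apply: eq_bigr => i _; rewrite mulrCA; congr (_ * _).
rewrite expiX -expiD -exprM omX; congr expi.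
have dE : d.+2%:R = d%:R + 2 :> R by rewrite -addn2 natrD.
have iE : i.+1%:R = i%:R + 1 :> R by rewrite -natr1.
by rewrite natrM iE dE; field; rewrite -dE.
Qed.

End TrigonometricPolynomials.

(** * W as a space of trigonometric polynomials *)

Section Inner.
Variables (R : realType) (k : nat).
Local Notation r := (k./2).
Local Notation C := (R[i]^o).
Local Notation V := 'rV[C]_r.+1.
Implicit Types (x y z : V) (phi : R).

Definition vphi phi : V := \row_t expi ((t.*2 + odd k)%:R * phi).

Lemma vvecE n (j : 'Z_(2 * n + k)) :
  vvec R j = vphi ((j : nat)%:R * pi / (2 * n + k)%:R).
Proof.
by apply/rowP => t; rewrite !mxE /angle; congr expi; ring.
Qed.

(** Each coordinate contributes half the sum of x_t conj(v_t) and its conjugate, of frequencies -(2t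
    + odd k) and 2t + odd k; the shift by k makes them the exponents r - t and r + t + odd k of
    exp(2 i phi). *)
Definition inner_poly x : {poly R[i]} :=
  \sum_(t < r.+1) ((2^-1 * x 0 t) *: 'X^(r - t) +
                   (2^-1 * (x 0 t)^*%C) *: 'X^(r + t + odd k)).

Lemma double_half_odd : k = (r.*2 + odd k)%N.
Proof. by rewrite addnC odd_double_half. Qed.

Lemma natr_half_odd : k%:R = 2 * r%:R + (odd k)%:R :> R.
Proof. by rewrite [in LHS]double_half_odd natrD -mul2n natrM. Qed.

Lemma size_inner_poly x : (size (inner_poly x) <= k.+1)%N.
Proof.
apply: leq_trans (size_sum _ _ _) _; apply/bigmax_leqP => t _.
apply: leq_trans (size_polyD _ _) _; rewrite geq_max.
have lt := ltn_ord t.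
rewrite !(leq_trans (size_scale_leq _ _)) // size_polyXn
  [in X in (_ < X)%N]double_half_odd.
  by rewrite ltnS -addnn; lia.
by rewrite ltnS -addnn; lia.
Qed.

Lemma inner_polyE x phi :
  (inner x (vphi phi))%:C%C =
  expi (- (k%:R * phi)) * (inner_poly x).[expi (2 * phi)].
Proof.
rewrite /inner_poly horner_sum mulr_sumr /inner.
rewrite (big_morph (fun a : R => a%:C%C) (rmorphD (real_complex R)) (erefl 0)).
apply: eq_bigr => t _; rewrite hornerD !hornerZ !hornerXn !expiX mulrDr.
have lt : (t <= r)%N by rewrite -ltnS.
have eM (a b : R) (c : R[i]) : expi a * (c * expi b) = c * expi (a + b).
  by rewrite expiD mulrCA.
rewrite !eM !mxE.
have -> : - (k%:R * phi) + (r - t)%:R * (2 * phi) =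
    - ((t.*2 + odd k)%:R * phi) :> R.
  by rewrite natrB // natrD -mul2n natrM natr_half_odd; ring.
have -> : - (k%:R * phi) + (r + t + odd k)%:R * (2 * phi) =
    ((t.*2 + odd k)%:R * phi) :> R.
  by rewrite !natrD -mul2n natrM natr_half_odd; ring.
rewrite -expiJ; move: (expi _) (x 0 t) => [a b] [c d].
by apply/eqP; rewrite eq_complex /=; apply/andP; split; apply/eqP; field.
Qed.

Lemma trig_poly_inner x :
  trig_poly k (fun phi => (inner x (vphi phi))%:C%C).
Proof.
by exists (inner_poly x) => [|phi]; [exact: size_inner_poly|exact: inner_polyE].
Qed.

Lemma inner_poly_eq0 x : W R k x -> inner_poly x = 0 -> x = 0.
Proof.
move=> Wx P0; apply/rowP => t; rewrite mxE.
have := congr1 (fun p : {poly R[i]} => p`_(r - t)) P0; rewrite coef0.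
rewrite /inner_poly coef_sum (bigD1 t) //= big1 ?addr0; last first.
  move=> u ut; rewrite coefD !coefZ !coefXn.
  have lt := ltn_ord t; have lu := ltn_ord u.
  have nut : (u : nat) <> t by move/val_inj/eqP; rewrite (negbTE ut).
  rewrite (_ : (r - t == r - u)%N = false) ?mulr0 ?add0r; last by apply/eqP; lia.
  rewrite (_ : (r - t == r + u + odd k)%N = false) ?mulr0 //; apply/eqP; lia.
rewrite coefD !coefZ !coefXn eqxx mulr1.
have lt := ltn_ord t.
case: eqP => [e|_]; last first.
  by rewrite mulr0 addr0 => /eqP; rewrite mulf_eq0 invr_eq0 pnatr_eq0 => /eqP.
(* The two exponents collide only for k even and t = 0. The coefficient then sees only the real part
   of x_0, and membership in [W] kills the imaginary part. *)
have ek : ~~ odd k by case: (odd k) e => //= e; lia.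
have t0 : t = 0 by apply/val_inj => /=; lia.
have := Wx ek; rewrite t0; case: (x 0 0) => a b /= ->; rewrite mulr1 oppr0.
rewrite -mulrDr => /eqP; rewrite mulf_eq0 invr_eq0 pnatr_eq0 /= => /eqP [].
by move=> a2 _; congr (_ +i* _)%C; lra.
Qed.

(** Distinct angles in [0, pi) give distinct roots exp(2 i phi) of [inner_poly x], whose degree is
    at most k. *)
Lemma inner_zeros x (m : nat) (s : seq nat) : W R k x ->
  uniq s -> all (fun j => (j < m)%N) s -> (k < size s)%N ->
  (forall j, j \in s -> inner x (vphi (j%:R * pi / m%:R)) = 0) -> x = 0.
Proof.
move=> Wx us sm ks x0; apply: inner_poly_eq0 => //; apply/eqP.
apply/negPn/negP => nz.
pose z j : R[i] := expi (2 * (j%:R * pi / m%:R)).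
have := max_poly_roots (rs := map z s) nz; rewrite size_map.
have -> /= : all (root (inner_poly x)) (map z s).
  apply/allP => _ /mapP[j js ->]; rewrite /root.
  have := inner_polyE x (j%:R * pi / m%:R); rewrite x0 // => /esym/eqP.
  rewrite mulf_eq0 => /orP[/eqP e|//].
  have := expi0 R; rewrite -(addNr (k%:R * (j%:R * pi / m%:R))) expiD e mul0r.
  by move/esym/eqP; rewrite oner_eq0.
rewrite map_inj_in_uniq => [/(_ isT us)|]; last first.
  by move=> i j /(allP sm) im /(allP sm) jm; exact: expi_root_inj.
by rewrite ltnNge => /negP; apply; apply: leq_trans ks; exact: size_inner_poly.
Qed.

(** The coefficients are folded about the centre of 0, ..., k. For even k there is a middle one,
    which must be counted only once. *)
Lemma sum_two_sided (G : nat -> R) :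
  \sum_(i < k.+1) G i =
  \sum_(t < r.+1) (G (r - t)%N +
    if odd k || (0 < t)%N then G (r + t + odd k)%N else 0).
Proof.
rewrite big_split /= -(big_mkord xpredT G) (big_cat_nat (n := r.+1)) //=; last first.
  by rewrite ltnS [leqRHS]double_half_odd -addnn -addnA leq_addr.
congr (_ + _).
  rewrite big_mkord (reindex_inj rev_ord_inj) /=.
  by apply: eq_bigr => t _; rewrite subSS.
rewrite -{1}[r.+1]add0n big_addn [in X in (X - _)%N]double_half_odd.
have [ok|ek] := boolP (odd k).
  rewrite /= (_ : (r.*2 + true).+1 - r.+1 = r.+1)%N; last by rewrite -addnn; lia.
  by rewrite big_mkord; apply: eq_bigr => t _; congr G; lia.
rewrite /= (_ : (r.*2 + false).+1 - r.+1 = r)%N; last first.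
  by rewrite -addnn; lia.
rewrite big_mkord big_ord_recl /= add0r; apply: eq_bigr => t _.
by rewrite /bump /=; congr G; lia.
Qed.

(** Converse of [trig_poly_inner]: taking real parts folds the coefficients at opposite frequencies
    into one complex coordinate, so polynomials built as products of sines yield vectors of W. *)
Lemma trig_poly_real (F : R -> R) : trig_poly k (fun phi => (F phi)%:C%C) ->
  exists2 x, W R k x & forall phi, F phi = inner x (vphi phi).
Proof.
move=> [P sP FE].
pose x : V := \row_(t < r.+1)
  if odd k || (0 < t)%N then P`_(r - t) + (P`_(r + t + odd k))^*%C
  else (complex.Re P`_(r - t))%:C%C.
exists x; first by move=> ek; rewrite mxE (negbTE ek).
move=> phi; pose G i := complex.Re (P`_i * expi (((i.*2)%:R - k%:R) * phi)).
transitivity (\sum_(i < k.+1) G i).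
  have := congr1 (@complex.Re R) (FE phi) => /= ->.
  rewrite (horner_coef_wide _ sP) mulr_sumr.
  rewrite (big_morph (@complex.Re R) (id1 := 0) (op1 := +%R)) //; last first.
    by case=> ? ? [].
  apply: eq_bigr => i _; rewrite /G mulrCA expiX -expiD.
  congr (complex.Re (_ * expi _)).
  by rewrite -muln2 natrM; ring.
rewrite sum_two_sided /inner; apply: eq_bigr => t _; rewrite !mxE /G.
have lt : (t <= r)%N by rewrite -ltnS.
have -> : ((r - t).*2%:R - k%:R : R) = - (t.*2 + odd k)%:R.
  by rewrite -!mul2n natrM natrB // natrD natrM natr_half_odd; ring.
have -> : ((r + t + odd k).*2%:R - k%:R : R) = (t.*2 + odd k)%:R.
  have dbl (a : nat) : a.*2%:R = 2 * a%:R :> R by rewrite -mul2n natrM.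
  by rewrite dbl !natrD dbl natr_half_odd; ring.
rewrite mulNr -expiJ; case: ifP => [_|/norP].
  move: (expi _) (P`_ _) (P`_ _) => [a b] [c d] [e f] /=; ring.
move=> [/negbTE ok]; rewrite -eqn0Ngt => /eqP t0.
rewrite ok t0 mul0r expi0; case: (P`_ _) => a b /=; ring.
Qed.

End Inner.


(** * Sign vectors of W and stable sets *)

Section InnerLinear.
Variables (R : realType) (k : nat).
Local Notation C := (R[i]^o).
Local Notation V := 'rV[C]_(k./2).+1.
Implicit Types (x y z : V) (a : R).

Lemma innerDl x y z : inner (x + y) z = inner x z + inner y z.
Proof.
rewrite /inner -big_split; apply: eq_bigr => t _; rewrite mxE mulrDl.
by case: (x 0 t * _) => ? ?; case: (y 0 t * _).
Qed.

Lemma innerZl a x z : inner (a%:C%C *: x) z = a * inner x z.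
Proof.
rewrite /inner mulr_sumr; apply: eq_bigr => t _; rewrite mxE.
by case: (x 0 t) => b c; case: (z 0 t) => d e /=; ring.
Qed.

Lemma inner0l z : inner (0 : V) z = 0.
Proof.
rewrite /inner big1 // => t _; rewrite mxE.
by case: (z 0 t) => d e /=; ring.
Qed.

Lemma inner_suml (I : Type) (s : seq I) (P : pred I) (a : I -> R) (y : I -> V) z :
  inner (\sum_(i <- s | P i) (a i)%:C%C *: y i) z =
  \sum_(i <- s | P i) a i * inner (y i) z.
Proof.
rewrite (big_morph (fun x => inner x z) (id1 := 0) (op1 := +%R)).
- by apply: eq_bigr => i _; rewrite innerZl.
- by move=> x y'; exact: innerDl.
- exact: inner0l.
Qed.

Lemma innerC x y : inner x y = inner y x.
Proof.
apply: eq_bigr => t _.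
by case: (x 0 t) => b c; case: (y 0 t) => d e /=; ring.
Qed.

Lemma inner_ge0 x : 0 <= inner x x.
Proof.
apply: sumr_ge0 => t _; case: (x 0 t) => b c /=.
by rewrite mulrN opprK addr_ge0 // -expr2 sqr_ge0.
Qed.

Lemma inner_eq0 x : inner x x = 0 -> x = 0.
Proof.
have nn t : 0 <= complex.Re (x 0 t * (x 0 t)^*%C).
  by case: (x 0 t) => b c /=; rewrite mulrN opprK addr_ge0 // -expr2 sqr_ge0.
move/eqP; rewrite psumr_eq0 // => /allP h; apply/rowP => t; rewrite mxE.
have := h t (mem_index_enum t); rewrite /=; case: (x 0 t) => b c /=.
rewrite mulrN opprK -!expr2 paddr_eq0 ?sqr_ge0 // !sqrf_eq0.
by move=> /andP[/eqP -> /eqP ->].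
Qed.

Lemma WD x y : W R k x -> W R k y -> W R k (x + y).
Proof.
move=> Wx Wy ek; rewrite mxE; have := Wx ek; have := Wy ek.
by case: (x 0 0) => a b; case: (y 0 0) => c d /= -> ->; rewrite addr0.
Qed.

Lemma WZ a x : W R k x -> W R k (a%:C%C *: x).
Proof.
move=> Wx ek; rewrite mxE; have := Wx ek.
by case: (x 0 0) => c d /= ->; rewrite mulr0 mul0r addr0.
Qed.

Lemma W0 : W R k 0. Proof. by move=> ek; rewrite mxE. Qed.

Lemma W_sum (I : Type) (s : seq I) (P : pred I) (y : I -> V) :
  (forall i, P i -> W R k (y i)) -> W R k (\sum_(i <- s | P i) y i).
Proof.
by move=> h; elim/big_ind: _ => //; [exact: W0|move=> ? ? ? ?; exact: WD].
Qed.

Lemma sphere_neq0 x : sphereW R k x -> x != 0.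
Proof.
move=> [_ x1]; apply/negP => /eqP x0.
by move: x1; rewrite /= x0 inner0l => /eqP; rewrite eq_sym oner_eq0.
Qed.

End InnerLinear.

(** * The coordinates with respect to u_j *)

Section Alternating.
Variables (R : realType) (n k : nat).
Local Notation m := (2 * n + k)%N.
Local Notation C := (R[i]^o).
Local Notation V := 'rV[C]_(k./2).+1.
Implicit Types (x : V) (i : nat) (j : 'Z_m).

(** The pairing with u_i for a natural index i; it descends to Z/m by [ualt_addm], which makes sums
    and angle arithmetic possible before reduction modulo m. *)
Definition ualt i x : R := (-1) ^+ i * inner x (vphi k (i%:R * pi / m%:R)).
Definition alt j x : R := (-1) ^+ (j : nat) * inner x (vvec R j).

Lemma altE j x : alt j x = ualt j x.
Proof. by rewrite /alt vvecE. Qed.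

Lemma alt_suml (I : Type) (s : seq I) (P : pred I) (a : I -> R) (y : I -> V) j :
  alt j (\sum_(i <- s | P i) (a i)%:C%C *: y i) =
  \sum_(i <- s | P i) a i * alt j (y i).
Proof.
rewrite /alt inner_suml mulr_sumr; apply: eq_bigr => i _; ring.
Qed.

Lemma altZ a x j : alt j (a%:C%C *: x) = a * alt j x.
Proof. rewrite /alt innerZl; ring. Qed.

Lemma altD x y j : alt j (x + y) = alt j x + alt j y.
Proof. by rewrite /alt innerDl mulrDr. Qed.

Hypothesis n_gt0 : (0 < n)%N.

Lemma m_gt1 : (1 < m)%N.
Proof. by rewrite (leq_trans _ (leq_addr _ _)) // leq_pmulr. Qed.

Lemma m_gt0 : (0 < m)%N. Proof. exact: ltnW m_gt1. Qed.

Lemma mR_neq0 : m%:R != 0 :> R.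
Proof. by rewrite pnatr_eq0 -lt0n m_gt0. Qed.

Lemma Zm_ltn j : (j < m)%N.
Proof. by apply: leq_trans (ltn_ord j) _; rewrite Zp_cast // m_gt1. Qed.

Lemma val_Zm i : ((i%:R : 'Z_m) : nat) = (i %% m)%N.
Proof. by rewrite val_Zp_nat // m_gt1. Qed.

Lemma vphi_pi phi : vphi k (phi + pi) = (-1) ^+ k *: vphi k phi :> V.
Proof.
apply/rowP => t; rewrite !mxE mulrDr expiD expi_natpi mulrC; congr (_ * _).
by rewrite -signr_odd -[in RHS]signr_odd oddD odd_double oddb.
Qed.

Lemma complex_sign (b : nat) : ((-1) ^+ b : R[i]) = ((-1) ^+ b : R)%:C%C.
Proof. by rewrite rmorphXn rmorphN1. Qed.

Lemma sign_cycle_length : (-1) ^+ m = (-1) ^+ k :> R.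
Proof.
by rewrite -signr_odd oddD mul2n odd_double addFb signr_odd.
Qed.

(** A shift of the angle by pi multiplies v by (-1)^k, and this cancels against (-1)^m = (-1)^k.
    Thus the u_i are m-periodic, although for odd k the v_i are not. *)
Lemma ualt_addm i x : ualt (i + m) x = ualt i x.
Proof.
rewrite /ualt natrD !mulrDl [m%:R * _ / _]mulrAC divff ?mR_neq0 // mul1r.
rewrite vphi_pi complex_sign innerC innerZl innerC exprD sign_cycle_length.
by rewrite mulrACA mulrA -!mulrA [_ * (_ * inner _ _)]mulrA -expr2 sqrr_sign mul1r.
Qed.

Lemma ualt_mod i x : ualt (i %% m) x = ualt i x.
Proof.
rewrite {2}(divn_eq i m); elim: (i %/ m)%N => [|q IH]; first by rewrite add0n.
by rewrite (mulSn q) [(m + _)%N]addnC addnAC ualt_addm.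
Qed.

Lemma alt_nat i x : alt i%:R x = ualt i x.
Proof. by rewrite altE val_Zm ualt_mod. Qed.

(** The minus sign in the action makes sigma send v_j to -v_(j+1), hence u_j to u_(j+1), and the
    action is isometric. *)
Lemma alt_sigma j x : alt (j + 1) (W_sigma n x) = alt j x.
Proof.
rewrite -[j]natr_Zp natr1 !alt_nat /ualt exprS.
have -> : vphi k (j.+1%:R * pi / m%:R) =
    (-1 : R)%:C%C *: W_sigma n (vphi k ((j : nat)%:R * pi / m%:R)) :> V.
  apply/rowP => t; rewrite !mxE /angle rmorphN1 mulN1r opprK -expiD -natr1.
  by congr expi; ring.
by rewrite innerC innerZl innerC inner_sigma; ring.
Qed.

Lemma alt_rho j x : alt (- j) (W_rho x) = alt j x.
Proof.
have -> : - j = (m - j)%:R :> 'Z_m.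
  apply: val_inj; rewrite [RHS]val_Zm /=; move: (nat_of_ord j) => v.
  by rewrite Zp_cast // m_gt1.
rewrite alt_nat altE /ualt.
have -> : vphi k ((m - j)%:R * pi / m%:R) =
    ((-1) ^+ k : R)%:C%C *: W_rho (vphi k ((j : nat)%:R * pi / m%:R)) :> V.
  rewrite (natrB _ (ltnW (Zm_ltn j))) mulrBl mulrBl [m%:R * _ / _]mulrAC.
  rewrite divff ?mR_neq0 // mul1r addrC vphi_pi complex_sign; congr (_ *: _).
  by apply/rowP => t; rewrite !mxE expiJ mulrN.
rewrite innerC innerZl innerC inner_rho mulrA; congr (_ * _).
rewrite -sign_cycle_length -signr_odd -[X in _ * X]signr_odd -[RHS]signr_odd.
rewrite (oddB (ltnW (Zm_ltn j))) -signr_addb.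
by case: (odd m); case: (odd j).
Qed.

Lemma alt_eq0 x : W R k x -> (forall j, alt j x = 0) -> x = 0.
Proof.
move=> Wx x0; apply: (@inner_zeros R k x m (iota 0 m) Wx (iota_uniq _ _)).
- by apply/allP => i; rewrite mem_iota.
- by rewrite size_iota -[ltnLHS]add0n ltn_add2r muln_gt0.
move=> i; rewrite mem_iota /= add0n => im.
have := x0 i%:R; rewrite alt_nat /ualt => /eqP; rewrite mulf_eq0 signr_eq0.
by move/eqP.
Qed.

(** The product of [w] and the polynomial of x has degree m - 2, so samples of polynomials of degree
    m - k - 2 = 2n - 2 are linear relations among the u_i. *)
Lemma sum_ualt (d : nat) (w : R -> R) x : (d + k).+2 = m ->
  trig_poly d (fun phi => (w phi)%:C%C) ->
  \sum_(i < m) w (i%:R * pi / m%:R) * ualt i x = 0.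
Proof.
move=> dm tw.
have := trig_poly_alternating_sum (trig_polyM tw (trig_poly_inner x)).
rewrite dm => h; suff: (\sum_(i < m) w (i%:R * pi / m%:R) * ualt i x)%:C%C = 0 :> R[i].
  by case.
rewrite -h (big_morph (fun a : R => a%:C%C) (rmorphD (real_complex R)) (erefl 0)).
apply: eq_bigr => i _; rewrite /ualt complex_sign -!rmorphM; congr (_%:C%C).
by rewrite mulrCA.
Qed.

(** The relation with constant weight 1 says that the coordinates sum to zero, so they are not all
    positive. *)
Lemma exists_alt_le0 x : exists j, alt j x <= 0.
Proof.
have t0 : trig_poly 0 (fun phi => (1 : R)%:C%C).
  have := trig_poly_prod_sin ([::] : seq R) => -[P sP H].
  by exists P => // phi; rewrite -H big_nil.
have := @sum_ualt ((n.-1).*2 + 0) (fun=> 1) x _ (trig_poly_raisen n.-1 t0).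
rewrite addn0 -mul2n => /(_ _) h.
apply: contrapT => /forallNP H.
have /eqP : \sum_(i < m) 1 * ualt i x = 0.
  by apply: h; case: (n) n_gt0 => // n' _; rewrite mulnS.
rewrite psumr_eq0 => [/allP/(_ (Ordinal m_gt0) (mem_index_enum _))|i _].
  by rewrite mul1r /= -alt_nat => /eqP e; apply: (H 0%:R); rewrite e.
by rewrite mul1r -alt_nat ltW // ltNge; apply/negP/H.
Qed.

Lemma sin_npi_gt0 (a : R) : 0 < a -> a < m%:R -> 0 < sin (a * pi / m%:R).
Proof.
move=> a0 am; have m0 : (0 : R) < m%:R by rewrite ltr0n m_gt0.
apply: sin_gt0_pi; rewrite divr_gt0 ?mulr_gt0 ?pi_gt0 //=.
by rewrite ltr_pdivrMr // mulrC ltr_pM2l ?pi_gt0.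
Qed.

End Alternating.


(** A scan from [lo] that takes each index satisfying [a] and then skips its successor. The
    successor of a chosen index may be [hi] itself. *)
Lemma greedy_pairs (a : pred nat) (lo hi : nat) : exists s : seq nat,
  [/\ uniq s, forall i, i \in s -> i.+1 \notin s,
      forall i, i \in s -> [/\ (lo <= i)%N, (i < hi)%N & a i] &
      forall i, (lo <= i)%N -> (i < hi)%N -> a i ->
        exists2 e, e \in s & i = e \/ i = e.+1].
Proof.
move: {2}(hi - lo)%N (leqnn (hi - lo)%N) => N.
elim/ltn_ind: N lo => N IH lo hlo.
have [hl|lh] := leqP hi lo.
  by exists [::]; split => // i loi ih _; move: (leq_trans hl loi); lia.
have [al|nal] := boolP (a lo).
  have [||s [us ns rs cs]] := IH N.-2 _ lo.+2; [lia|lia|].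
  have lt2 i : i \in s -> (lo.+1 < i)%N by case/rs.
  exists (lo :: s); split => /=.
  - by rewrite us andbT; apply/negP => /lt2; lia.
  - move=> i; rewrite !inE negb_or => /orP[/eqP ->|iis].
      by rewrite gtn_eqF //=; apply/negP => /lt2; lia.
    by rewrite (ns i iis) andbT; have := lt2 i iis; lia.
  - move=> i; rewrite inE => /orP[/eqP -> //|/rs[h1 h2 h3]].
    by split => //; lia.
  - move=> i loi ih ai; have [le|gt] := leqP i lo.+1.
      by exists lo; rewrite ?mem_head //; lia.
    by have [e es h] := cs i gt ih ai; exists e; rewrite // inE es orbT.
have [||s [us ns rs cs]] := IH N.-1 _ lo.+1; [lia|lia|].
exists s; split => //.
- by move=> i /rs[h1 h2 h3]; split => //; lia.
- move=> i loi ih ai; apply: cs => //; rewrite ltn_neqAle loi andbT.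
  by apply: contraNneq nal => ->.
Qed.

Lemma count_below (a : pred nat) (i hi : nat) : (i <= hi)%N ->
  (\sum_(e < i) a e = \sum_(e <- [seq e <- iota 0 hi | a e]) (e < i))%N.
Proof.
move=> im; rewrite big_filter big_mkcond /= -(subnKC im) iotaD big_cat /=.
rewrite [X in (_ + X)%N]big1_seq ?addn0 => [|e]; last first.
  by case/andP=> _; rewrite mem_iota add0n => /andP[ie _]; rewrite ltnNge ie.
rewrite -(big_mkord xpredT (fun e => a e : nat)) /index_iota subn0.
rewrite [RHS]big_mkcond [LHS]big_seq [RHS]big_seq; apply: eq_bigr => e.
by rewrite mem_iota add0n /= => ->; case: ifP.
Qed.

(** * Gale's lemma with stable sets, and separation *)

Section StableSets.
Variables (R : realType) (n k : nat).
Hypothesis n_gt0 : (0 < n)%N.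
Local Notation m := (2 * n + k)%N.
Local Notation C := (R[i]^o).
Local Notation V := 'rV[C]_(k./2).+1.
Implicit Types (x : V) (i : nat) (j : 'Z_m).

Lemma card_Zm_nat (l : seq nat) : uniq l -> all (fun i => (i < m)%N) l ->
  #|finset (fun j : 'Z_m => (j : nat) \in l)| = size l.
Proof.
move=> ul lm; have valK i : (i < m)%N -> ((i%:R : 'Z_m) : nat) = i.
  by move=> im; rewrite val_Zm // modn_small.
rewrite -(size_map (fun i => i%:R : 'Z_m)) -(card_uniqP _); last first.
  rewrite map_inj_in_uniq // => i i' /(allP lm) il /(allP lm) il' e.
  by rewrite -(valK i) // e valK.
apply: eq_card => j; rewrite inE; apply/idP/mapP => [jl|[i il ->]].
  by exists (j : nat) => //; rewrite natr_Zp.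
by rewrite valK //; exact: (allP lm).
Qed.

(** Since 0 is not in [l], the cyclic pair {m - 1, 0} cannot occur, and having no consecutive
    naturals suffices; any n elements of [l] do. *)
Lemma stable_of_seq (l : seq nat) : uniq l -> (n <= size l)%N ->
  (forall i, i \in l -> (0 < i < m)%N) -> (forall i, i \in l -> i.+1 \notin l) ->
  exists T : SG n k, forall j, j \in val T -> (j : nat) \in l.
Proof.
move=> ul nl lm ll; pose T := finset (fun j : 'Z_m => (j : nat) \in take n l).
have sub i : i \in take n l -> i \in l by exact: mem_take.
suff sT : stable_subset T.
  exists (exist (fun T => is_true (stable_subset T)) T sT : SG n k).
  by move=> j; rewrite inE => /sub.
apply/andP; split.
  rewrite card_Zm_nat ?take_uniq ?size_takel //.
  by apply/allP => i /sub /lm /andP[].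
apply/forallP => j; rewrite !inE; apply/negP => /andP[/sub jl /sub].
have jm : (j < m)%N := Zm_ltn n_gt0 j.
rewrite -[j in (j + 1)]natr_Zp natr1 val_Zm //.
have [lt|] := ltnP j.+1 m; first by rewrite modn_small // (negbTE (ll _ jl)).
rewrite leq_eqVlt ltnNge jm orbF => /eqP <-; rewrite modnn => /lm.
by rewrite ltnn.
Qed.

(* If the greedy choice yields fewer than n pairs {e, e + 1} covering the
   positive entries of x, then the nonnegative trigonometric polynomial w
   vanishing exactly on these pairs has degree at most 2n - 2, so that
   sum_i w(i) (-1)^i <x, v_i> = 0 although no term is positive; hence
   <x, v_i> = 0 for at least k + 2 values of i. *)
Lemma positive_stable_rotated x : sphereW R k x -> alt (0 : 'Z_m) x <= 0 ->
  exists T : SG n k, forall j, j \in val T -> 0 < alt j x.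
Proof.
move=> Sx x0; have [Wx _] := Sx.
have m0 := m_gt0 k n_gt0.
(* The scan may start at 1 because coordinate 0 is not positive; this is what rules out a conflict
   between m - 1 and 0. *)
have [s [us ns rs cs]] := greedy_pairs (fun i => 0 < ualt n i x) 1 m.
have [nls|] := leqP n (size s).
  have [|T HT] := stable_of_seq us nls _ ns.
    by move=> i /rs[-> ->].
  by exists T => j /HT /rs[_ _]; rewrite altE.
move=> ls; exfalso; have /negP := sphere_neq0 Sx; apply; apply/eqP.
pose al i : R := i%:R * pi / m%:R.
pose w phi := \prod_(e <- s) (sin (phi - al e) * sin (phi - al e.+1)).
have tw : trig_poly (size s).*2 (fun phi => (w phi)%:C%C).
  have := trig_poly_prod_sin (map al s ++ map (fun e => al e.+1) s).
  rewrite size_cat !size_map addnn => -[P sP H]; exists P => // phi.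
  by rewrite -H /w big_split big_cat !big_map.
have al_sub i e : al i - al e = (i%:R - e%:R) * pi / m%:R.
  by rewrite /al !mulrBl.
have sin_nat a b : (b < a < b + m)%N -> 0 < sin (al a - al b).
  move=> /andP[ba ab]; rewrite al_sub; apply: sin_npi_gt0 => //.
    by rewrite subr_gt0 ltr_nat.
  by rewrite ltrBlDl -natrD ltr_nat.
(* No sample angle lies strictly between those of e and e + 1, so the two sines never have opposite
   signs at one. *)
have fac_ge0 i e : e \in s -> (i < m)%N ->
    0 <= sin (al i - al e) * sin (al i - al e.+1).
  move=> /rs[e1 em _] im; have [ei|ie] := ltnP e i.
    apply: mulr_ge0; first by apply/ltW/sin_nat; lia.
    have [->|ne] := eqVneq e.+1 i; first by rewrite subrr sin0.
    by apply/ltW/sin_nat; lia.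
  rewrite -mulrNN -!sinN !opprB; apply: mulr_ge0.
    have [->|ne] := eqVneq e i; first by rewrite subrr sin0.
    by apply/ltW/sin_nat; lia.
  (* The wrap-around case e = m - 1, i = 0: the angles differ by pi and the sine vanishes. *)
  have [h|ne] := eqVneq (e.+1 - i)%N m; last by apply/ltW/sin_nat; lia.
  rewrite al_sub -natrB ?h; last by lia.
  by rewrite mulrAC divff ?mul1r ?sinpi // mR_neq0.
have fac_neq0 i e : e \in s -> (i < m)%N -> i <> e -> i <> (e.+1 %% m)%N ->
    sin (al i - al e) * sin (al i - al e.+1) != 0.
  move=> /rs[e1 em _] im ie ie1.
  have ie1' : i <> e.+1 by move=> h; apply: ie1; rewrite -h modn_small.
  have ie0 : ~ (e.+1 = m /\ i = 0%N).
    by move=> [h h0]; apply: ie1; rewrite h modnn.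
  rewrite mulf_neq0 //.
    have [lt|ge] := ltnP e i; first by rewrite gt_eqF //; apply: sin_nat; lia.
    rewrite -oppr_eq0 -sinN opprB gt_eqF //; apply: sin_nat; lia.
  have [lt|ge] := ltnP e.+1 i; first by rewrite gt_eqF //; apply: sin_nat; lia.
  rewrite -oppr_eq0 -sinN opprB gt_eqF //; apply: sin_nat; lia.
have w_ge0 i : (i < m)%N -> 0 <= w (al i).
  by move=> im; rewrite /w big_seq; apply: prodr_ge0 => e es; exact: fac_ge0.
have w_eq0 i : (i < m)%N -> 0 < ualt n i x -> w (al i) = 0.
  move=> im xi; have i0 : (0 < i)%N.
    case: (i) xi => // xi; move: x0; rewrite -[0]/(0%:R : 'Z_m) alt_nat //.
    by rewrite leNgt xi.
  have [e es h] := cs i i0 im xi; apply/eqP; rewrite /w prodf_seq_eq0.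
  apply/hasP; exists e => //=.
  by case: h => ->; rewrite subrr sin0 ?mul0r ?mulr0.
(* Brings the degree from twice the number of pairs up to exactly 2n - 2, as [sum_ualt] demands. *)
have tw2 := trig_poly_raisen (n.-1 - size s) tw.
have sum0 : \sum_(i < m) w (al i) * ualt n i x = 0.
  by apply: (sum_ualt x _ tw2); rewrite -!addnn; lia.
have term i : (i < m)%N -> w (al i) * ualt n i x = 0.
  move=> im; move: sum0 => /eqP; rewrite -oppr_eq0 -sumrN psumr_eq0.
    move=> /allP/(_ (Ordinal im) (mem_index_enum _)) /=.
    by rewrite oppr_eq0 => /eqP.
  move=> i' _; rewrite oppr_ge0; have [pos|neg] := ltP 0 (ualt n i' x).
    by rewrite w_eq0 ?mul0r.
  by apply: mulr_ge0_le0 => //; exact: w_ge0.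
(* The zeros of [w] among the samples, at most 2(n - 1) of them; the reduction modulo m accounts for
   e = m - 1. *)
pose bad := s ++ map (fun e => e.+1 %% m)%N s.
pose t := [seq i <- iota 0 m | i \notin bad].
apply: (@inner_zeros R k x m t Wx).
- by rewrite filter_uniq // iota_uniq.
- by apply/allP => i; rewrite mem_filter mem_iota => /andP[_].
- have := count_predC (mem bad) (iota 0 m); rewrite size_iota size_filter => h.
  have : (count (mem bad) (iota 0 m) <= size bad)%N.
    rewrite -size_filter; apply: uniq_leq_size.
      by rewrite filter_uniq // iota_uniq.
    by move=> i; rewrite mem_filter => /andP[].
  rewrite size_cat size_map => h2.
  have -> : count (fun i => i \notin bad) (iota 0 m) =
    count (predC (mem bad)) (iota 0 m) by apply: eq_count.
  by move: h h2; set c1 := count _ _; set c2 := count _ _; lia.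
move=> i; rewrite mem_filter mem_iota mem_cat negb_or => /andP[/andP[i1 i2]].
move=> /= im; have wi : w (al i) != 0.
  rewrite /w prodf_seq_neq0; apply/allP => e es /=; apply: fac_neq0 => //.
    by move=> h; move: i1; rewrite h es.
  move=> h; move: i2; rewrite h => /negP; apply.
  by apply/mapP; exists e.
have /eqP := term i im; rewrite mulf_eq0 (negbTE wi) /= /ualt mulf_eq0.
by rewrite signr_eq0 => /eqP.
Qed.

Lemma W_sigma_iter_stable x i : sphereW R k x ->
  sphereW R k (iter i (W_sigma n) x).
Proof. by move=> Sx; elim: i => //= i; exact: W_sigma_stable. Qed.

Lemma alt_sigma_iter x j i :
  alt (j + i%:R) (iter i (W_sigma n) x) = alt j x.
Proof.
by elim: i => [|i IH]; rewrite ?addr0 // iterS -natr1 addrA alt_sigma.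
Qed.

Lemma mem_SG_sigma (T : SG n k) j : (j \in val (SG_sigma T)) = (j - 1 \in val T).
Proof.
rewrite /= /shift_set; apply/imsetP/idP => [[i iT ->]|jT]; first by rewrite addrK.
by exists (j - 1); rewrite ?subrK.
Qed.

Lemma mem_SG_rho (T : SG n k) j : (j \in val (SG_rho T)) = (- j \in val T).
Proof.
rewrite /= /opp_set; apply/imsetP/idP => [[i iT ->]|jT]; first by rewrite opprK.
by exists (- j); rewrite ?opprK.
Qed.

(** Gale's lemma: some u_j with j in a stable n-set lie in the open hemisphere around x. A
    nonpositive coordinate [j0] is rotated to position 0, and the set found there is rotated
    back. *)
Lemma positive_stable x : sphereW R k x ->
  exists T : SG n k, forall j, j \in val T -> 0 < alt j x.
Proof.
move=> Sx; have [j0 x0] := exists_alt_le0 n_gt0 x.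
have jm := Zm_ltn n_gt0 j0.
have step i (y : V) : (exists T : SG n k, forall j, j \in val T -> 0 < alt j y) ->
   exists T : SG n k, forall j, j \in val T -> 0 < alt j (iter i (W_sigma n) y).
  move=> H; elim: i => [//|i [T HT]]; exists (SG_sigma T) => j.
  by rewrite mem_SG_sigma => /HT; rewrite -[j in X in _ -> X](subrK 1) alt_sigma.
have -> : x = iter j0 (W_sigma n) (iter (m - j0) (W_sigma n) x).
  by rewrite -iterD (subnKC (ltnW jm)) (W_sigma_iter x n_gt0).
apply: step; apply: positive_stable_rotated; first exact: W_sigma_iter_stable.
rewrite -(alt_sigma_iter _ j0 (m - j0)) in x0.
move: x0; congr (alt _ _ <= 0).
have -> : j0 + (m - j0)%:R = (j0 + (m - j0))%:R :> 'Z_m by rewrite natrD natr_Zp.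
by rewrite (subnKC (ltnW jm)); apply: val_inj; rewrite [LHS]val_Zm //= modnn.
Qed.

Lemma negative_stable x : sphereW R k x ->
  exists T : SG n k, forall j, j \in val T -> alt j x < 0.
Proof.
move=> Sx; pose y : V := (-1 : R)%:C%C *: x.
have Sy : sphereW R k y.
  split; first by apply: WZ; case: Sx.
  by rewrite /= /y innerZl innerC innerZl mulrA mulrNN !mul1r; case: Sx.
have [T HT] := positive_stable Sy; exists T => j /HT.
by rewrite /y altZ mulN1r oppr_gt0.
Qed.

Section Separation.
Variable S : SG n k.
Local Notation a i := ((i%:R : 'Z_m) \in val S).
Local Notation z i := (~~ a i && ~~ a i.+1).

Lemma S_no_adj i : a i -> ~~ a i.+1.
Proof.
move=> ai; case: S ai => /= T /andP[_ /forallP/(_ i%:R)].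
by rewrite natr1 => h ai; move: h; rewrite ai.
Qed.

(** The number of prescribed zeros to the left of i. *)
Definition gaps i := (\sum_(e < i) z e)%N.

(** From e to e + 1 membership in [S] switches, except exactly at the e counted by [gaps]. The
    induction goes back two steps across an element of [S] to stay outside [S]. *)
Lemma gaps_parity i : ~~ a i -> odd (i + gaps i) = a 0.
Proof.
have gS e : gaps e.+1 = (gaps e + z e)%N by rewrite /gaps big_ord_recr.
elim/ltn_ind: i => -[|i] IH ai.
  by rewrite /gaps big_ord0 (negbTE ai).
have [ai'|ai'] := boolP (a i); last first.
  rewrite gS ai' ai -(IH i (ltnSn i) ai') /=; set g := gaps i; lia.
case: i IH ai ai' => [|i] IH ai ai'.
  by rewrite gS ai' /gaps big_ord0.
have nai : ~~ a i by apply/negP => /S_no_adj; rewrite ai'.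
rewrite !gS ai' /= andbF !addn0 negbK; apply: IH => //; lia.
Qed.

Lemma sum_mem_S : (\sum_(i < m) a i = n)%N.
Proof.
case: S => T /=  /andP[/eqP cT _]; rewrite -[RHS]cT -sum1_card.
rewrite (reindex (fun i : 'I_m => (i : nat)%:R : 'Z_m)) /=.
  rewrite [RHS]big_mkcond; by apply: eq_bigr => i _; case: (_ \in T).
exists (fun j => Ordinal (Zm_ltn n_gt0 j)) => [i _|j _].
  by apply: val_inj; rewrite /= -[LHS]/((_ : 'Z_m) : nat) val_Zm // modn_small.
by rewrite /= natr_Zp.
Qed.

(** Each i is of exactly one kind: i in S, i + 1 in S, or a gap. The first two kinds have n members
    each, leaving m - 2n = k. *)
Lemma gaps_total : gaps m = k.
Proof.
have shift : (\sum_(i < m) a i.+1 = n)%N.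
  have := big_ord_recl m (op := addn) (idx := 0%N)
    (fun i : 'I_m.+1 => nat_of_bool (a i)).
  rewrite big_ord_recr /= sum_mem_S.
  have -> : (m%:R : 'Z_m) = 0%:R.
    by apply: val_inj; rewrite [LHS]val_Zm //= modnn.
  by move=> /eqP; rewrite addnC eqn_add2l => /eqP/esym.
have : (\sum_(i < m) (z i + a i + a i.+1) = m)%N.
  rewrite -[RHS]card_ord -sum1_card; apply: eq_bigr => i _.
  by have [/S_no_adj/negbTE ->|] := boolP (a i); last case: (a i.+1).
rewrite !big_split /= sum_mem_S shift => /eqP.
by rewrite -addnA addnn -mul2n addnC eqn_add2l => /eqP.
Qed.

(* The trigonometric polynomial with the k zeros lying halfway between j and
   j + 1 for all j such that neither of them belongs to S. *)
Lemma separating_vector :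
  exists2 x, W R k x & forall j, j \notin val S -> alt j x < 0.
Proof.
pose s := [seq i <- iota 0 m | z i].
pose be i : R := (2 * i%:R + 1) / 2 * pi / m%:R.
pose F phi := \prod_(e <- map be s) sin (phi - e).
have gapsE i : (i <= m)%N -> gaps i = (\sum_(e <- s) (e < i))%N.
  exact: (count_below (fun e => z e)).
have size_s : size s = k.
  rewrite -gaps_total gapsE // -sum1_size; apply: eq_big_seq => e.
  by rewrite mem_filter mem_iota => /andP[_ /= ->].
have [x Wx Fx] : exists2 x, W R k x & forall phi, F phi = inner x (vphi k phi).
  apply: trig_poly_real; rewrite -[X in trig_poly X]size_s -(size_map be).
  exact: trig_poly_prod_sin.
(* At j outside [S] the polynomial has sign (-1)^(k - gaps j), one factor for each zero to the
   right, and (-1)^j is (-1)^(gaps j + a 0). Their product does not depend on j, and [c] is minus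
   that sign. *)
pose c : R := - (-1) ^+ (k + a 0).
exists (c%:C%C *: x); first exact: WZ.
move=> j jS; have jm := Zm_ltn n_gt0 j.
have par := @gaps_parity j; rewrite natr_Zp in par.
have sj : (-1) ^+ j = (-1) ^+ (gaps j + a 0) :> R.
  rewrite -signr_odd -[RHS]signr_odd -(par jS) !oddD oddb.
  by case: (odd j); case: (odd (gaps j)).
rewrite altZ altE /ualt sj -Fx /c mulNr oppr_lt0.
have -> : (-1) ^+ (k + a 0) * ((-1) ^+ (gaps j + a 0) * F (j%:R * pi / m%:R)) =
   (-1) ^+ (gaps j) * \prod_(e <- s) - sin (j%:R * pi / m%:R - be e) :> R.
  have eN (l : seq nat) (f : nat -> R) :
      \prod_(e <- l) - f e = (-1) ^+ size l * \prod_(e <- l) f e.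
    elim: l => [|e l IH]; first by rewrite !big_nil mul1r.
    by rewrite !big_cons IH /= exprS; ring.
  rewrite eN size_s /F big_map !exprD; case: (a 0); rewrite ?expr1 ?expr0; ring.
rewrite (gapsE _ (ltnW jm)) -prodrXr -big_split /= big_seq; apply: prodr_gt0 => e.
rewrite mem_filter mem_iota add0n => /andP[_ /= em].
have fE (M u v : R) : M != 0 -> u * pi / M - (2 * v + 1) / 2 * pi / M =
    ((2 * u - 2 * v - 1) / 2) * pi / M by move=> ?; field.
rewrite /be (fE _ _ _ (mR_neq0 R k n_gt0)).
have jm' : (j%:R + 1 : R) <= m%:R by rewrite natr1 ler_nat.
have em' : (e%:R + 1 : R) <= m%:R by rewrite natr1 ler_nat.
have j0 : (0 : R) <= j%:R by []; have e0 : (0 : R) <= e%:R by [].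
have [ej|je] := ltnP e j.
  have ej' : (e%:R + 1 : R) <= j%:R by rewrite natr1 ler_nat.
  by rewrite expr1 mulrNN mul1r; apply: sin_npi_gt0 => //; lra.
have je' : (j%:R : R) <= e%:R by rewrite ler_nat.
by rewrite expr0 mul1r -sinN -!mulNr; apply: sin_npi_gt0 => //; lra.
Qed.

End Separation.
End StableSets.


(** * Convergence and normalization in W *)

Section RowTopology.
Variables (R : realType) (r : nat).
Local Notation C := (R[i]^o).
Local Notation V := 'rV[C]_r.+1.

Lemma cvg_complex (T : Type) (F : set_system T) (f : T -> C) (z : C) :
  Filter F ->
  complex.Re (f x) @[x --> F] --> complex.Re z ->
  complex.Im (f x) @[x --> F] --> complex.Im z -> f @ F --> z.
Proof.
move=> FF fr fi A [e /= e0 eA].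
(* Radii of balls in [R[i]] are complex numbers, but a positive one is real. *)
have [e1 e2] : complex.Im e = 0 /\ 0 < complex.Re e.
  by move: e0; rewrite ltcE => /andP[/eqP].
have key w : `|complex.Re z - complex.Re w| < complex.Re e / 2 ->
    `|complex.Im z - complex.Im w| < complex.Re e / 2 -> A w.
  move: e e0 eA e1 e2 => [ea eb] /= e0 eA e1 e2 hr hi; apply: eA => /=.
  rewrite e1 normc_def ltcR.
  have -> : ea = Num.sqrt (ea ^+ 2) by rewrite sqrtr_sqr gtr0_norm.
  rewrite ltr_sqrt ?exprn_gt0 //.
  move: z w hr hi {fr fi} => [a b] [c d] /=; rewrite !ltr_norml.
  by move=> /andP[h1 h2] /andP[h3 h4]; nra.
have hr : \forall x \near F, `|complex.Re z - complex.Re (f x)| < complex.Re e / 2.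
  by apply: cvgr_dist_lt => //; rewrite divr_gt0.
have hi : \forall x \near F, `|complex.Im z - complex.Im (f x)| < complex.Re e / 2.
  by apply: cvgr_dist_lt => //; rewrite divr_gt0.
by apply: filterS2 hr hi => x; exact: key.
Qed.

Lemma cvg_rV (T : Type) (F : set_system T) (f : T -> V) (y : V) :
  Filter F ->
  (forall t, complex.Re (f x 0 t) @[x --> F] --> complex.Re (y 0 t)) ->
  (forall t, complex.Im (f x 0 t) @[x --> F] --> complex.Im (y 0 t)) ->
  f @ F --> y.
Proof.
move=> FF fr fi A [/= P Py sPA].
have h t : \forall x \near F, P 0 t (f x 0 t).
  by apply: (@cvg_complex _ F (fun x => f x 0 t) (y 0 t)) => //; exact: Py.
have : \forall x \near F, forall t, P 0 t (f x 0 t) by apply: filter_forall.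
by apply: filterS => x Px; apply: sPA => i t; rewrite (ord1 i); exact: Px.
Qed.

Lemma cvg_rV_coord (T : Type) (F : set_system T) (f : T -> V) (y : V) t :
  Filter F -> f @ F --> y ->
  (complex.Re (f x 0 t) @[x --> F] --> complex.Re (y 0 t)) /\
  (complex.Im (f x 0 t) @[x --> F] --> complex.Im (y 0 t)).
Proof.
move=> FF fy.
suff H e : 0 < e -> \forall x \near F,
    `|complex.Re (y 0 t) - complex.Re (f x 0 t)| < e /\
    `|complex.Im (y 0 t) - complex.Im (f x 0 t)| < e.
  by split; apply/cvgrPdist_lt => e /H; apply: filterS => x [].
move=> e0; apply: (fy (fun w : V => `|complex.Re (y 0 t) - complex.Re (w 0 t)| < e /\
  `|complex.Im (y 0 t) - complex.Im (w 0 t)| < e)).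
exists (fun i u => if u == t then
    [set z : C | `|complex.Re (y 0 t) - complex.Re z| < e /\
      `|complex.Im (y 0 t) - complex.Im z| < e] else setT) => [i u|w /= Pw].
  case: eqP => [->|_]; last exact: filterT.
  exists e%:C%C => /=; first by rewrite ltcR.
  move=> z /=; rewrite (ord1 i) normc_def ltcR => h.
  set a := complex.Re _ - _; set b := complex.Im _ - _.
  have h' : Num.sqrt (a ^+ 2 + b ^+ 2) < e.
    by move: h; case: (y 0 t) @a @b => ? ?; case: z.
  have le (u1 v1 : R) : `|u1| <= Num.sqrt (u1 ^+ 2 + v1 ^+ 2).
    by rewrite -sqrtr_sqr ler_wsqrtr // lerDl sqr_ge0.
  split; apply: le_lt_trans h'; first exact: le.
  by rewrite addrC; exact: le.
by have := Pw 0 t; rewrite eqxx.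
Qed.

End RowTopology.

Section RowMaps.
Variables (R : realType) (k : nat).
Local Notation C := (R[i]^o).
Local Notation V := 'rV[C]_(k./2).+1.
Variables (T : Type) (F : set_system T).
Hypothesis FF : Filter F.

Lemma cvg_inner (f g : T -> V) (y z : V) : f @ F --> y -> g @ F --> z ->
  inner (f x) (g x) @[x --> F] --> inner y z.
Proof.
move=> fy gz; apply: cvg_sumr => t _.
have [fr fi] := cvg_rV_coord t FF fy; have [gr gi] := cvg_rV_coord t FF gz.
have reE (a b : C) : complex.Re (a * b^*%C) =
    complex.Re a * complex.Re b + complex.Im a * complex.Im b.
  by case: a => ? ?; case: b => ? ? /=; rewrite mulrN opprK.
under eq_cvg do rewrite reE.
by rewrite reE; apply: cvgD; exact: cvgM.
Qed.

Lemma cvg_scale (a : T -> R) (f : T -> V) (c : R) (y : V) :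
  a @ F --> c -> f @ F --> y ->
  ((a x)%:C%C *: f x : V) @[x --> F] --> (c%:C%C *: y : V).
Proof.
move=> ac fy; apply: cvg_rV => t; have [fr fi] := cvg_rV_coord t FF fy.
  have reE (u : R) (v : V) : complex.Re ((u%:C%C *: v) 0 t) = u * complex.Re (v 0 t).
    by rewrite mxE; case: (v 0 t) => ? ? /=; ring.
  under eq_cvg do rewrite reE.
  by rewrite reE; exact: cvgM.
have imE (u : R) (v : V) : complex.Im ((u%:C%C *: v) 0 t) = u * complex.Im (v 0 t).
  by rewrite mxE; case: (v 0 t) => ? ? /=; ring.
under eq_cvg do rewrite imE.
by rewrite imE; exact: cvgM.
Qed.

Lemma cvg_rVD (f g : T -> V) (y z : V) : f @ F --> y -> g @ F --> z ->
  (f x + g x : V) @[x --> F] --> (y + z : V).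
Proof.
move=> fy gz; apply: cvg_rV => t;
have [fr fi] := cvg_rV_coord t FF fy; have [gr gi] := cvg_rV_coord t FF gz.
  have reE (u v : V) : complex.Re ((u + v) 0 t) =
      complex.Re (u 0 t) + complex.Re (v 0 t).
    by rewrite mxE; case: (u 0 t) => ? ?; case: (v 0 t).
  under eq_cvg do rewrite reE.
  by rewrite reE; exact: cvgD.
have imE (u v : V) : complex.Im ((u + v) 0 t) =
    complex.Im (u 0 t) + complex.Im (v 0 t).
  by rewrite mxE; case: (u 0 t) => ? ?; case: (v 0 t).
under eq_cvg do rewrite imE.
by rewrite imE; exact: cvgD.
Qed.

Lemma cvg_normalize (f : T -> V) (y : V) : y != 0 -> f @ F --> y ->
  normalize (f x) @[x --> F] --> normalize y.
Proof.
move=> y0 fy; apply: cvg_scale => //; apply: cvgV.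
  rewrite gt_eqF // sqrtr_gt0 lt_neqAle inner_ge0 andbT eq_sym.
  by apply: contra y0 => /eqP/inner_eq0 ->.
apply: (@cvg_comp _ _ _ (fun x => inner (f x) (f x)) Num.sqrt F
  (nbhs (inner y y))); last exact: sqrt_continuous.
exact: cvg_inner.
Qed.

End RowMaps.

Lemma cvg_comb (R : realType) (k : nat) (T : Type) (F : set_system T)
    (I : finType) (f : T -> I -> R) (p : I -> R) (y : I -> 'rV[R[i]^o]_(k./2).+1) :
  Filter F ->
  (forall i, f x i @[x --> F] --> p i) ->
  (\sum_i (f x i)%:C%C *: y i : 'rV[R[i]^o]_(k./2).+1) @[x --> F] -->
  (\sum_i (p i)%:C%C *: y i : 'rV[R[i]^o]_(k./2).+1).
Proof.
move=> FF fp; apply: cvg_big => [z|i _]; last exact: cvg_scale (fp i) (cvg_cst _).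
by apply: cvg_rVD; [exact: cvg_fst|exact: cvg_snd].
Qed.


Lemma hausdorff_rV (R : realType) (r : nat) : hausdorff_space 'rV[R[i]^o]_r.+1.
Proof. exact: (@norm_hausdorff R[i] 'rV[R[i]^o]_r.+1). Qed.

Section Normalize.
Variables (R : realType) (k : nat).
Local Notation C := (R[i]^o).
Local Notation V := 'rV[C]_(k./2).+1.
Implicit Types x y : V.

Lemma inner_gt0 x : x != 0 -> 0 < inner x x.
Proof.
move=> x0; rewrite lt_neqAle inner_ge0 andbT eq_sym.
by apply: contra x0 => /eqP/inner_eq0 ->.
Qed.

Definition scal x : R := (Num.sqrt (inner x x))^-1.

Lemma normalizeE x : normalize x = (scal x)%:C%C *: x.
Proof. by []. Qed.

Lemma scal_gt0 x : x != 0 -> 0 < scal x.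
Proof. by move=> /inner_gt0 x0; rewrite invr_gt0 sqrtr_gt0. Qed.

Lemma scale_realA (a c : R) x : a%:C%C *: (c%:C%C *: x) = (a * c)%:C%C *: x :> V.
Proof. by rewrite scalerA rmorphM. Qed.

Lemma normalize_sphere x : W R k x -> x != 0 -> sphereW R k (normalize x).
Proof.
move=> Wx x0; split; first exact: WZ.
rewrite /= normalizeE innerZl innerC innerZl mulrA /scal -expr2 exprVn.
by rewrite sqr_sqrtr ?inner_ge0 // mulVf // gt_eqF // inner_gt0.
Qed.

Lemma normalizeZ (a : R) x : 0 < a -> normalize (a%:C%C *: x) = normalize x.
Proof.
move=> a0; rewrite !normalizeE scale_realA; congr (_%:C%C *: _).
rewrite /scal innerZl innerC innerZl mulrA -expr2 sqrtrM ?sqr_ge0 //.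
by rewrite sqrtr_sqr gtr0_norm // invfM mulrAC mulVf ?mul1r // gt_eqF.
Qed.

Lemma normalize_id x : sphereW R k x -> normalize x = x.
Proof.
by case=> _ /= x1; rewrite normalizeE /scal x1 sqrtr1 invr1 scale1r.
Qed.

Lemma normalize_inj x y : x != 0 -> y != 0 -> normalize x = normalize y ->
  exists2 a : R, 0 < a & x = a%:C%C *: y.
Proof.
move=> x0 y0 e; have sx := scal_gt0 x0; have sy := scal_gt0 y0.
exists ((scal x)^-1 * scal y); first by apply: mulr_gt0 => //; rewrite invr_gt0.
have : (scal x)^-1%:C%C *: normalize x = (scal x)^-1%:C%C *: normalize y.
  by rewrite e.
by rewrite !normalizeE !scale_realA mulVf ?gt_eqF // scale1r.
Qed.

Lemma alt_normalize n (j : 'Z_(2 * n + k)) x :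
  alt j (normalize x) = scal x * alt j x.
Proof. by rewrite normalizeE altZ. Qed.

End Normalize.


(** * The barycentric subdivision of the sphere *)

Section SignOrder.
Variable m : nat.

Lemma sign_le_refl : reflexive (@sign_le m).
Proof. by move=> s; apply/forallP => j; rewrite eqxx orbT. Qed.

Lemma sign_le_anti : antisymmetric (@sign_le m).
Proof.
move=> s t /andP[/forallP st /forallP ts]; apply/ffunP => j.
by have := st j; have := ts j; case: (s j) => [[]|]; case: (t j) => [[]|].
Qed.

Lemma sign_le_trans : transitive (@sign_le m).
Proof.
move=> t s u /forallP st /forallP tu; apply/forallP => j.
have := st j; have := tu j.
by case: (s j) => [[]|]; case: (t j) => [[]|]; case: (u j) => [[]|].
Qed.

End SignOrder.

Lemma realization_supp (R : realType) (T : finType) (lt : rel T) (P : {set T})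
    (p : {ptws T -> R}) : realization lt P p -> exists a, p a != 0.
Proof.
move=> [_ p1 _ _]; apply: contrapT => /forallNP h.
have /eqP := p1; rewrite big1 ?(eq_sym 0) ?oner_eq0 // => t _.
by apply/eqP/negPn/negP; exact: h.
Qed.

Section SignVectors.
Variables (R : realType) (n k : nat).
Local Notation m := (2 * n + k)%N.
Local Notation C := (R[i]^o).
Local Notation V := 'rV[C]_(k./2).+1.
Implicit Types (x y : V) (j : 'Z_m) (s t : sign_vector m).

(** Flipping both signs preserves the order, so it can be tested on the pairings with u_j in place
    of v_j. *)
Lemma sign_le_real (a c : R) (e : bool) :
  ((sign a == None) || (sign a == sign c)) =
  ((0 < (-1) ^+ e * a) ==> (0 < (-1) ^+ e * c)) &&
  (((-1) ^+ e * a < 0) ==> ((-1) ^+ e * c < 0)).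
Proof.
rewrite /sign; case: e; rewrite ?expr0 ?expr1 ?mul1r ?mulN1r ?oppr_gt0 ?oppr_lt0;
by case: (ltgtP a 0) => ha; case: (ltgtP c 0) => hc.
Qed.

Lemma sign_leP x y : reflect (forall j, (0 < alt j x -> 0 < alt j y) /\
    (alt j x < 0 -> alt j y < 0)) (sign_le (sgnvec n x) (sgnvec n y)).
Proof.
apply: (iffP forallP) => h j; have := h j; rewrite /alt -(signr_odd R) !ffunE.
  by rewrite (sign_le_real _ _ (odd j)) => /andP[/implyP ? /implyP].
by case=> /implyP h1 /implyP h2; rewrite (sign_le_real _ _ (odd j)) h1 h2.
Qed.

Lemma sgnvec_eq x y :
  (forall j, [/\ 0 < alt j y -> 0 < alt j x, alt j y < 0 -> alt j x < 0 &
              alt j y = 0 -> alt j x = 0]) -> sgnvec n x = sgnvec n y.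
Proof.
move=> h; apply: sign_le_anti; apply/andP; split; apply/sign_leP => j.
  have [h1 h2 h3] := h j.
  case: (ltgtP (alt j y) 0) h1 h2 h3 => [hy _ H _|hy H _ _|hy _ _ H].
  - by split => // hx; move: (lt_trans hx (H isT)); rewrite ltxx.
  - by split => // hx; move: (lt_trans (H isT) hx); rewrite ltxx.
  - by rewrite H // ltxx.
by have [h1 h2 _] := h j.
Qed.

Lemma mem_S_0 x j : (j \in S_ ord0 (sgnvec n x)) = (0 < alt j x).
Proof.
rewrite inE ffunE /alt /sign /= expr0 -[in LHS]signr_odd -[in RHS]signr_odd.
case: (ltgtP (inner x (vvec R j)) 0) => h; case: (odd j);
  rewrite ?expr0 ?expr1 ?mul1r ?mulN1r ?oppr_gt0 ?h ?ltxx ?(lt_gtF h) //=.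
Qed.

Lemma mem_S_1 x j : (j \in S_ ord_max (sgnvec n x)) = (alt j x < 0).
Proof.
rewrite inE ffunE /alt /sign /= expr1 -[in LHS]signr_odd -[in RHS]signr_odd.
case: (ltgtP (inner x (vvec R j)) 0) => h; case: (odd j);
  rewrite ?expr0 ?expr1 ?mul1r ?mulN1r ?oppr_lt0 ?h ?ltxx ?(lt_gtF h) //=.
Qed.

Lemma sgnvec_normalize x : x != 0 -> sgnvec n (normalize x) = sgnvec n x.
Proof.
move=> /scal_gt0 sx; apply: sgnvec_eq => j; rewrite alt_normalize; split=> h.
- by rewrite mulr_gt0.
- by rewrite pmulr_rlt0.
- by rewrite h mulr0.
Qed.

Lemma mem_L x : sphereW R k x -> sgnvec n x \in L R n k.
Proof. by move=> Sx; rewrite inE; apply/asboolP; exists x. Qed.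

End SignVectors.

Section Subdivision.
Variables (R : realType) (n k : nat).
Hypothesis n_gt0 : (0 < n)%N.
Local Notation m := (2 * n + k)%N.
Local Notation C := (R[i]^o).
Local Notation V := 'rV[C]_(k./2).+1.
Variable b : sign_vector m -> V.
Hypothesis hb : barycenters b.
Implicit Types (x y : V) (j : 'Z_m) (s t : sign_vector m).
Local Notation L := (L R n k).
Local Notation le := (@sign_le m).

Lemma b_sphere s : s \in L -> sphereW R k (b s).
Proof. by case: hb => H _ /H[]. Qed.

Lemma b_sgn s : s \in L -> sgnvec n (b s) = s.
Proof. by case: hb => H _ /H[]. Qed.

Lemma b_W s : s \in L -> W R k (b s).
Proof. by move=> /b_sphere[]. Qed.

Lemma sign_le_b s t : s \in L -> t \in L -> le s t ->
  forall j, (0 < alt j (b s) -> 0 < alt j (b t)) /\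
            (alt j (b s) < 0 -> alt j (b t) < 0).
Proof.
by move=> sL tL; rewrite -{1}(b_sgn sL) -{1}(b_sgn tL) => /sign_leP.
Qed.

(** Comparable sign vectors have no opposite signs, so no coordinate cancels in a combination along
    a chain. *)
Lemma comparable_b s t j : s \in L -> t \in L -> le s t || le t s ->
  (0 < alt j (b s) -> 0 <= alt j (b t)) /\
  (alt j (b s) < 0 -> alt j (b t) <= 0).
Proof.
move=> sL tL /orP[h|h];
  [have [h1 h2] := sign_le_b sL tL h j|have [h1 h2] := sign_le_b tL sL h j].
  by split=> [/h1/ltW|/h2/ltW].
split=> hs; rewrite leNgt; apply/negP => ht.
  by move: (lt_trans hs (h2 ht)); rewrite ltxx.
by move: (lt_trans (h1 ht) hs); rewrite ltxx.
Qed.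

(** Points of the cone over |L|, apex included. Without the condition of total mass 1, weights can
    be subtracted, which both inductions below rely on, and [comb] maps onto all of W. *)
Definition chain_weight (p : sign_vector m -> R) :=
  [/\ forall s, 0 <= p s, forall s, p s != 0 -> s \in L &
      forall s t, p s != 0 -> p t != 0 -> le s t || le t s].

Definition comb (p : sign_vector m -> R) : V := \sum_s (p s)%:C%C *: b s.

Lemma comb_W p : chain_weight p -> W R k (comb p).
Proof.
case=> p0 pL _; apply: W_sum => s _.
by have [->|/pL/b_W] := eqVneq (p s) 0; [rewrite scale0r; exact: W0|exact: WZ].
Qed.

Lemma alt_comb p j : alt j (comb p) = \sum_s p s * alt j (b s).
Proof. exact: alt_suml. Qed.

Lemma comb_pos p j s : chain_weight p -> p s != 0 -> 0 < alt j (b s) ->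
  0 < alt j (comb p).
Proof.
move=> [p0 pL pC] ps h; rewrite alt_comb (bigD1 s) //=; apply: ltr_wpDr.
  apply: sumr_ge0 => t _; have [->|pt] := eqVneq (p t) 0; first by rewrite mul0r.
  apply: mulr_ge0 => //; have [H _] := comparable_b j (pL s ps) (pL t pt) (pC s t ps pt).
  exact: H.
by apply: mulr_gt0 => //; rewrite lt_neqAle eq_sym ps p0.
Qed.

Lemma comb_neg p j s : chain_weight p -> p s != 0 -> alt j (b s) < 0 ->
  alt j (comb p) < 0.
Proof.
move=> [p0 pL pC] ps h; rewrite alt_comb (bigD1 s) //= -oppr_gt0 opprD.
apply: ltr_wpDr; last first.
  by rewrite oppr_gt0 pmulr_rlt0 // lt_neqAle eq_sym ps p0.
rewrite -sumrN; apply: sumr_ge0 => t _.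
have [->|pt] := eqVneq (p t) 0; first by rewrite mul0r oppr0.
rewrite oppr_ge0; apply: mulr_ge0_le0 => //.
by have [_ H] := comparable_b j (pL s ps) (pL t pt) (pC s t ps pt); exact: H.
Qed.

Lemma b_alt_neq0 s : s \in L -> exists j, alt j (b s) != 0.
Proof.
move=> sL; apply: contrapT => /forallNP h.
have := sphere_neq0 (b_sphere sL); rewrite (alt_eq0 n_gt0 (b_W sL)) ?eqxx //.
by move=> j; apply/eqP/negPn/negP; exact: h.
Qed.

Lemma comb_neq0 p s : chain_weight p -> p s != 0 -> comb p != 0.
Proof.
move=> cp ps; have [p0 pL pC] := cp; have [j] := b_alt_neq0 (pL s ps).
apply: contraNneq => c0; have a0 : alt j (comb p) = 0.
  by rewrite c0 /alt inner0l mulr0.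
case: (ltgtP (alt j (b s)) 0) => h //.
  by have := comb_neg cp ps h; rewrite a0 ltxx.
by have := comb_pos cp ps h; rewrite a0 ltxx.
Qed.

Lemma chain_weight_top p s : chain_weight p -> p s != 0 ->
  exists2 t, p t != 0 & (forall u, p u != 0 -> le u t).
Proof.
move=> [p0 pL pC] ps; pose S := finset (fun t => p t != 0).
have [||t] := @chain_max _ le S (@sign_le_refl m) (@sign_le_trans m).
- by move=> t u; rewrite !inE; exact: pC.
- by apply/set0Pn; exists s; rewrite inE.
by rewrite inE => pt H; exists t => // u pu; apply: H; rewrite inE.
Qed.

(** Nothing cancels along the chain, and every nonzero sign occurring in it already occurs in its
    top. *)
Lemma sgnvec_comb p t : chain_weight p -> p t != 0 ->
  (forall u, p u != 0 -> le u t) -> sgnvec n (comb p) = t.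
Proof.
move=> cp pt top; have [p0 pL pC] := cp; rewrite -[RHS](b_sgn (pL t pt)).
apply: sgnvec_eq => j; split; [exact: comb_pos|exact: comb_neg|].
move=> h; rewrite alt_comb big1 // => u _.
have [->|pu] := eqVneq (p u) 0; first by rewrite mul0r.
have [h1 h2] := sign_le_b (pL u pu) (pL t pt) (top u pu) j.
suff -> : alt j (b u) = 0 by rewrite mulr0.
by case: (ltgtP (alt j (b u)) 0) => // [/h2|/h1]; rewrite h ltxx.
Qed.

Lemma weight_sub_supp p s (d : R) t : 0 <= d <= p s ->
  p t - d * (t == s)%:R != 0 -> p t != 0.
Proof.
move=> /andP[d0 ds]; have [->|_] := eqVneq t s; last by rewrite mulr0 subr0.
by apply: contraNneq => p_0; rewrite mulr1 p_0 subr_eq0 eq_le d0 -p_0 ds.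
Qed.

Lemma chain_weight_sub p s (d : R) : chain_weight p -> 0 <= d <= p s ->
  chain_weight (fun t => p t - d * (t == s)%:R).
Proof.
move=> [p0 pL pC] dp; have supp t := @weight_sub_supp p s d t dp.
have /andP[d0 ds] := dp.
split=> [t|t /supp/pL //|t u /supp pt /supp pu]; last exact: pC.
by have [->|_] := eqVneq t s; rewrite ?mulr1 ?mulr0 ?subr0 // subr_ge0.
Qed.

Lemma comb_sub p s (d : R) :
  comb (fun t => p t - d * (t == s)%:R) = comb p - d%:C%C *: b s.
Proof.
rewrite /comb -(big_pred1_eq +%R s (fun t => d%:C%C *: b t)) big_mkcond -sumrB.
apply: eq_bigr => t _; rewrite rmorphB scalerBl; congr (_ - _).
by case: eqP; rewrite ?mulr1 // mulr0 scale0r.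
Qed.

(* The sign vector of a combination is the top of its chain, so two equal
   combinations have the same top, and the smaller of its two weights can be
   subtracted from both. *)
Lemma comb_inj p q : chain_weight p -> chain_weight q -> comb p = comb q ->
  p = q.
Proof.
pose N (r : sign_vector m -> R) := #|finset (fun t => r t != 0)|.
move: {2}(N p + N q).+1 (ltnSn (N p + N q)) => M.
elim: M p q => // M IH p q; rewrite ltnS => NM cp cq e.
have [[s ps]|p_eq0] := pselect (exists s, p s != 0); last first.
  have {}p_eq0 s : p s = 0 by apply/eqP/negPn/negP => ps; apply: p_eq0; exists s.
  have c0 : comb p = 0 by apply: big1 => s _; rewrite p_eq0 scale0r.
  apply/funext => s; rewrite p_eq0; apply/esym/eqP/negPn/negP => qs.
  by have := comb_neq0 cq qs; rewrite -e c0 eqxx.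
have [[s' qs]|q_eq0] := pselect (exists s, q s != 0); last first.
  have {}q_eq0 u : q u = 0 by apply/eqP/negPn/negP => ps'; apply: q_eq0; exists u.
  have c0 : comb q = 0 by apply: big1 => u _; rewrite q_eq0 scale0r.
  by have := comb_neq0 cp ps; rewrite e c0 eqxx.
have [t pt topp] := chain_weight_top cp ps.
have [t' qt topq] := chain_weight_top cq qs.
have tt' : t = t' by rewrite -(sgnvec_comb cp pt topp) e (sgnvec_comb cq qt topq).
rewrite -{}tt' in qt topq.
have [p0 _ _] := cp; have [q0 _ _] := cq.
pose d := Num.min (p t) (q t).
have d0 : 0 <= d by rewrite le_min p0 q0.
have dp : 0 <= d <= p t by rewrite d0 ge_min lexx.
have dq : 0 <= d <= q t by rewrite d0 ge_min lexx orbT.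
pose p' u := p u - d * (u == t)%:R; pose q' u := q u - d * (u == t)%:R.
have Np : (N p' <= N p)%N.
  apply/subset_leq_card/fintype.subsetP => u; rewrite !inE.
  exact: weight_sub_supp.
have Nq : (N q' <= N q)%N.
  apply/subset_leq_card/fintype.subsetP => u; rewrite !inE.
  exact: weight_sub_supp.
have NM' : (N p' + N q' < M)%N.
  apply: leq_trans NM; have [pq|qp] := leP (p t) (q t).
    rewrite -addSn; apply: leq_add => //; apply: proper_card; apply/properP.
    split.
      apply/fintype.subsetP => u; rewrite !inE; exact: weight_sub_supp.
    by exists t; rewrite !inE // /p' /d eqxx mulr1 (elimT min_idPl pq) subrr eqxx.
  rewrite -addnS; apply: leq_add => //; apply: proper_card; apply/properP.
  split.
    apply/fintype.subsetP => u; rewrite !inE; exact: weight_sub_supp.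
  by exists t; rewrite !inE // /q' /d eqxx mulr1 (elimT min_idPr (ltW qp)) subrr eqxx.
have Ep : p' = q'.
  apply: IH => //; [exact: chain_weight_sub|exact: chain_weight_sub|].
  by rewrite !comb_sub e.
by apply/funext => u; have := congr1 (fun f => f u) Ep => /addIr.
Qed.

(* Subtract the largest multiple of b (sgnvec x) that leaves x in the closed
   cell of sgnvec x. *)
Lemma comb_surj x : W R k x ->
  exists p, [/\ chain_weight p, comb p = x &
    forall s, p s != 0 -> le s (sgnvec n x)].
Proof.
pose N y := #|finset (fun j => alt j y != 0)|.
move: {2}(N x).+1 (ltnSn (N x)) => M; elim: M x => // M IH x; rewrite ltnS.
move=> NM Wx; have [->|x0] := eqVneq x 0.
  exists (fun=> 0); split; last by move=> s; rewrite eqxx.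
    by split=> // [s|s t]; rewrite eqxx.
  by apply: big1 => s _; rewrite scale0r.
pose s := sgnvec n x.
have sL : s \in L.
  by rewrite /s -(sgnvec_normalize n x0); apply: mem_L; exact: normalize_sphere.
pose y := b s.
have yx j : [/\ 0 < alt j x -> 0 < alt j y, alt j x < 0 -> alt j y < 0,
    0 < alt j y -> 0 < alt j x & alt j y < 0 -> alt j x < 0].
  have /sign_leP/(_ j)[h1 h2] : le (sgnvec n x) (sgnvec n y).
    by rewrite b_sgn // sign_le_refl.
  have /sign_leP/(_ j)[h3 h4] : le (sgnvec n y) (sgnvec n x).
    by rewrite b_sgn // sign_le_refl.
  by [].
pose q j := alt j x / alt j y.
have [j0 j0y] := b_alt_neq0 sL.
(* With the minimal ratio as multiple, no coordinate of [x'] changes sign and the one at [jm]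
   becomes 0, so [N] drops. *)
case: (@arg_minP _ _ _ j0 (fun j => alt j y != 0) q j0y) => jm jmy qmin.
have qx j : alt j y != 0 -> alt j x = q j * alt j y.
  by move=> nz; rewrite /q divfK.
have q0 j : 0 <= q j.
  have [h1 h2 h3 h4] := yx j; rewrite /q.
  case: (ltgtP (alt j y) 0) => [h|h|->]; last by rewrite invr0 mulr0.
    by rewrite -mulrNN -invrN mulr_ge0 ?invr_ge0 // oppr_ge0 ltW // h4.
  by rewrite mulr_ge0 ?invr_ge0 ?ltW // h3.
pose d := q jm; pose x' := x + (- d)%:C%C *: y.
have altx' j : alt j x' = alt j x - d * alt j y.
  by rewrite /x' altD altZ mulNr.
have le' : forall j, (0 < alt j x' -> 0 < alt j x) /\ (alt j x' < 0 -> alt j x < 0).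
  move=> j; rewrite altx'; have [h1 h2 h3 h4] := yx j.
  case: (ltgtP (alt j y) 0) => [h|h|h]; last by rewrite h mulr0 subr0.
    split=> [|_]; last exact: h4.
    have qd := qmin j (ltr0_neq0 h); rewrite (qx j (ltr0_neq0 h)) -mulrBl => hh.
    have : (q j - d) * alt j y <= 0.
      by apply: mulr_ge0_le0; [rewrite subr_ge0|exact: ltW].
    by rewrite leNgt hh.
  split=> [_|]; first exact: h3.
  have qd := qmin j (lt0r_neq0 h); rewrite (qx j (lt0r_neq0 h)) -mulrBl => hh.
  have : 0 <= (q j - d) * alt j y by apply: mulr_ge0; [rewrite subr_ge0|exact: ltW].
  by rewrite leNgt hh.
have x'm : alt jm x' = 0 by rewrite altx' (qx _ jmy) /d subrr.
have [||p [cp cx' psub]] := IH x'.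
- apply: leq_trans NM; apply: proper_card; apply/properP; split.
    apply/fintype.subsetP => j; rewrite !inE; have [h1 h2] := le' j.
    by rewrite !neq_lt => /orP[/h2 ->|/h1 ->]; rewrite ?orbT.
  exists jm; rewrite !inE ?x'm ?eqxx //; have [h1 h2 h3 h4] := yx jm.
  by move: jmy; rewrite !neq_lt => /orP[/h4 ->|/h3 ->]; rewrite ?orbT.
- by apply: WD => //; apply: WZ; exact: b_W.
have [p0 pL pC] := cp.
have ps t : p t != 0 -> le t s.
  by move=> /psub h; apply: sign_le_trans h _; apply/sign_leP.
pose p' t := p t + d * (t == s)%:R.
have p'0 t : p' t != 0 -> t = s \/ p t != 0.
  rewrite /p'; have [->|_] := eqVneq t s; first by left.
  by rewrite mulr0 addr0; right.
exists p'; split.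
- split.
  + by move=> t; rewrite /p' addr_ge0 // mulr_ge0 // q0.
  + by move=> t /p'0[->|/pL].
  + move=> t u /p'0[->|pt] /p'0[->|pu]; rewrite ?sign_le_refl //.
    * by rewrite (ps u pu) orbT.
    * by rewrite (ps t pt).
    * exact: pC.
- have -> : p' = fun t => p t - (- d) * (t == s)%:R.
    by apply/funext => t; rewrite mulNr opprK.
  by rewrite comb_sub cx' /x' addrK.
- by move=> t /p'0[->|/ps //]; exact: sign_le_refl.
Qed.

Lemma realization_weight (p : {ptws sign_vector m -> R}) :
  realization le L p -> chain_weight p.
Proof. by case. Qed.

Lemma subdivisionE p : subdivision b p = normalize (comb p).
Proof. by []. Qed.

Lemma subdivision_sphere p : realization le L p ->
  sphereW R k (subdivision b p).
Proof.
move=> Rp; have [s ps] := realization_supp Rp; have cp := realization_weight Rp.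
by apply: normalize_sphere; [exact: comb_W|exact: comb_neq0 ps].
Qed.

Lemma subdivision_inj p q : realization le L p -> realization le L q ->
  subdivision b p = subdivision b q -> p = q.
Proof.
move=> Rp Rq; have [s ps] := realization_supp Rp.
have [s' qs] := realization_supp Rq.
have cp := realization_weight Rp; have cq := realization_weight Rq.
move=> /(normalize_inj (comb_neq0 cp ps) (comb_neq0 cq qs)) [a a0 e].
have ca : chain_weight (fun s => a * q s).
  have [q0 qL qC] := cq.
  have sup u : a * q u != 0 -> q u != 0 by rewrite mulf_eq0 gt_eqF.
  split=> [u|u /sup/qL //|u v /sup qu /sup qv]; last exact: qC.
  by rewrite mulr_ge0 // ltW.
have pq : (p : _ -> R) = fun s => a * q s.
  apply: comb_inj => //; rewrite e /comb scaler_sumr; apply: eq_bigr => u _.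
  by rewrite scale_realA.
have a1 : a = 1.
  have [_ p1 _ _] := Rp; have [_ q1 _ _] := Rq.
  by rewrite -p1 pq -mulr_sumr q1 mulr1.
by rewrite pq a1; apply/funext => u; rewrite mul1r.
Qed.

Lemma subdivision_surj x : sphereW R k x ->
  exists2 p, realization le L p & subdivision b p = x.
Proof.
move=> Sx; have [p [cp cx psub]] := comb_surj (proj1 Sx).
have [p0 pL pC] := cp; pose S := \sum_s p s.
have S0 : 0 < S.
  rewrite lt_neqAle sumr_ge0 // andbT eq_sym; apply/negP; rewrite psumr_eq0 //.
  move=> /allP h; have /negP := sphere_neq0 Sx; apply; rewrite -cx /comb big1 //.
  move=> s _; have /= /eqP -> := h s (mem_index_enum _).
  by rewrite scale0r.
exists (fun s => S^-1 * p s).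
  have sup u : S^-1 * p u != 0 -> p u != 0 by rewrite mulf_eq0 invr_eq0 gt_eqF.
  split=> [u||u /sup/pL //|u v /sup pu /sup pv]; last exact: pC.
    by rewrite mulr_ge0 // invr_ge0 ltW.
  by rewrite -mulr_sumr mulVf // gt_eqF.
rewrite subdivisionE -[RHS](normalize_id Sx) -cx.
rewrite -(@normalizeZ _ _ S^-1 (comb p)) ?invr_gt0 // /comb; congr normalize.
by rewrite scaler_sumr; apply: eq_bigr => s _; rewrite scale_realA.
Qed.

End Subdivision.


(** * The maps between the sphere and the Hom complex *)

Section Compactness.

Lemma closed_of_limits (X : topologicalType) (A : set X) :
  (forall (F : set_system X) (p : X), ProperFilter F -> F --> p ->
     (\forall q \near F, A q) -> A p) -> closed A.
Proof.
move=> H p clp; apply: (H (within A (nbhs p))).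
- exact: cvg_within.
- exact: withinT.
Qed.

(** A closed A meets the compact K in a compact set, whose image is closed in the Hausdorff target;
    within f(K) this image is the preimage of A under [g]. *)
Lemma continuous_compact_inverse (X Y : topologicalType) (K : set X)
    (f : X -> Y) (g : Y -> X) : hausdorff_space Y -> compact K ->
  {within K, continuous f} -> (forall x, K x -> g (f x) = x) ->
  {within f @` K, continuous g}.
Proof.
move=> hY cK cf gf; apply/continuous_closedP => A cA; apply/closed_subspaceP.
exists (f @` (K `&` A)).
  apply: compact_closed => //; apply: continuous_compact.
    by apply: continuous_subspaceW cf => x [].
  exact: compact_closedI.
apply/seteqP; split => [_ [[x [Kx Ax] <-] _]|y [Ag [x Kx e]]].
  split; last by exists x.
  by suff : A (g (f x)) by []; rewrite gf.
split; last by exists x.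
have {}Ag : A (g y) := Ag; rewrite -e gf // in Ag.
by exists x.
Qed.

Lemma realization_compact (R : realType) (T : finType) (le : rel T)
    (P : {set T}) : compact (realization le P : set {ptws T -> R}).
Proof.
apply: (@subclosed_compact _ _ [set f : {ptws T -> R} | forall t, `[0, 1] (f t)]).
- apply: closed_of_limits => F p PF Fp near.
  have coord t : (q t : R) @[q --> F] --> p t.
    exact: (@ptws_cvg_coord R T _ F id p t _ Fp).
  have lim (f : {ptws T -> R} -> R) (A : set R) (l : R) : closed A ->
      (forall q, realization le P q -> A (f q)) -> f @ F --> l -> A l.
    move=> cA fA; apply: closed_cvg => //.
    by apply: filterS near => q; exact: fA.
  split.
  + move=> t; apply: (lim (fun q => q t) [set x | 0 <= x]).
    * exact: closed_ge.
    * by move=> q [q0 _ _ _]; exact: q0.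
    * exact: coord.
  + apply: (lim (fun q => \sum_t q t) [set x | x = 1]).
    * exact: closed_eq.
    * by move=> q [_ q1 _ _].
    * exact: cvg_sumr.
  + move=> t; apply: contraNT => tP; apply/eqP.
    apply: (lim (fun q => q t) [set x | x = 0]).
    * exact: closed_eq.
    * by move=> q [_ _ qP _]; apply/eqP/negPn/negP => /qP; rewrite (negbTE tP).
    * exact: coord.
  + move=> t u; have [//|ntu] := boolP (le t u || le u t).
    (* For incomparable t and u the chain condition reads p t * p u = 0, which survives limits. *)
    move=> pt pu; have : p t * p u = 0.
      apply: (lim (fun q => q t * q u) [set x | x = 0]).
      * exact: closed_eq.
      * move=> q [_ _ _ qC]; apply/eqP/negPn/negP; rewrite mulf_eq0 negb_or.
        by move=> /andP[qt qu]; move: ntu; rewrite (qC t u qt qu).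
      * exact: cvgM.
    by move/eqP; rewrite mulf_eq0 (negbTE pt) (negbTE pu).
- exact: (@tychonoff T (fun=> R : topologicalType) (fun=> `[0, 1])
    (fun=> @segment_compact R 0 1)).
- move=> p [p0 p1 _ _] t /=; rewrite in_itv /= p0 -p1 (bigD1 t) //= lerDl.
  exact: sumr_ge0.
Qed.

End Compactness.

Lemma ord2_cases (l : 'I_2) : l = ord0 \/ l = ord_max.
Proof. by case: l => [[|[|//]] hl]; [left|right]; apply: val_inj. Qed.

Section HomPosets.
Variables (n k : nat).
Local Notation HomT := {ffun K2 -> {set SG n k}}.
Local Notation HomP := (Defs.Hom K2 (SG n k)).
Local Notation hle := (@Hom_le K2 (SG n k)).
Implicit Types T U : HomT.

Lemma Hom_leP T U : reflect (T ord0 \subset U ord0 /\ T ord_max \subset U ord_max)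
  (hle T U).
Proof.
apply: (iffP forallP) => [h|[h0 h1] l]; first by split; exact: h.
by case: (ord2_cases l) => ->.
Qed.

Lemma Hom_le_refl : reflexive hle.
Proof. by move=> T; apply/forallP. Qed.

Lemma Hom_le_trans : transitive hle.
Proof.
move=> T U U' /forallP h /forallP h'; apply/forallP => l.
exact: fintype.subset_trans (h l) (h' l).
Qed.

Lemma Hom_le_anti : antisymmetric hle.
Proof.
move=> T U /andP[/forallP h /forallP h']; apply/ffunP => l; apply/eqP.
by rewrite finset.eqEsubset (h l) (h' l).
Qed.

Lemma mem_HomP T : reflect
  [/\ T ord0 != finset.set0, T ord_max != finset.set0 &
      forall S S' : SG n k, S \in T ord0 -> S' \in T ord_max -> adj S S'] (T \in HomP).
Proof.
rewrite inE; apply: (iffP andP) => [[/forallP h0 /forallP hadj]|[h0 h1 h]].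
  split=> // S S' S0 S1; have /forallP/(_ ord_max)/implyP/(_ isT) := hadj ord0.
  by move=> /forall_inP/(_ S S0)/forall_inP/(_ S' S1).
split; first by apply/forallP => l; case: (ord2_cases l) => ->.
apply/forallP => u; apply/forallP => v; apply/implyP.
case: (ord2_cases u) => ->; case: (ord2_cases v) => -> //= _;
  apply/forall_inP => S hS; apply/forall_inP => S' hS'; first exact: h.
by rewrite disjoint_sym; exact: h.
Qed.

Definition covers T (j : 'Z_(2 * n + k)) : bool := [exists S in T ord0, j \in val S].

Lemma coversP T j : reflect (exists2 S, S \in T ord0 & j \in val S) (covers T j).
Proof. exact: exists_inP. Qed.

Lemma covers_le T U j : hle T U -> covers T j -> covers U j.
Proof.
move=> /Hom_leP[/fintype.subsetP h _] /coversP[S S0 jS]; apply/coversP.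
by exists S => //; exact: h.
Qed.

Lemma Hom_not_covers T (S' : SG n k) j :
  T \in HomP -> S' \in T ord_max -> j \in val S' ->
  ~~ covers T j.
Proof.
move=> /mem_HomP[_ _ h] S'T jS'; apply/negP => /coversP[S ST jS].
have /= := h S S' ST S'T; rewrite -setI_eq0 => /eqP e.
by have : j \in val S :&: val S' by [rewrite inE jS jS']; rewrite e inE.
Qed.

(** If U is the larger vertex, S' also belongs to its second set; if it is the smaller one, it
    covers less than T. Hence one coordinate is negative for the cone points of a whole chain, and
    their combination is nonzero. *)
Lemma comparable_not_covers T U (S' : SG n k) j : T \in HomP -> U \in HomP ->
  hle T U || hle U T -> S' \in T ord_max -> j \in val S' -> ~~ covers U j.
Proof.
move=> TP UP /orP[h|h] S'T jS'.
  apply: (Hom_not_covers UP _ jS'); case/Hom_leP: h => _ /fintype.subsetP; exact.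
by apply: contra (Hom_not_covers TP S'T jS'); exact: covers_le.
Qed.

Hypothesis n_gt0 : (0 < n)%N.

Lemma SG_nonempty (S : SG n k) : exists j, j \in val S.
Proof.
case: S => S /= /andP[/eqP cS _].
by apply/set0Pn; rewrite -card_gt0 cS.
Qed.

End HomPosets.

Section Maps.
Variables (R : realType) (n k : nat).
Hypothesis n_gt0 : (0 < n)%N.
Local Notation m := (2 * n + k)%N.
Local Notation C := (R[i]^o).
Local Notation V := 'rV[C]_(k./2).+1.
Variable b : sign_vector m -> V.
Hypothesis hb : barycenters b.
Implicit Types (x y : V) (j : 'Z_m) (s t : sign_vector m).
Local Notation L := (L R n k).
Local Notation le := (@sign_le m).
Local Notation HomT := {ffun K2 -> {set SG n k}}.
Local Notation HomP := (Defs.Hom K2 (SG n k)).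
Local Notation hle := (@Hom_le K2 (SG n k)).
Local Notation HomR := (@Hom_realization R n k).
Implicit Types (T U : HomT).

Lemma within_subdivision_continuous :
  {within realization le L, continuous (subdivision b)}.
Proof.
apply/subspace_continuousP => p Rp; have [s ps] := realization_supp Rp.
apply: cvg_normalize; first exact: (comb_neq0 n_gt0 hb (realization_weight Rp) ps).
apply: cvg_comb => t; apply: (@ptws_cvg_coord R _ _ _ id).
exact: cvg_within.
Qed.

Definition inv_subdivision : V -> {ptws sign_vector m -> R} :=
  'pinv_(fun=> 0 : sign_vector m -> R) (realization le L) (subdivision b).

Lemma subdivisionK p : realization le L p ->
  inv_subdivision (subdivision b p) = p.
Proof.
move=> Rp; apply: pinvKV; rewrite ?inE // => p' q'; rewrite !inE.
exact: subdivision_inj.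
Qed.

Lemma inv_subdivision_realization x : sphereW R k x ->
  realization le L (inv_subdivision x).
Proof.
by move=> /(subdivision_surj n_gt0 hb)[p Rp <-]; rewrite subdivisionK.
Qed.

Lemma inv_subdivisionK x : sphereW R k x ->
  subdivision b (inv_subdivision x) = x.
Proof.
by move=> /(subdivision_surj n_gt0 hb)[p Rp <-]; rewrite subdivisionK.
Qed.

Lemma inv_subdivision_continuous :
  {within sphereW R k, continuous inv_subdivision}.
Proof.
have -> : sphereW R k = subdivision b @` realization le L.
  apply/seteqP; split=> [x /(subdivision_surj n_gt0 hb)[p Rp <-]|_ [p Rp <-]].
    by exists p.
  exact: subdivision_sphere.
apply: continuous_compact_inverse.
- exact: hausdorff_rV.
- exact: realization_compact.
- exact: within_subdivision_continuous.
- exact: subdivisionK.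
Qed.

Lemma mem_g_map s (l : 'I_2) (S : SG n k) :
  (S \in g_map s l) = (val S \subset S_ l s).
Proof. by rewrite ffunE inE. Qed.

Lemma g_map0P s (S : SG n k) : s \in L ->
  reflect (forall j, j \in val S -> 0 < alt j (b s)) (S \in g_map s ord0).
Proof.
move=> sL; rewrite mem_g_map -(b_sgn hb sL).
by apply: (iffP fintype.subsetP) => h j /h; rewrite mem_S_0 b_sgn.
Qed.

Lemma g_map1P s (S : SG n k) : s \in L ->
  reflect (forall j, j \in val S -> alt j (b s) < 0) (S \in g_map s ord_max).
Proof.
move=> sL; rewrite mem_g_map -(b_sgn hb sL).
by apply: (iffP fintype.subsetP) => h j /h; rewrite mem_S_1 b_sgn.
Qed.

(** Nonemptiness of the two sets is Gale's lemma for b(s) and its antipode; positive and negative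
    coordinates are disjoint. *)
Lemma g_map_Hom s : s \in L -> g_map s \in HomP.
Proof.
move=> sL; have Sb := b_sphere hb sL; apply/mem_HomP; split.
- have [S HS] := positive_stable n_gt0 Sb; apply/set0Pn; exists S.
  exact/g_map0P.
- have [S HS] := negative_stable n_gt0 Sb; apply/set0Pn; exists S.
  exact/g_map1P.
move=> S S' /(g_map0P _ sL) h /(g_map1P _ sL) h'; rewrite /= -setI_eq0.
apply/eqP/setP => j; rewrite !inE; apply/negP => /andP[/h h1 /h' h2].
by move: (lt_trans h1 h2); rewrite ltxx.
Qed.

Lemma g_map_le s t : s \in L -> t \in L -> le s t -> hle (g_map s) (g_map t).
Proof.
move=> sL tL st; apply/Hom_leP; split; apply/fintype.subsetP => S.
  move=> /(g_map0P _ sL) h; apply/(g_map0P _ tL) => j /h.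
  by have [] := sign_le_b hb sL tL st j.
move=> /(g_map1P _ sL) h; apply/(g_map1P _ tL) => j /h.
by have [] := sign_le_b hb sL tL st j.
Qed.

Lemma f_map_Hom x : sphereW R k x -> HomR (f_map b x).
Proof.
move=> /inv_subdivision_realization; apply: realization_map_stable.
  exact: g_map_Hom.
exact: g_map_le.
Qed.

Lemma f_map_continuous : {within sphereW R k, continuous (f_map b)}.
Proof.
apply/subspace_continuousP => x Sx.
have := inv_subdivision_continuous; move/subspace_continuousP => /(_ x Sx) c.
apply: (@cvg_comp _ _ _ inv_subdivision (realization_map (@g_map n k)) _
  (nbhs (inv_subdivision x))) => //.
exact: realization_map_continuous.
Qed.

(* The cells on which all coordinates outside the union of the first set of T
   are negative: they form an open convex cone, which grows with T. *)
Definition cells_over T : {set sign_vector m} :=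
  finset (fun s => (s \in L) && [forall j, ~~ covers T j ==> (alt j (b s) < 0)]).

Definition cone_point T : V := \sum_(s in cells_over T) b s.

Lemma cells_overP T s : reflect
  (s \in L /\ forall j, ~~ covers T j -> alt j (b s) < 0) (s \in cells_over T).
Proof.
apply: (iffP idP).
  rewrite finset.in_set => /andP[sL /forallP h]; split=> // j nj.
  by have /implyP := h j; exact.
move=> [sL h]; rewrite finset.in_set sL /=.
by apply/forallP => j; apply/implyP; exact: h.
Qed.

Lemma cells_over_neq0 T : T \in HomP -> exists s, s \in cells_over T.
Proof.
move=> TP; have [/set0Pn[S ST] /set0Pn[S' S'T] h] := mem_HomP _ TP.
have [x Wx Hx] := separating_vector R n_gt0 S.
have ncov j : ~~ covers T j -> alt j x < 0.
  by move=> nj; apply: Hx; apply: contra nj => jS; apply/coversP; exists S.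
(* The second set of T provides an index outside X, where x is strictly negative; hence x is not
   0. *)
have [j jS'] := SG_nonempty n_gt0 S'.
have x0 : x != 0.
  apply/eqP => x0; have := ncov j (Hom_not_covers TP S'T jS').
  by rewrite x0 /alt inner0l mulr0 ltxx.
have sL : sgnvec n x \in L.
  by rewrite -(sgnvec_normalize n x0); apply: mem_L; exact: normalize_sphere.
exists (sgnvec n x); apply/cells_overP; split=> // i /ncov.
have : le (sgnvec n x) (sgnvec n (b (sgnvec n x))).
  by rewrite b_sgn // sign_le_refl.
by move=> /sign_leP/(_ i)[].
Qed.

Lemma cone_point_W T : W R k (cone_point T).
Proof. by apply: W_sum => s /cells_overP[/(b_W hb)]. Qed.

Lemma alt_cone_point T j : alt j (cone_point T) = \sum_(s in cells_over T) alt j (b s).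
Proof.
have -> : cone_point T = \sum_(s in cells_over T) (1 : R)%:C%C *: b s.
  by apply: eq_bigr => s _; rewrite scale1r.
by rewrite alt_suml; apply: eq_bigr => s _; rewrite mul1r.
Qed.

Lemma alt_cone_point_lt0 T j : T \in HomP -> ~~ covers T j ->
  alt j (cone_point T) < 0.
Proof.
move=> TP nj; have [s sT] := cells_over_neq0 TP.
rewrite alt_cone_point (bigD1 s) //= -oppr_gt0 opprD; apply: ltr_pwDl.
  by rewrite oppr_gt0; have /cells_overP[_ h] := sT; exact: h.
rewrite -sumrN; apply: sumr_ge0 => t /andP[/cells_overP[_ h] _].
by rewrite oppr_ge0 ltW // h.
Qed.

Definition cone_sum (p : {ptws HomT -> R}) : V := \sum_T (p T)%:C%C *: cone_point T.
Definition to_sphere (p : {ptws HomT -> R}) : V := normalize (cone_sum p).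

Lemma cone_sum_W p : W R k (cone_sum p).
Proof. by apply: W_sum => T _; apply: WZ; exact: cone_point_W. Qed.

Lemma alt_cone_sum_lt0 p T (S' : SG n k) j : HomR p -> p T != 0 -> S' \in T ord_max ->
  j \in val S' -> alt j (cone_sum p) < 0.
Proof.
move=> [p0 p1 pP pC] pT S'T jS'; rewrite alt_suml (bigD1 T) //=.
have neg U : p U != 0 -> alt j (cone_point U) < 0.
  move=> pU; apply: alt_cone_point_lt0; first exact: pP.
  by apply: (comparable_not_covers (pP T pT) (pP U pU) (pC T U pT pU) S'T jS').
rewrite -oppr_gt0 opprD; apply: ltr_pwDl.
  by rewrite oppr_gt0 pmulr_rlt0 ?neg // lt_neqAle eq_sym pT p0.
rewrite -sumrN; apply: sumr_ge0 => U _; rewrite oppr_ge0.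
have [->|pU] := eqVneq (p U) 0; first by rewrite mul0r.
by apply: mulr_ge0_le0 => //; rewrite ltW // neg.
Qed.

Lemma Hom_max_point T : T \in HomP -> exists S' j, S' \in T ord_max /\ j \in val S'.
Proof.
move=> /mem_HomP[_ /set0Pn[S' S'T] _]; have [j jS'] := SG_nonempty n_gt0 S'.
by exists S', j.
Qed.

Lemma cone_sum_neq0 p : HomR p -> cone_sum p != 0.
Proof.
move=> Rp; have [T pT] := realization_supp Rp; have [_ _ pP _] := Rp.
have [S' [j [S'T jS']]] := Hom_max_point (pP T pT).
apply/eqP => h0; have := alt_cone_sum_lt0 Rp pT S'T jS'.
by rewrite h0 /alt inner0l mulr0 ltxx.
Qed.

Lemma alt_to_sphere_lt0 p T (S' : SG n k) j : HomR p -> p T != 0 -> S' \in T ord_max ->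
  j \in val S' -> alt j (to_sphere p) < 0.
Proof.
move=> Rp pT S'T jS'; rewrite alt_normalize pmulr_rlt0.
  exact: (alt_cone_sum_lt0 Rp pT S'T jS').
exact: scal_gt0 (cone_sum_neq0 Rp).
Qed.

Lemma to_sphere_sphere p : HomR p -> sphereW R k (to_sphere p).
Proof.
by move=> Rp; apply: normalize_sphere; [exact: cone_sum_W|exact: cone_sum_neq0].
Qed.

Lemma to_sphere_continuous : {within HomR, continuous to_sphere}.
Proof.
apply/subspace_continuousP => p Rp; apply: cvg_normalize.
  exact: cone_sum_neq0.
apply: cvg_comb => t; apply: (@ptws_cvg_coord R _ _ _ id).
exact: cvg_within.
Qed.

(** The vertex g(s) lies in the carrier of f x, and its second set consists of sets of negative
    coordinates of b(s). Negativity passes to x along the chain, and to h (f x) by construction of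
    h. *)
Lemma alt_f_map x s (S' : SG n k) j : sphereW R k x -> inv_subdivision x s != 0 ->
  S' \in g_map s ord_max -> j \in val S' ->
  alt j x < 0 /\ alt j (to_sphere (f_map b x)) < 0.
Proof.
move=> Sx xs S's jS'; have Rx := inv_subdivision_realization Sx.
have [_ xL _] := realization_weight Rx.
have cw := realization_weight Rx; have sL := xL s xs.
have nb : alt j (b s) < 0 by have /(g_map1P _ sL) := S's; exact.
split.
  rewrite -(inv_subdivisionK Sx) subdivisionE alt_normalize pmulr_rlt0.
    exact: (comb_neg hb cw xs nb).
  exact: scal_gt0 (comb_neq0 n_gt0 hb cw xs).
apply: (@alt_to_sphere_lt0 _ (g_map s) S') => //; first exact: f_map_Hom.
rewrite gt_eqF //; have [x0 _ _ _] := Rx.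
rewrite /f_map /realization_map (bigD1 s) //=; apply: ltr_pwDl.
  by rewrite lt_neqAle eq_sym xs x0.
by apply: sumr_ge0 => t _; exact: x0.
Qed.

(** Both sets are read at the single point y = h p: the elements of S are positive coordinates of y
    since U = g(s) for a cell s in the carrier of y, those of S' are negative ones. *)
Lemma fh_compatible p U T (S S' : SG n k) : HomR p -> f_map b (to_sphere p) U != 0 ->
  p T != 0 -> S \in U ord0 -> S' \in T ord_max -> adj S S'.
Proof.
move=> Rp /realization_map_supp[s <- ys] pT SU S'T.
set y := to_sphere p in ys; have Sy : sphereW R k y by exact: to_sphere_sphere.
have Ry := inv_subdivision_realization Sy.
have cw := realization_weight Ry; have [_ yL _] := cw.
rewrite /= -setI_eq0; apply/eqP/setP => j; rewrite !inE.
apply/negP => /andP[jS jS']; have := alt_to_sphere_lt0 Rp pT S'T jS'.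
rewrite -/y -(inv_subdivisionK Sy) subdivisionE alt_normalize pmulr_rlt0; last first.
  exact: scal_gt0 (comb_neq0 n_gt0 hb cw ys).
have /(g_map0P _ (yL s ys)) /(_ j jS) := SU.
move=> /(comb_pos hb cw ys) h1 h2; by move: (lt_trans h1 h2); rewrite ltxx.
Qed.

End Maps.


(** * Homotopies *)

Section WithinLimits.

Lemma cvg_to_within (X : Type) (Y : topologicalType) (F : set_system X)
    (f : X -> Y) (A : set Y) (y : Y) : Filter F ->
  (\forall x \near F, A (f x)) -> f @ F --> y -> f @ F --> within A (nbhs y).
Proof.
move=> FF nA fy B nB; have := fy _ nB; rewrite /= => h.
by apply: filterS2 nA h => x Ax; exact.
Qed.

Lemma cvg_snd_prod (X Y : topologicalType) (S : set (X * Y)) (t : X) (y : Y) :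
  snd @ within S (nbhs (t, y)) --> y.
Proof.
move=> B nB; have h : snd @ nbhs (t, y) --> y by exact: cvg_snd.
exact: (@filterS (X * Y)%type (nbhs (t, y)) _ _ _ (fun z Bz _ => Bz) (h B nB)).
Qed.

Lemma cvg_fst_prod (X Y : topologicalType) (S : set (X * Y)) (t : X) (y : Y) :
  fst @ within S (nbhs (t, y)) --> t.
Proof.
move=> B nB; have h : fst @ nbhs (t, y) --> t by exact: cvg_fst.
exact: (@filterS (X * Y)%type (nbhs (t, y)) _ _ _ (fun z Bz _ => Bz) (h B nB)).
Qed.

Lemma cvg_snd_within (X Y : topologicalType) (I : set X) (A : set Y) (t : X)
    (y : Y) : snd @ within (I `*` A) (nbhs (t, y)) --> within A (nbhs y).
Proof.
apply: cvg_to_within; last exact: cvg_snd_prod.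
by apply: filterS (@withinT _ (nbhs (t, y)) (I `*` A) _) => z [].
Qed.

Lemma within_comp (X Y Z : topologicalType) (A : set X) (B : set Y)
    (f : X -> Y) (g : Y -> Z) : (forall x, A x -> B (f x)) ->
  {within A, continuous f} -> {within B, continuous g} ->
  {within A, continuous (g \o f)}.
Proof.
move=> AB /subspace_continuousP cf /subspace_continuousP cg.
apply/subspace_continuousP => x Ax.
apply: (@cvg_comp _ _ _ f g _ (within B (nbhs (f x)))); last exact: cg (AB x Ax).
apply: cvg_to_within; last exact: cf.
by apply: filterS (@withinT _ (nbhs x) A _) => z; exact: AB.
Qed.

End WithinLimits.

(** * The zigzag as a poset map *)

Section Zigzag.
Variables (n k : nat).
Local Notation HomT := {ffun K2 -> {set SG n k}}.
Local Notation HomP := (Defs.Hom K2 (SG n k)).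
Local Notation hle := (@Hom_le K2 (SG n k)).
Implicit Types T U : HomT.

(* For i = 0, ..., 4 this is
     (A, B) <= (A, B u B') >= (A, B') <= (A u A', B') >= (A', B')
   where U = (A, B) and T = (A', B'). *)
Definition zigzag (z : HomT * HomT * 'I_5) : HomT :=
  let: (U, T, i) := z in
  [ffun l : K2 => if l == ord0
    then (if (i <= 3)%N then U ord0 else finset.set0) :|:
         (if (3 <= i)%N then T ord0 else finset.set0)
    else (if (i <= 1)%N then U ord_max else finset.set0) :|:
         (if (1 <= i)%N then T ord_max else finset.set0)].

Definition zigzag_le : rel (HomT * HomT * 'I_5) :=
  prod_le (prod_le hle hle) fence_le.

Lemma zigzag_start U T : zigzag (U, T, ord0) = U.
Proof.
apply/ffunP => l; rewrite ffunE /=.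
by case: (ord2_cases l) => -> /=; rewrite finset.setU0.
Qed.

Lemma zigzag_end U T : zigzag (U, T, ord_max) = T.
Proof.
apply/ffunP => l; rewrite ffunE /=.
by case: (ord2_cases l) => -> /=; rewrite finset.set0U.
Qed.

Lemma zigzag_mono z w : zigzag_le z w -> hle (zigzag z) (zigzag w).
Proof.
move: z w => [[U T] i] [[U' T'] j] /andP[/andP[/= /Hom_leP[U0 U1] /Hom_leP[T0 T1]]] ij.
have sub (G : finType) (c d : bool) (A B : {set G}) : (c -> d) -> A \subset B ->
    (if c then A else finset.set0) \subset (if d then B else finset.set0).
  by move=> cd AB; case: c cd => [->|_] //; rewrite finset.sub0set.
(* Going up in the fence, from an even index to a neighbouring odd one, only switches summands
   on. *)
have [ij1 ij2 ij3 ij4] : [/\ (i <= 3)%N -> (j <= 3)%N, (3 <= i)%N -> (3 <= j)%N,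
    (i <= 1)%N -> (j <= 1)%N & (1 <= i)%N -> (1 <= j)%N].
  move: ij; rewrite /fence_le => /orP[/eqP ->|/and3P[ei oj h]] //.
  by have ji := ltn_ord j; split; lia.
by apply/Hom_leP; rewrite !ffunE /=; split; apply: finset.setUSS; exact: sub.
Qed.

Lemma zigzag_Hom U T i : U \in HomP -> T \in HomP ->
  (forall S S' : SG n k, S \in U ord0 -> S' \in T ord_max -> adj S S') ->
  zigzag (U, T, i) \in HomP.
Proof.
move=> /mem_HomP[/set0Pn[S1 U0] /set0Pn[S2 U1] hU].
move=> /mem_HomP[/set0Pn[S3 T0] /set0Pn[S4 T1] hT] hUT.
have i4 := ltn_ord i; apply/mem_HomP; rewrite !ffunE /=; split.
- apply/set0Pn; have [i3|i3] := leqP i 3; first by exists S1; rewrite inE U0.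
  by exists S3; rewrite inE (ltnW i3) T0 orbT.
- apply/set0Pn; have [i1|i1] := leqP i 1; first by exists S2; rewrite inE U1.
  by exists S4; rewrite inE (ltnW i1) T1 orbT.
have memif (G : finType) (c : bool) (A : {set G}) x :
    (x \in if c then A else finset.set0) = c && (x \in A).
  by case: c; rewrite ?inE.
move=> S S'; rewrite !finset.in_setU !memif.
(* The third case, A' against B, would need both 3 <= i and i <= 1. *)
move=> /orP[]/andP[c1 hS] /orP[]/andP[c2 hS'];
  [exact: hU|exact: hUT|lia|exact: hT].
Qed.

End Zigzag.

Section Homotopies.
Variables (R : realType) (n k : nat).
Hypothesis n_gt0 : (0 < n)%N.
Local Notation m := (2 * n + k)%N.
Local Notation C := (R[i]^o).
Local Notation V := 'rV[C]_(k./2).+1.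
Variable b : sign_vector m -> V.
Hypothesis hb : barycenters b.
Implicit Types (x y : V) (j : 'Z_m) (s : sign_vector m).
Local Notation L := (L R n k).
Local Notation le := (@sign_le m).
Local Notation HomT := {ffun K2 -> {set SG n k}}.
Local Notation HomP := (Defs.Hom K2 (SG n k)).
Local Notation hle := (@Hom_le K2 (SG n k)).
Local Notation HomR := (@Hom_realization R n k).
Local Notation f := (f_map b).
Local Notation h := (to_sphere b).
Local Notation inv := (inv_subdivision b).
Implicit Types (T U : HomT).

Definition sphere_homotopy (z : R * V) : V :=
  normalize ((1 - z.1)%:C%C *: h (f z.2) + z.1%:C%C *: z.2).

Lemma sphere_homotopy_neq0 (t : R) x : 0 <= t <= 1 -> sphereW R k x ->
  (1 - t)%:C%C *: h (f x) + t%:C%C *: x != 0.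
Proof.
move=> /andP[t0 t1] Sx; have Rx := inv_subdivision_realization n_gt0 hb Sx.
have [s xs] := realization_supp Rx; have [_ _ xL _] := Rx.
have [S' [j [S's jS']]] := Hom_max_point n_gt0 (g_map_Hom n_gt0 hb (xL s xs)).
have [a1 a2] := alt_f_map n_gt0 hb Sx xs S's jS'.
move: (h (f x)) a2 => y a2; apply/eqP => e0.
have : alt j ((1 - t)%:C%C *: y + t%:C%C *: x) = 0.
  by rewrite e0 /alt inner0l mulr0.
rewrite altD !altZ; have [->|tn0] := eqVneq t 0.
  by rewrite subr0 mul1r mul0r addr0 => a20; move: a2; rewrite a20 ltxx.
have : t * alt j x < 0 by rewrite pmulr_rlt0 // lt_neqAle eq_sym tn0.
have : (1 - t) * alt j y <= 0.
  by apply: mulr_ge0_le0; [rewrite subr_ge0|exact: ltW].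
by move=> le0 lt0 sum0; move: (ler_ltD le0 lt0); rewrite sum0 addr0 ltxx.
Qed.

Lemma fh_continuous : {within HomR, continuous (f \o h)}.
Proof.
apply: (@within_comp _ _ _ _ (sphereW R k)).
- by move=> p; exact: to_sphere_sphere.
- exact: to_sphere_continuous.
- exact: f_map_continuous.
Qed.

Lemma hf_continuous : {within sphereW R k, continuous (h \o f)}.
Proof.
apply: (@within_comp _ _ _ _ HomR).
- by move=> p; exact: f_map_Hom.
- exact: f_map_continuous.
- exact: to_sphere_continuous.
Qed.

Lemma sphere_homotopy_continuous :
  {within `[0, 1] `*` sphereW R k, continuous sphere_homotopy}.
Proof.
apply/subspace_continuousP => -[t x] [/= t01 Sx].
apply: cvg_normalize.
  by apply: sphere_homotopy_neq0 => //; move: t01; rewrite in_itv.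
have cx : snd @ within (`[0, 1] `*` sphereW R k) (nbhs (t, x)) --> x.
  exact: cvg_snd_prod.
have ct : fst @ within (`[0, 1] `*` sphereW R k) (nbhs (t, x)) --> t.
  exact: cvg_fst_prod.
have c1 : 1 - z.1 @[z --> within (`[0, 1] `*` sphereW R k) (nbhs (t, x))] --> 1 - t.
  by apply: cvgB => //; exact: cvg_cst.
have c2 : h (f z.2) @[z --> within (`[0, 1] `*` sphereW R k) (nbhs (t, x))] -->
    h (f x).
  apply: (@cvg_comp _ _ _ snd (h \o f) _ (within (sphereW R k) (nbhs x))).
    exact: cvg_snd_within.
  by have /subspace_continuousP/(_ x Sx) := hf_continuous.
exact: (cvg_rVD _ (cvg_scale _ c1 c2) (cvg_scale _ ct cx)).
Qed.

Lemma prod_Hom_le_order : [/\ reflexive (prod_le hle hle),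
  antisymmetric (prod_le hle hle) & transitive (prod_le hle hle)].
Proof.
split.
- by move=> [U T]; rewrite /prod_le !Hom_le_refl.
- move=> [U T] [U' T'] /andP[/andP[/= h1 h2] /andP[/= h3 h4]]; congr (_, _).
    by apply: Hom_le_anti; rewrite h1 h3.
  by apply: Hom_le_anti; rewrite h2 h4.
- move=> [U T] [U' T'] [U2 T2] /andP[/= h1 h2] /andP[/= h3 h4].
  by rewrite /prod_le /= (Hom_le_trans h1 h3) (Hom_le_trans h2 h4).
Qed.

Definition joint (p : {ptws HomT -> R}) : {ptws HomT * HomT -> R} :=
  coupling hle hle (f (h p)) p.

Definition hom_homotopy (z : R * {ptws HomT -> R}) : {ptws HomT -> R} :=
  realization_map (@zigzag n k)
    (coupling (prod_le hle hle) fence_le (joint z.2) (fence_path z.1)).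

Lemma fh_realization p : HomR p -> HomR (f (h p)).
Proof. by move=> Rp; apply: f_map_Hom => //; exact: to_sphere_sphere. Qed.

Lemma joint_realization p : HomR p ->
  realization (prod_le hle hle) finset.setT (joint p).
Proof.
move=> Rp; apply: (coupling_realization (@Hom_le_refl n k) (@Hom_le_anti n k)
  (@Hom_le_trans n k) (@Hom_le_refl n k) (@Hom_le_anti n k) (@Hom_le_trans n k)
  (fh_realization Rp) Rp).
by move=> U T _ _; rewrite inE.
Qed.

Lemma joint_supp p z : joint p z != 0 -> f (h p) z.1 != 0 /\ p z.2 != 0.
Proof. exact: coupling_supp. Qed.

Lemma hom_homotopy_points (t : R) p : 0 <= t <= 1 -> HomR p ->
  HomR (hom_homotopy (t, p)).
Proof.
move=> t01 Rp; have [r2 a2 t2] := prod_Hom_le_order; have Rfp := fh_realization Rp.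
(* For arbitrary pairs the zigzag may leave [HomP], so the source is cut down to the triples it maps
   into [HomP]; the support of the coupling consists of such triples by [fh_compatible]. *)
pose P := finset (fun z => zigzag z \in HomP).
apply: (@realization_map_stable _ _ _ (@zigzag_le n k) _ P).
- by move=> z; rewrite inE.
- by move=> z w _ _; exact: zigzag_mono.
apply: (coupling_realization r2 a2 t2 fence_refl fence_anti fence_trans
  (joint_realization Rp) (fence_path_realization t01)) => -[U T] i.
move=> /joint_supp[/= fU pT] _; rewrite inE; apply: zigzag_Hom.
- by case: Rfp => _ _ H _; exact: H.
- by case: Rp => _ _ H _; exact: H.
- by move=> S S' SU S'T; exact: (fh_compatible n_gt0 hb Rp fU pT SU S'T).
Qed.

Lemma hom_homotopy0 p : HomR p -> hom_homotopy (0, p) = f (h p).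
Proof.
move=> Rp; have [r2 a2 t2] := prod_Hom_le_order; rewrite /hom_homotopy /=.
(* At t = 0 the fence measure is the unit mass at 0, so on the support the zigzag is the first
   projection, and only a marginal of the coupling is left. *)
rewrite (@eq_realization_map _ _ _ _ (fst \o fst)); last first.
  move=> [[U T] i] /coupling_supp[_].
  change (fence_path (0 : R) i != 0 -> zigzag (U, T, i) = U); rewrite fence_path0.
  by have [->|_] := eqVneq i ord0; rewrite ?eqxx // zigzag_start.
rewrite -realization_map_comp.
have t01 : 0 <= (0 : R) <= 1 by apply/andP; split; lra.
rewrite (realization_map_coupling_fst r2 fence_refl fence_anti fence_trans
  (joint_realization Rp) (fence_path_realization t01)).
exact: (realization_map_coupling_fst (@Hom_le_refl n k) (@Hom_le_refl n k)
  (@Hom_le_anti n k) (@Hom_le_trans n k) (fh_realization Rp) Rp).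
Qed.

Lemma hom_homotopy1 p : HomR p -> hom_homotopy (1, p) = p.
Proof.
move=> Rp; have [r2 a2 t2] := prod_Hom_le_order; rewrite /hom_homotopy /=.
rewrite (@eq_realization_map _ _ _ _ (snd \o fst)); last first.
  move=> [[U T] i] /coupling_supp[_].
  change (fence_path (1 : R) i != 0 -> zigzag (U, T, i) = T); rewrite fence_path1.
  by have [->|_] := eqVneq i ord_max; rewrite ?eqxx // zigzag_end.
rewrite -realization_map_comp.
have t01 : 0 <= (1 : R) <= 1 by apply/andP; split; lra.
rewrite (realization_map_coupling_fst r2 fence_refl fence_anti fence_trans
  (joint_realization Rp) (fence_path_realization t01)).
exact: (realization_map_coupling_snd (@Hom_le_refl n k) (@Hom_le_anti n k)
  (@Hom_le_trans n k) (@Hom_le_refl n k) (fh_realization Rp) Rp).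
Qed.

Lemma hom_homotopy_continuous :
  {within `[0, 1] `*` HomR, continuous hom_homotopy}.
Proof.
apply/subspace_continuousP => -[t p] [/= t01 Rp].
have cp : snd @ within (`[0, 1] `*` HomR) (nbhs (t, p)) --> p.
  exact: cvg_snd_prod.
have ct : fst @ within (`[0, 1] `*` HomR) (nbhs (t, p)) --> t.
  exact: cvg_fst_prod.
apply: (@cvg_comp _ _ _ (fun z => coupling (prod_le hle hle) fence_le
    (joint z.2) (fence_path z.1)) (realization_map (@zigzag n k)) _
  (nbhs (coupling (prod_le hle hle) fence_le (joint p) (fence_path t)))).
  apply: cvg_coupling.
    apply: cvg_coupling => //.
    apply: (@cvg_comp _ _ _ snd (f \o h) _ (within HomR (nbhs p))).
      exact: cvg_snd_within.
    by have /subspace_continuousP/(_ p Rp) := fh_continuous.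
  apply: (@cvg_comp _ _ _ fst (@fence_path R) _ (nbhs t)) => //.
  exact: fence_path_continuous.
exact: realization_map_continuous.
Qed.

End Homotopies.


(** * Equivariance *)

Section Symmetry.
Variables (R : realType) (n k : nat).
Hypothesis n_gt0 : (0 < n)%N.
Local Notation m := (2 * n + k)%N.
Local Notation C := (R[i]^o).
Local Notation V := 'rV[C]_(k./2).+1.
Variable b : sign_vector m -> V.
Hypothesis hb : barycenters b.
Implicit Types (x y : V) (j : 'Z_m) (s : sign_vector m).
Local Notation L := (L R n k).
Local Notation le := (@sign_le m).
Local Notation HomT := {ffun K2 -> {set SG n k}}.
Local Notation HomP := (Defs.Hom K2 (SG n k)).
Local Notation hle := (@Hom_le K2 (SG n k)).
Local Notation HomR := (@Hom_realization R n k).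
Local Notation f := (f_map b).
Local Notation h := (to_sphere b).
Local Notation inv := (inv_subdivision b).
Implicit Types (T U : HomT).

Variables (w : V -> V) (e : SG n k -> SG n k) (a : 'Z_m -> 'Z_m).

(* A generator of the dihedral group, acting on W by w, on the vertices of SG
   by e, and on Z/m by the inverse of a. *)
Record generator : Prop := Generator {
  wD : forall x y, w (x + y) = w x + w y;
  wZ : forall (c : R) x, w (c%:C%C *: x) = c%:C%C *: w x;
  w_inner : forall x y, inner (w x) (w y) = inner x y;
  w_sphere : forall x, sphereW R k x -> sphereW R k (w x);
  w_alt : forall j x, alt j (w x) = alt (a j) x;
  a_inj : injective a;
  mem_e : forall S j, (j \in val (e S)) = (a j \in val S);
  b_w : forall x, sphereW R k x -> b (sgnvec n (w x)) = w (b (sgnvec n x)) }.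

Hypothesis gen : generator.

Lemma w0 : w 0 = 0.
Proof. by have := (wZ gen) 0 0; rewrite scaler0 => ->; rewrite scale0r. Qed.

Lemma w_sum (I : Type) (r : seq I) (P : pred I) (y : I -> V) :
  w (\sum_(i <- r | P i) y i) = \sum_(i <- r | P i) w (y i).
Proof. exact: (big_morph w (wD gen) w0). Qed.

Lemma w_normalize x : normalize (w x) = w (normalize x).
Proof. by rewrite !normalizeE (wZ gen) /scal (w_inner gen). Qed.

Lemma a_surj j : exists i, a i = j.
Proof. by have [a' aK a'K] := injF_bij (a_inj gen); exists (a' j). Qed.

Lemma e_inj : injective e.
Proof.
move=> S S' eS; apply/val_inj/setP => j; have [i <-] := a_surj j.
by rewrite -!(mem_e gen) eS.
Qed.

Lemma e_surj S : exists S', e S' = S.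
Proof. by have [e' eK e'K] := injF_bij e_inj; exists (e' S). Qed.

(** The action on cells, computed through the representative b(s) instead of by a formula on signs;
    it is meaningful on [L] only. *)
Definition cell_act s : sign_vector m := sgnvec n (w (b s)).

Lemma cell_act_L s : s \in L -> cell_act s \in L.
Proof. by move=> sL; apply/mem_L/(w_sphere gen)/b_sphere. Qed.

Lemma b_cell_act s : s \in L -> b (cell_act s) = w (b s).
Proof. by move=> sL; rewrite /cell_act (b_w gen) ?b_sgn //; exact: b_sphere. Qed.

Lemma alt_cell_act s j : s \in L -> alt j (b (cell_act s)) = alt (a j) (b s).
Proof. by move=> sL; rewrite b_cell_act // (w_alt gen). Qed.

Lemma cell_act_le s t : s \in L -> t \in L -> le s t ->
  le (cell_act s) (cell_act t).
Proof.
move=> sL tL st; apply/sign_leP => j; rewrite !(w_alt gen).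
exact: (sign_le_b hb sL tL st (a j)).
Qed.

Lemma cell_act_inj : {in L &, injective cell_act}.
Proof.
move=> s t sL tL est; rewrite -(b_sgn hb sL) -(b_sgn hb tL).
have alt_eq j : alt j (b s) = alt j (b t).
  by have [i <-] := a_surj j; rewrite -!alt_cell_act // est.
by apply: sgnvec_eq => j; rewrite alt_eq.
Qed.

Lemma cell_act_imset : cell_act @: L = L.
Proof.
apply/eqP; rewrite eqEcard (card_in_imset cell_act_inj) leqnn andbT.
by apply/fintype.subsetP => _ /imsetP[s sL ->]; exact: cell_act_L.
Qed.

Lemma inv_subdivision_act x : sphereW R k x ->
  inv (w x) = realization_map cell_act (inv x).
Proof.
move=> Sx; have Rx := inv_subdivision_realization n_gt0 hb Sx.
have [_ _ xL _] := Rx.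
(* Both sides are compared after [subdivision], where the claim becomes that [comb] intertwines
   [cell_act] and [w]. *)
rewrite -{1}(inv_subdivisionK n_gt0 hb Sx) -[RHS](subdivisionK n_gt0 hb).
  congr inv_subdivision; rewrite !subdivisionE -w_normalize; congr normalize.
  rewrite /comb w_sum
    (@sum_realization_map R _ _ _ _ _ (fun u (r : R) => r%:C%C *: b u)).
  - apply: eq_bigr => s _; rewrite (wZ gen); have [->|xs] := eqVneq (inv x s) 0.
      by rewrite !scale0r.
    by rewrite b_cell_act // xL.
  - by move=> u r1 r2; rewrite rmorphD scalerDl.
  - by move=> u; rewrite scale0r.
apply: realization_map_stable Rx; [exact: cell_act_L|exact: cell_act_le].
Qed.

Lemma g_map_act s : s \in L -> g_map (cell_act s) = Hom_map e (g_map s).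
Proof.
move=> sL; have cL := cell_act_L sL; apply/ffunP => l; rewrite [RHS]ffunE.
apply/setP => S; have [S' <-] := e_surj S; rewrite (mem_imset _ _ e_inj).
have h0 (c : R -> bool) : (forall j, j \in val (e S') -> c (alt j (b (cell_act s)))) <->
    (forall j, j \in val S' -> c (alt j (b s))).
  split=> H j; last by rewrite (mem_e gen) alt_cell_act //; exact: H.
  by have [i <-] := a_surj j; rewrite -(mem_e gen) -alt_cell_act //; exact: H.
have /= hp := h0 (fun r => 0 < r); have /= hn := h0 (fun r => r < 0).
case: (ord2_cases l) => ->.
  apply/(g_map0P hb _ cL)/(g_map0P hb _ sL); first by move/hp.
  by move/hp.
apply/(g_map1P hb _ cL)/(g_map1P hb _ sL); first by move/hn.
by move/hn.
Qed.

Lemma f_map_act x : sphereW R k x ->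
  f (w x) = realization_map (Hom_map e) (f x).
Proof.
move=> Sx; have Rx := inv_subdivision_realization n_gt0 hb Sx.
have [_ _ xL _] := Rx.
transitivity (realization_map (@g_map n k \o cell_act) (inv x)).
  rewrite -realization_map_comp -inv_subdivision_act //.
transitivity (realization_map (Hom_map e \o @g_map n k) (inv x)).
  by apply: eq_realization_map => s /xL; exact: g_map_act.
by rewrite -realization_map_comp.
Qed.

Lemma covers_act T j : covers (Hom_map e T) j = covers T (a j).
Proof.
apply/coversP/coversP => [[S]|[S ST jS]].
  by rewrite ffunE => /imsetP[S' S'T ->]; rewrite (mem_e gen); exists S'.
by exists (e S); rewrite ?(mem_e gen) // ffunE imset_f.
Qed.

Lemma cells_over_act T : cells_over b (Hom_map e T) = cell_act @: cells_over b T.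
Proof.
apply/setP => s; apply/cells_overP/imsetP => [[sL H]|[t /cells_overP[tL H] ->]].
  move: sL H; rewrite -{1}cell_act_imset => /imsetP[t tL ->] H.
  exists t => //; apply/cells_overP; split=> // j.
  have [i <-] := a_surj j; rewrite -covers_act => /H.
  by rewrite alt_cell_act.
split; first exact: cell_act_L.
by move=> j; rewrite covers_act alt_cell_act //; exact: H.
Qed.

Lemma cone_point_act T : cone_point b (Hom_map e T) = w (cone_point b T).
Proof.
rewrite /cone_point cells_over_act big_imset /=.
  rewrite w_sum; apply: eq_bigr => s /cells_overP[sL _]; exact: b_cell_act.
by move=> s t /cells_overP[sL _] /cells_overP[tL _]; exact: cell_act_inj.
Qed.

Lemma to_sphere_act p : h (realization_map (Hom_map e) p) = w (h p).
Proof.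
rewrite /to_sphere -w_normalize; congr normalize.
rewrite /cone_sum w_sum
  (@sum_realization_map R _ _ _ _ _ (fun u (r : R) => r%:C%C *: cone_point b u)).
- by apply: eq_bigr => T _; rewrite (wZ gen) cone_point_act.
- by move=> u r1 r2; rewrite rmorphD scalerDl.
- by move=> u; rewrite scale0r.
Qed.

Lemma sphere_homotopy_act (t : R) x : sphereW R k x ->
  sphere_homotopy b (t, w x) = w (sphere_homotopy b (t, x)).
Proof.
move=> Sx; rewrite /sphere_homotopy /= -w_normalize (wD gen).
rewrite (wZ gen _ (h (f x))) (wZ gen _ x).
by rewrite f_map_act // to_sphere_act.
Qed.

Lemma Hom_map_inj : injective (Hom_map e : HomT -> HomT).
Proof.
move=> T U eTU; apply/ffunP => l.
have := congr1 (fun F : HomT => F l) eTU; rewrite !ffunE.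
exact: (imset_inj e_inj).
Qed.

Lemma Hom_map_mono : {mono (Hom_map e : HomT -> HomT) : T U / hle T U}.
Proof.
move=> T U; apply/idP/idP; last exact: Hom_map_le.
move=> /forallP H; apply/forallP => l; have := H l; rewrite !ffunE.
move=> /fintype.subsetP Hs; apply/fintype.subsetP => S ST.
by rewrite -(mem_imset _ _ e_inj); apply/Hs/imset_f.
Qed.

Lemma zigzag_act U T i :
  zigzag (Hom_map e U, Hom_map e T, i) = Hom_map e (zigzag (U, T, i)).
Proof.
apply/ffunP => l; rewrite !ffunE.
have ifE (c : bool) (A : {set SG n k}) : (if c then e @: A else finset.set0) =
    e @: (if c then A else finset.set0) by case: c => //; rewrite imset0.
by case: (ord2_cases l) => -> /=; rewrite imsetU -!ifE.
Qed.

Lemma joint_act p : HomR p -> joint b (realization_map (Hom_map e) p) =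
  realization_map (fun z => (Hom_map e z.1, Hom_map e z.2)) (joint b p).
Proof.
move=> Rp; rewrite /joint to_sphere_act f_map_act; last exact: to_sphere_sphere.
apply: coupling_map; [exact: Hom_map_inj|exact: Hom_map_inj|
  exact: Hom_map_mono|exact: Hom_map_mono].
Qed.

Lemma hom_homotopy_act (t : R) p : HomR p ->
  hom_homotopy b (t, realization_map (Hom_map e) p) =
  realization_map (Hom_map e) (hom_homotopy b (t, p)).
Proof.
move=> Rp; rewrite /hom_homotopy /= joint_act //.
(* The group fixes the fence; writing its measure as a push-forward under the identity makes
   naturality of the coupling applicable. *)
rewrite -{1}(realization_map_id (fence_path t)) coupling_map //.
- rewrite !realization_map_comp; congr realization_map.
  by apply/funext => -[[U T] i] /=; exact: zigzag_act.
- by move=> [U T] [U' T'] [/Hom_map_inj -> /Hom_map_inj ->].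
- by move=> [U T] [U' T']; rewrite /prod_le /= !Hom_map_mono.
Qed.

End Symmetry.

Section Generators.
Variables (R : realType) (n k : nat).
Hypothesis n_gt0 : (0 < n)%N.
Local Notation m := (2 * n + k)%N.
Local Notation C := (R[i]^o).
Local Notation V := 'rV[C]_(k./2).+1.
Implicit Types (x y : V) (j : 'Z_m).

Lemma W_sigmaD x y : W_sigma n (x + y) = W_sigma n x + W_sigma n y.
Proof. by apply/rowP => t; rewrite !mxE mulrDr opprD. Qed.

Lemma W_sigmaZ (c : R) x : W_sigma n (c%:C%C *: x) = c%:C%C *: W_sigma n x.
Proof. by apply/rowP => t; rewrite !mxE mulrN mulrCA. Qed.

Lemma W_rhoD x y : W_rho (x + y) = W_rho x + W_rho y.
Proof. by apply/rowP => t; rewrite !mxE rmorphD. Qed.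

Lemma W_rhoZ (c : R) x : W_rho (c%:C%C *: x) = c%:C%C *: W_rho x.
Proof.
apply/rowP => t; rewrite !mxE; case: (x 0 t) => u v.
by apply/eqP; rewrite eq_complex /=; apply/andP; split; apply/eqP; ring.
Qed.

Lemma sigma_generator (b : sign_vector m -> V) : barycenters b ->
  generator b (W_sigma n) (@SG_sigma n k) (fun j => j - 1).
Proof.
move=> [_ hb]; split.
- exact: W_sigmaD.
- exact: W_sigmaZ.
- exact: inner_sigma.
- exact: W_sigma_stable.
- by move=> j x; rewrite -{1}[j](subrK 1) alt_sigma.
- exact: addIr.
- exact: mem_SG_sigma.
- by move=> x /hb[].
Qed.

Lemma rho_generator (b : sign_vector m -> V) : barycenters b ->
  generator b (@W_rho R k) (@SG_rho n k) (fun j => - j).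
Proof.
move=> [_ hb]; split.
- exact: W_rhoD.
- exact: W_rhoZ.
- exact: inner_rho.
- exact: W_rho_stable.
- by move=> j x; rewrite -{1}[j]opprK alt_rho.
- exact: oppr_inj.
- exact: mem_SG_rho.
- by move=> x /hb[].
Qed.

End Generators.

Theorem theorem5p1 (R : realType) (n k : nat) (n_gt0 : (0 < n)%N)
    (b : sign_vector (2 * n + k) -> 'rV[(R[i])^o]_(k./2).+1)
    (b_barycenters : barycenters b) :
  equivariant_homotopy_equivalence R
    (sphere_space R k n_gt0) (hom_space R k n_gt0) (f_map b).
Proof.
have gs := sigma_generator n_gt0 b_barycenters.
have gr := rho_generator n_gt0 b_barycenters.
split.
  split; [exact: f_map_Hom|exact: f_map_continuous|].
  by move=> x Sx; split; [exact: (f_map_act _ _ gs)|exact: (f_map_act _ _ gr)].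
exists (to_sphere b); split.
- split; [exact: to_sphere_sphere|exact: to_sphere_continuous|].
  by move=> p Rp; split; [exact: (to_sphere_act _ gs p)|exact: (to_sphere_act _ gr p)].
- exists (sphere_homotopy b); split.
  + exact: sphere_homotopy_continuous.
  + move=> x Sx; rewrite /sphere_homotopy /= subr0 scale1r scale0r addr0.
    by apply: normalize_id; apply: to_sphere_sphere => //; exact: f_map_Hom.
  + move=> x Sx; rewrite /sphere_homotopy /= subrr scale0r scale1r add0r.
    exact: normalize_id.
  + move=> t x t01 Sx; apply: normalize_sphere.
      apply: WD; apply: WZ; last by case: Sx.
      by have [] := to_sphere_sphere n_gt0 b_barycenters
        (f_map_Hom n_gt0 b_barycenters Sx).
    by apply: sphere_homotopy_neq0 => //; move: t01; rewrite !inE /= ?in_itv.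
  + move=> t t01 x Sx.
    by split; [exact: (sphere_homotopy_act _ _ gs)|exact: (sphere_homotopy_act _ _ gr)].
exists (hom_homotopy b); split.
- exact: hom_homotopy_continuous.
- exact: hom_homotopy0.
- exact: hom_homotopy1.
- move=> t p t01 Rp; apply: hom_homotopy_points => //.
  by move: t01; rewrite !inE /= ?in_itv.
- move=> t t01 p Rp.
  by split; [exact: (hom_homotopy_act _ _ gs)|exact: (hom_homotopy_act _ _ gr)].
Qed.
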